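(* Let $\Sigma$ be an arbitrary origami surface, equipped with its length metric and its Lebesgue-induced measure (normalised to a probability measure). Then the free group $\mathbb{F}_2$ of rank $2$ admits a measure-preserving action by Lipschitz homeomorphisms on $\Sigma$ that is expanding in measure. Equivalently, this action $\mathbb{F}_2 \curvearrowright \Sigma$ has spectral gap.
   Context: Origami surfaces. An origami datum is a triple $(m,\sigma,\tau)$ with $m$ a positive integer and $\sigma,\tau$ permutations of $\{1,\dots,m\}$ generating a group acting transitively on $\{1,\dots,m\}$. The associated origami surface $\Sigma$ is obtained from copies $P_1,\dots,P_m$ of $[0,1]^2$, with identifying homeomorphisms $\rho_i\colon P_i\to[0,1]^2$, by gluing, for every $i$, the left side of $P_i$ to the right side of $P_{\sigma(i)}$ and the top side of $P_i$ to the bottom side of $P_{\tau(i)}$, in both cases by translation. $\Sigma$ is a connected closed orientable surface; it carries the length metric induced by the Euclidean length of paths on the squares, and the measure given by Lebesgue measure on each square (total mass $m$, normalised to mass $1$ when a probability measure is needed). Let $G$ be a group with a finite symmetric generating set $S$ containing $1_G$. A measure-preserving action of $G$ on a probability space $(X,\mu)$ is expanding in measure if there is $c>0$ such that $\mu\big(\bigcup_{s\in S}s.U\big)\geqslant(1+c)\mu(U)$ for every measurable $U\subseteq X$ with $0<\mu(U)\leqslant\frac12\mu(X)$. It has spectral gap if there is $\kappa>0$ such that $\sum_{s\in S}\|s.f-f\|_2\geqslant\kappa\|f\|_2$ for every $f\in L^2(X,\mu)$ of mean zero, where $(g.f)(x)=f(g^{-1}x)$. Both properties are independent of the choice of $S$,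 and they are equivalent for probability-measure-preserving actions. *)

(* Defs.v *)
From HB Require Import structures.
From mathcomp Require Import all_boot all_order all_algebra all_fingroup.
From mathcomp Require Import finmap lra.
From mathcomp Require Import all_classical all_reals all_analysis.
From mathcomp Require Import measurable_realfun.
From Stdlib Require Import Relation_Operators.

Set Implicit Arguments.
Unset Strict Implicit.
Unset Printing Implicit Defensive.

Import Order.TTheory GRing.Theory Num.Theory.
Import numFieldNormedType.Exports.

Local Open Scope classical_set_scope.
Local Open Scope ring_scope.

(* Elements are reduced words over the letters [(a, true)] = a and
   [(a, false)] = a^-1. *)
Section FreeGroup.
Variable T : choiceType.

Definition letter : Type := (T * bool)%type.
Definition letter_inv (l : letter) : letter := (l.1, ~~ l.2).
Definition reduced (w : seq letter) : bool :=
  sorted (fun l l' => l' != letter_inv l) w.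

Definition free_group : Type := {w : seq letter | reduced w}.
HB.instance Definition _ := Choice.on free_group.

Definition word_push (l : letter) (w : seq letter) : seq letter :=
  if w is l' :: w' then if l' == letter_inv l then w' else l :: w else [:: l].
Definition word_mul (u v : seq letter) : seq letter := foldr word_push v u.
Definition word_inv (u : seq letter) : seq letter := rev (map letter_inv u).

Lemma letter_invK : involutive letter_inv.
Proof. by case=> a b; rewrite /letter_inv /= negbK. Qed.

Lemma reduced_cons l w : reduced (l :: w) -> reduced w.
Proof. by case: w => [|l' w] //= /andP[]. Qed.

Lemma word_push_reduced l w : reduced w -> reduced (word_push l w).
Proof.
case: w => [|l' w] //= rw; case: ifPn => [_|nl]; first exact: (@reduced_cons l').
by rewrite /= nl.
Qed.

Lemma word_mul_reduced u v : reduced v -> reduced (word_mul u v).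
Proof. by move=> rv; elim: u => //= l u; exact: word_push_reduced. Qed.

Lemma word_inv_reduced u : reduced u -> reduced (word_inv u).
Proof.
rewrite /word_inv /reduced rev_sorted sorted_map; apply: sub_sorted => l l' /=.
apply: contraNneq => /(canRL letter_invK); rewrite letter_invK.
by move/(congr1 letter_inv); rewrite letter_invK => ->.
Qed.

Lemma word_pushK l w : reduced w -> word_push l (word_push (letter_inv l) w) = w.
Proof.
case: w => [|l' w] /=; first by rewrite eqxx.
rewrite letter_invK; case: eqP => [->|_] rw /=; last by rewrite eqxx.
case: w rw => [|l'' w] //= /andP[/negPf nl _]; by rewrite nl.
Qed.

Lemma word_mul_push l x w : reduced w ->
  word_mul (word_push l x) w = word_push l (word_mul x w).
Proof.
move=> rw; case: x => [|l' x] //=; case: eqP => //= ->.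
by rewrite word_pushK// word_mul_reduced.
Qed.

Lemma word_mulA u v w : reduced w ->
  word_mul u (word_mul v w) = word_mul (word_mul u v) w.
Proof. by move=> rw; elim: u => //= l u ->; rewrite word_mul_push. Qed.

Lemma word_mulw1 w : reduced w -> word_mul w [::] = w.
Proof.
elim: w => //= l w IH rw; rewrite IH ?(reduced_cons rw)//.
by case: w rw {IH} => //= l' w /andP[/negPf ->].
Qed.

Lemma word_mulVw u : word_mul (word_inv u) u = [::].
Proof.
elim: u => // l u IH; rewrite /word_inv /= rev_cons /word_mul foldr_rcons /=.
by rewrite letter_invK eqxx.
Qed.

Lemma word_invK : involutive word_inv.
Proof. by move=> u; rewrite /word_inv map_rev revK mapK//; exact: letter_invK. Qed.

Definition free_one : free_group := exist _ [::] isT.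
Definition free_mul (u v : free_group) : free_group :=
  exist _ (word_mul (val u) (val v)) (word_mul_reduced (val u) (valP v)).
Definition free_inv (u : free_group) : free_group :=
  exist _ (word_inv (val u)) (word_inv_reduced (valP u)).

Lemma free_mulA : associative free_mul.
Proof. by move=> u v w; apply/val_inj/word_mulA/valP. Qed.
Lemma free_mul1 : left_id free_one free_mul.
Proof. by move=> u; exact/val_inj. Qed.
Lemma free_mulr1 : right_id free_one free_mul.
Proof. by move=> u; apply/val_inj/word_mulw1/valP. Qed.
Lemma free_mulV : left_inverse free_one free_inv free_mul.
Proof. by move=> u; apply/val_inj/word_mulVw. Qed.
Lemma free_mulrV : right_inverse free_one free_inv free_mul.
Proof.
by move=> u; apply/val_inj; rewrite /= -{1}[val u]word_invK word_mulVw.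
Qed.

HB.instance Definition _ := isGroup.Build free_group
  free_mulA free_mul1 free_mulr1 free_mulV free_mulrV.

End FreeGroup.

Definition group_action (G : groupType) (X : Type) (act : G -> X -> X) : Prop :=
  (forall x, act 1%g x = x) /\
  (forall g h x, act (g * h)%g x = act g (act h x)).

Definition homeomorphism (X Y : topologicalType) (f : X -> Y) : Prop :=
  exists g : Y -> X,
    [/\ cancel f g, cancel g f, continuous f & continuous g].

Definition lipschitz_map (R : realType) (X : Type) (d : X -> X -> \bar R)
    (f : X -> X) : Prop :=
  exists L : R, forall x y, (d (f x) (f y) <= L%:E * d x y)%E.

Definition measure_preserving (R : realType) (disp : measure_display)
    (X : measurableType disp) (mu : {measure set X -> \bar R}) (f : X -> X)
  : Prop :=
  measurable_fun [set: X] f /\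
  forall A, measurable A -> mu (f @^-1` A) = mu A.

(* As the set is symmetric, the generated subgroup consists of the finite products
   of elements of the set. *)
Definition symmetric_generating_set (G : groupType) (S : {fset G}) : Prop :=
  [/\ 1%g \in S,
      forall s, s \in S -> (s^-1)%g \in S &
      forall g, exists2 w : seq G,
        {subset w <= S} & g = (\prod_(x <- w) x)%g].

Definition expanding_in_measure (R : realType) (G : groupType) (S : {fset G})
    (disp : measure_display) (X : measurableType disp)
    (mu : {measure set X -> \bar R}) (act : G -> X -> X) : Prop :=
  exists2 c : R, 0 < c &
    forall U : set X, measurable U ->
      (0 < mu U)%E -> (mu U <= 2^-1%:E * mu [set: X])%E ->
      ((1 + c)%:E * mu U <= mu (\bigcup_(s in [set` S]) (act s @` U)))%E.

Definition translate (R : realType) (G : groupType) (X : Type)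
    (act : G -> X -> X) (g : G) (f : X -> R) : X -> R :=
  fun x => f (act g^-1%g x).

(* The gap is stated on real-valued functions; splitting into real and imaginary
   parts gives the complex-valued version, up to the value of [kappa]. *)
Definition spectral_gap (R : realType) (G : groupType) (S : {fset G})
    (disp : measure_display) (X : measurableType disp)
    (mu : {measure set X -> \bar R}) (act : G -> X -> X) : Prop :=
  exists2 kappa : R, 0 < kappa &
    forall f : X -> R, f \in Lfun mu 2%:E -> (\int[mu]_x (f x)%:E = 0)%E ->
      (kappa%:E * 'N[mu]_2%:E[EFin \o f] <=
       \sum_(s <- S) 'N[mu]_2%:E[EFin \o (translate act s f \- f)%R])%E.

Record origami_datum := OrigamiDatum {
  nsquares : nat;
  nsquares_gt0 : (0 < nsquares)%N;
  origami_sigma : {perm 'I_nsquares};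
  origami_tau : {perm 'I_nsquares};
  origami_transitive :
    [transitive <<[set origami_sigma; origami_tau]%SET>>%g,
      on [set: 'I_nsquares]%SET | 'P] }.

Definition unit_square (R : realType) : set (R * R) := `[0, 1] `*` `[0, 1].
Arguments unit_square R : clear implicits.

Section Surface.
Variables (R : realType) (O : origami_datum).

Definition squares : Type := {_ : 'I_(nsquares O) & unit_square R}.
HB.instance Definition _ := Topological.on squares.

Definition coord (u : squares) : R * R := set_val (projT2 u).

(* Left side of P_i to right side of P_(sigma i); top side of P_i to bottom
   side of P_(tau i). *)
Definition glue (u v : squares) : Prop :=
  [/\ projT1 v = origami_sigma O (projT1 u),
      (coord u).1 = 0, (coord v).1 = 1 & (coord v).2 = (coord u).2] \/
  [/\ projT1 v = origami_tau O (projT1 u),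
      (coord u).2 = 1, (coord v).2 = 0 & (coord v).1 = (coord u).1].

Definition glue_equiv (u v : squares) : bool :=
  `[< clos_refl_sym_trans _ glue u v >].

Lemma glue_equiv_refl : reflexive glue_equiv.
Proof. by move=> u; apply/asboolP; exact: rst_refl. Qed.
Lemma glue_equiv_sym : symmetric glue_equiv.
Proof. by move=> u v; apply/asbool_equiv_eq; split; exact: rst_sym. Qed.
Lemma glue_equiv_trans : transitive glue_equiv.
Proof.
move=> v u w /asboolP uv /asboolP vw; apply/asboolP; exact: rst_trans uv vw.
Qed.

Canonical glue_equivRel :=
  EquivRel glue_equiv glue_equiv_refl glue_equiv_sym glue_equiv_trans.

(* The quotient topology is also the topology of [length_dist] below. *)
Definition surface : Type := quotient_topology {eq_quot glue_equivRel}%qT.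
HB.instance Definition _ := Topological.on surface.
HB.instance Definition _ := Quotient.on surface.

Definition chart (i : 'I_(nsquares O)) (p : unit_square R) : surface :=
  (\pi_surface (existT _ i p : squares))%qT.

Lemma unit_square00 : (0, 0) \in unit_square R.
Proof. by rewrite inE; split; rewrite /= in_itv /= lexx ler01. Qed.

HB.instance Definition _ := isPointed.Build surface
  (chart (Ordinal (nsquares_gt0 O)) (exist _ (0, 0) unit_square00)).

HB.instance Definition _ := @isMeasurable.Build
  (sigma_display (@open surface)) surface <<s @open surface >>
  (@sigma_algebra0 _ setT (@open surface)) (@sigma_algebraC _ (@open surface))
  (@sigma_algebra_bigcup _ setT (@open surface)).

Lemma open_plane_measurable (V : set (R * R)) : open V ->
  measurable (V : set (measurableTypeR R * measurableTypeR R)).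
Proof.
move=> oV.
pose B (a b e : rat) : set (measurableTypeR R * measurableTypeR R) :=
  (ball (ratr a : R) (ratr e : R) : set R) `*`
  (ball (ratr b : R) (ratr e : R) : set R).
have mball (a b e : rat) : measurable (B a b e).
  by apply: measurableX; exact: open_measurable (ball_open _ _).
have -> : V = \bigcup_a \bigcup_b \bigcup_e
    (if `[< B a b e `<=` V >] then B a b e else set0).
  apply/seteqP; split => [[x y] Vxy|p [a _ [b _ [e _]]]]; last first.
    by case: asboolP => // + Bp; exact.
  have /nbhs_ballP[e /= e0 exyV] : nbhs (x, y) V by exact: open_nbhs_nbhs.
  have [r] := @rat_in_itvoo R 0 (e / 2) (divr_gt0 e0 (ltr0n _ 2)).
  rewrite in_itv /= => /andP[r0 re].
  have near_rat (z : R) : exists q : rat, `|z - ratr q| < ratr r.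
    have [|q] := @rat_in_itvoo R (z - ratr r) (z + ratr r); first by lra.
    by rewrite in_itv /= => /andP[q1 q2]; exists q; rewrite ltr_norml; lra.
  have [[a xa] [b yb]] := (near_rat x, near_rat y).
  exists a => //; exists b => //; exists r => //.
  case: asboolP => [_|[]].
    by split; rewrite /ball /= distrC.
  move=> [u v] [/= au bv]; apply: exyV; split => /=.
    by move: au xa; rewrite /ball /= => au xa;
      rewrite -(subrKA (ratr a)) (le_lt_trans (ler_normD _ _))//; lra.
  by move: bv yb; rewrite /ball /= => bv yb;
    rewrite -(subrKA (ratr b)) (le_lt_trans (ler_normD _ _))//; lra.
apply: bigcupT_measurable_rat => a; apply: bigcupT_measurable_rat => b.
by apply: bigcupT_measurable_rat => e; case: ifP.
Qed.

Lemma unit_square_measurable :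
  measurable (unit_square R : set (measurableTypeR R * measurableTypeR R)).
Proof. by apply: measurableX; exact: measurable_itv. Qed.

Lemma chart_continuous i : continuous (chart i).
Proof.
move=> p; apply: (@continuous_comp _ _ _
  (fun p : unit_square R => existT _ i p : squares) (\pi_surface)%qT).
  exact: existT_continuous.
exact: (@pi_continuous squares {eq_quot glue_equivRel}%qT).
Qed.

Definition square_part (i : 'I_(nsquares O)) (A : set surface) :
    set (measurableTypeR R * measurableTypeR R) :=
  set_val @` (chart i @^-1` A).

Lemma square_partC i A : square_part i (~` A) = unit_square R `\` square_part i A.
Proof.
apply/seteqP; split => [_ [p nA <-]|x [sqx nAx]].
  split; first exact: set_valP.
  by move=> [q Aq /val_inj qp]; apply: nA; rewrite -qp.
exists (exist _ x (mem_set sqx)) => //= Ax; apply: nAx.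
by exists (exist _ x (mem_set sqx)).
Qed.

Lemma square_part_bigcup i (F : (set surface)^nat) :
  square_part i (\bigcup_n F n) = \bigcup_n square_part i (F n).
Proof. by rewrite /square_part preimage_bigcup image_bigcup. Qed.

Lemma square_part_measurable i A : measurable A -> measurable (square_part i A).
Proof.
suff H : <<s @open surface >> `<=` [set A | measurable (square_part i A)].
  exact: H.
apply: smallest_sub => [|{}A oA]; first split.
- by rewrite /= /square_part preimage_set0 image_set0; exact: measurable0.
- move=> B mB; rewrite /= setTD square_partC.
  exact: measurableD unit_square_measurable mB.
- by move=> F mF; rewrite /= square_part_bigcup; apply: bigcup_measurable => k _; exact: mF.
have /continuousP/(_ _ oA) [V oV VA] := @chart_continuous i.
rewrite /= [X in measurable X](_ : _ = unit_square R `&` V).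
  exact: measurableI unit_square_measurable (open_plane_measurable oV).
rewrite /square_part -VA; apply/seteqP; split => [_ [p Vp <-]|x [sqx Vx]].
  by split => //; exact: set_valP.
by exists (exist _ x (mem_set sqx)).
Qed.

Definition square_area (i : 'I_(nsquares O)) (A : set surface) : \bar R :=
  (lebesgue_measure \x lebesgue_measure)%E (square_part i A).

Let square_area0 i : square_area i set0 = 0%E.
Proof.
by rewrite /square_area /square_part preimage_set0 image_set0 measure0.
Qed.

Let square_area_ge0 i A : (0 <= square_area i A)%E.
Proof. exact: measure_ge0. Qed.

Let square_area_sigma_additive i : semi_sigma_additive (square_area i).
Proof.
move=> F mF tF mUF; rewrite /square_area square_part_bigcup.
apply: measure_semi_sigma_additive.
- by move=> n; exact: square_part_measurable.
- apply/trivIsetP => m n _ _ mn; apply/seteqP; split => // x.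
  move=> [[p Fp <-] [q Fq /val_inj qp]].
  have /trivIsetP/(_ m n I I mn)/seteqP[+ _] := tF.
  by move/(_ (chart i p)); apply; split => //; rewrite -qp.
- by rewrite -square_part_bigcup; exact: square_part_measurable.
Qed.

HB.instance Definition _ i := isMeasure.Build _ _ _ (square_area i)
  (square_area0 i) (square_area_ge0 i) (@square_area_sigma_additive i).

Definition area (A : set surface) : \bar R := (\sum_i square_area i A)%E.

Let area0 : area set0 = 0%E.
Proof. by rewrite /area big1. Qed.

Let area_ge0 A : (0 <= area A)%E.
Proof. exact: sume_ge0. Qed.

Let area_sigma_additive : semi_sigma_additive area.
Proof.
move=> F mF tF mUF; rewrite [X in _ --> X](_ : _ =
    lim ((fun n => \sum_(0 <= k < n) area (F k))%E @ \oo)).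
  by apply: is_cvg_ereal_nneg_natsum => k _; exact: sume_ge0.
rewrite nneseries_sum//; apply: eq_bigr => /= i _.
exact: measure_semi_bigcup.
Qed.

HB.instance Definition _ := isMeasure.Build _ _ _ area
  area0 area_ge0 area_sigma_additive.

Lemma area_setT : area [set: surface] = (nsquares O)%:R%:E.
Proof.
have square_area1 i : square_area i [set: surface] = 1%E.
  rewrite /square_area (_ : square_part _ _ = `[0, 1] `*` `[0, 1]); last first.
    apply/seteqP; split => [_ [p _ <-]|x sqx]; first exact: (set_valP p).
    by exists (exist _ x (mem_set sqx)).
  have I1 : lebesgue_measure (`[0, 1] : set R) = 1%E.
    by rewrite lebesgue_measure_itv /= lte_fin ltr01 oppr0 adde0.
  rewrite product_measure1E; [|exact: measurable_itv|exact: measurable_itv].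
  by rewrite -[RHS]mul1e; congr (_ * _)%E.
rewrite /area (eq_bigr (fun=> 1%E)) => [|i _]; last exact: square_area1.
by rewrite sumEFin sumr_const card_ord.
Qed.

Definition surface_measure : set surface -> \bar R :=
  mscale ((nsquares O)%:R^-1)%:nng area.

HB.instance Definition _ := Measure.on surface_measure.

Let surface_measure_setT : surface_measure [set: surface] = 1%E.
Proof.
rewrite /surface_measure /mscale /= [area _]area_setT -EFinM mulVf//.
by rewrite pnatr_eq0 -lt0n nsquares_gt0.
Qed.

HB.instance Definition _ :=
  Measure_isProbability.Build _ _ _ surface_measure surface_measure_setT.

Definition euclidean_dist (p q : R * R) : R :=
  Num.sqrt ((p.1 - q.1) ^+ 2 + (p.2 - q.2) ^+ 2).

Definition curve_length (gamma : R -> R * R) : \bar R :=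
  ereal_sup [set (\sum_(t <- zip (0 :: s) s)
                    euclidean_dist (gamma t.1) (gamma t.2))%:E
            | s in itv_partition 0 1].

(* [path_of_length x y l]: some finite concatenation of continuous paths, each
   one contained in a single square, leads from [x] to [y] in the surface, and
   the Euclidean lengths of its pieces add up to [l]. *)
Inductive path_of_length : surface -> surface -> \bar R -> Prop :=
| path_nil x : path_of_length x x 0%E
| path_cons i (gamma : R -> unit_square R) y l :
    {within `[0, 1], continuous gamma} ->
    path_of_length (chart i (gamma 1)) y l ->
    path_of_length (chart i (gamma 0)) y
      (curve_length (set_val \o gamma) + l)%E.

(* Valued in [\bar R] only because [ereal_inf] is: the surface is path-connected,
   so the infimum is finite. *)
Definition length_dist (x y : surface) : \bar R :=
  ereal_inf [set l | path_of_length x y l].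

End Surface.

Arguments surface R O : clear implicits.
Arguments surface_measure R O : clear implicits.
Arguments length_dist {R O}.

(* Main.v *)
Require Import Defs.
From HB Require Import structures.
From mathcomp Require Import all_boot all_order all_algebra all_fingroup.
From mathcomp Require Import finmap.
From mathcomp Require Import all_classical all_reals all_analysis.
From mathcomp Require Import measurable_realfun ring lra zify.
From Stdlib Require Import Relation_Operators.

Set Implicit Arguments.
Unset Strict Implicit.
Unset Printing Implicit Defensive.

Import Order.TTheory GRing.Theory Num.Theory.
Import numFieldNormedType.Exports.

Local Open Scope classical_set_scope.
Local Open Scope ring_scope.

(* For an [N >= 3] with [sigma ^+ N = tau ^+ N = 1], let [a] be the horizontal multitwist,
   which is [(x, y) |-> (x + N y, y)] along each horizontal cylinder, and let [b] be the
   vertical one. The free group acts through [a] and [b].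

   On the torus, the shears act dually on the frequencies by ping-pong, so that by Bessel's
   inequality an almost invariant function has little mass away from the frequency 0.

   On the surface, suppose that there are almost invariant unit functions of mean zero.
   They tend weakly to 0: on each square their nonzero Fourier coefficients get small as
   above, their means on neighbouring squares get close, and the surface is connected. Hence
   [m + 1] of them, [u_0, ..., u_m], can be taken almost orthogonal, with [m] the number of
   squares. The fibre norm [p |-> (sum_k (u (psi k p))^2)^(1/2)] of an almost invariant [u] is
   almost invariant on the torus, hence almost constant. Applied to all the sums
   [u_i + u_j] this provides a point [p] at which the [m + 1] vectors [(u_i (psi k p))_k] of
   R^m are almost orthogonal and of almost equal norm, which is impossible.

   The gap for the pair [a], [b] yields the gap for all symmetric generating sets, and the
   expansion of [U] by applying it to the centred indicator function of [U]. *)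

(** * Square-integrable functions *)

(** Ping-pong cannot be run on the surface itself: one multitwist mixes the squares of horizontal
    strips, the other those of vertical strips, and there is no single lattice of frequencies on
    which both act. One multitwist alone makes each Fourier coefficient that it moves small, but the
    mass may escape to high frequencies, whence only weak convergence. The fibre norm brings a
    function to the torus, where ping-pong gives a bound in norm, at the price of the signs:
    constant fibre norm is all that can be concluded. A dimension count closes this gap, as a fibre
    has only [m] points.

    The exponent [N] has two duties. As [sigma ^+ N = 1], the shear by [N] moves the top side of
    each square back to the same square, so one formula defines the multitwist on all cylinders,
    whatever their lengths, and it covers the shear by [N] of the torus; the same holds for [tau].
    And [3 <= N] is what ping-pong asks for.

    Weak convergence is expressed without sequences, as a property of all sufficiently invariant
    functions. *)

Section SquareIntegrable.
Context d (T : measurableType d) (R : realType) (mu : probability T R).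
Implicit Types f g h : T -> R.

Local Notation L2 := (Lfun mu 2%:E).

Definition ip f g : R := \int[mu]_x (f x * g x).
Definition nrm f : R := Num.sqrt (ip f f).

Lemma L2_measurable f : f \in L2 -> measurable_fun setT f.
Proof. by rewrite inE => /andP[/[!inE]]. Qed.

Lemma eq_L2 f g : f =1 g -> f \in L2 -> g \in L2.
Proof. by move=> /funext ->. Qed.

Lemma eq_ip f f' g g' : f =1 f' -> g =1 g' -> ip f g = ip f' g'.
Proof. by move=> /funext -> /funext ->. Qed.

Lemma L2_mul_integrable f g : f \in L2 -> g \in L2 ->
  mu.-integrable setT (EFin \o (fun x => f x * g x)).
Proof.
by move=> lf lg; have /Lfun1_integrable := Lfun2_mul_Lfun1 lf lg.
Qed.

Lemma integrable_sqr_L2 f : measurable_fun setT f ->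
  mu.-integrable setT (EFin \o (fun x => f x ^+ 2)) -> f \in L2.
Proof.
move=> mf /integrableP[_ fi]; rewrite inE; apply/andP; split; rewrite inE//=.
rewrite /finite_norm unlock poweR_lty//.
rewrite (le_lt_trans _ fi)// ge0_le_integral//=; first last.
- by move=> x _; rewrite lee_fin powR_mulrn// -normrX.
- by apply/measurable_EFinP/measurableT_comp => //; exact: measurable_funX.
- by apply/measurable_EFinP/(measurableT_comp (measurable_powR _))/measurableT_comp.
Qed.

Lemma integrable_bounded f c : measurable_fun setT f -> (forall x, `|f x| <= c) ->
  mu.-integrable setT (EFin \o f).
Proof.
move=> mf fc; apply: measurable_bounded_integrable => //.
  by rewrite (le_lt_trans (probability_le1 _ _))// ltry.
exists c; split; first exact: num_real.
by move=> y cy x _; rewrite /= (le_trans (fc x))// ltW.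
Qed.

Lemma bounded_L2 f c : measurable_fun setT f -> (forall x, `|f x| <= c) -> f \in L2.
Proof.
move=> mf fc; apply: integrable_sqr_L2 => //.
apply: (@integrable_bounded _ (c ^+ 2)); first exact: measurable_funX.
by move=> x; rewrite normrX lerXn2r// nnegrE (le_trans _ (fc x)).
Qed.

Lemma cst_L2 c : cst c \in L2.
Proof. by apply: (@bounded_L2 _ `|c|). Qed.

Lemma L2D f g : f \in L2 -> g \in L2 -> (fun x => f x + g x) \in L2.
Proof.
have l2 : (1 <= 2%:E :> \bar R)%E by rewrite lee_fin ler1n.
by move=> lf lg; case: (Lfun_addr_closed mu l2) => _; exact.
Qed.

Lemma L2Z c f : f \in L2 -> (fun x => c * f x) \in L2.
Proof.
move=> lf; have := @Lfun_scale _ _ _ mu f c 2 _ lf; rewrite (_ : _ \o* _ = (fun x => c * f x)).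
  by apply; rewrite ler1n.
by apply/funext => x /=; rewrite mulrC.
Qed.

Lemma L2B f g : f \in L2 -> g \in L2 -> (fun x => f x - g x) \in L2.
Proof.
move=> lf lg; have := L2D lf (L2Z (-1) lg).
by apply: eq_L2 => x; rewrite mulN1r.
Qed.

Lemma L2_sum (I : eqType) (s : seq I) (f : I -> T -> R) :
  (forall i, i \in s -> f i \in L2) -> (fun x => \sum_(i <- s) f i x) \in L2.
Proof.
elim: s => [_|i s IH lf].
  by apply: eq_L2 (cst_L2 0) => x; rewrite big_nil.
have := L2D (lf i (mem_head _ _)) (IH (fun j js => lf j (mem_behead (s := i :: s) js))).
by apply: eq_L2 => x; rewrite big_cons.
Qed.

Lemma le_L2 f g : measurable_fun setT f -> g \in L2 -> (forall x, `|f x| <= `|g x|) -> f \in L2.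
Proof.
move=> mf lg fg; apply: integrable_sqr_L2 => //.
apply: le_integrable (Lfun2_integrable_sqr lg) => //.
  apply/measurable_EFinP; exact: measurable_funX.
by move=> x _ /=; rewrite lee_fin !normrX lerXn2r// ?nnegrE.
Qed.

Lemma ipC f g : ip f g = ip g f.
Proof. by apply: eq_Rintegral => x _; rewrite mulrC. Qed.

Lemma ipDl f g h : f \in L2 -> g \in L2 -> h \in L2 ->
  ip (fun x => f x + g x) h = ip f h + ip g h.
Proof.
move=> lf lg lh; rewrite /ip -RintegralD//; [|exact: L2_mul_integrable..].
by apply: eq_Rintegral => x _; rewrite mulrDl.
Qed.

Lemma ipZl c f h : f \in L2 -> h \in L2 -> ip (fun x => c * f x) h = c * ip f h.
Proof.
move=> lf lh; rewrite /ip -RintegralZl//; last exact: L2_mul_integrable.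
by apply: eq_Rintegral => x _; rewrite mulrA.
Qed.

Lemma ipBl f g h : f \in L2 -> g \in L2 -> h \in L2 ->
  ip (fun x => f x - g x) h = ip f h - ip g h.
Proof.
move=> lf lg lh; rewrite /ip -RintegralB//; [|exact: L2_mul_integrable..].
by apply: eq_Rintegral => x _; rewrite mulrBl.
Qed.

Lemma ip0l h : ip (fun=> 0) h = 0.
Proof. by rewrite /ip; under eq_Rintegral do rewrite mul0r; rewrite Rintegral_cst// mul0r. Qed.

Lemma ip_suml (I : eqType) (s : seq I) (f : I -> T -> R) h :
  (forall i, i \in s -> f i \in L2) -> h \in L2 ->
  ip (fun x => \sum_(i <- s) f i x) h = \sum_(i <- s) ip (f i) h.
Proof.
move=> + lh; elim: s => [_|i s IH lf].
  by rewrite big_nil -[RHS](ip0l h); apply: eq_ip => // x; rewrite big_nil.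
have lfs j : j \in s -> f j \in L2 by move=> js; apply: lf; rewrite in_cons js orbT.
rewrite big_cons -IH// -ipDl//; first by apply: eq_ip => // x; rewrite big_cons.
- by apply: lf; exact: mem_head.
- exact: L2_sum.
Qed.

Lemma ip_ge0 f : 0 <= ip f f.
Proof. by apply: Rintegral_ge0 => x _; rewrite -expr2 sqr_ge0. Qed.

Lemma ip_sqrD f g : f \in L2 -> g \in L2 ->
  ip (fun x => f x + g x) (fun x => f x + g x) = ip f f + 2 * ip f g + ip g g.
Proof.
move=> lf lg; have lfg := L2D lf lg.
by rewrite ipDl// (ipC f) (ipC g) !ipDl// (ipC g f); ring.
Qed.

Lemma ip_sqrB f g : f \in L2 -> g \in L2 ->
  ip (fun x => f x - g x) (fun x => f x - g x) = ip f f - 2 * ip f g + ip g g.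
Proof.
move=> lf lg; have lfg := L2B lf lg.
by rewrite ipBl// (ipC f) (ipC g) !ipBl// (ipC g f); ring.
Qed.

Lemma ip_sqrZ c f : f \in L2 -> ip (fun x => c * f x) (fun x => c * f x) = c ^+ 2 * ip f f.
Proof. by move=> lf; rewrite ipZl ?L2Z// ipC ipZl//; ring. Qed.

Lemma cauchy_schwarz f g : f \in L2 -> g \in L2 -> ip f g ^+ 2 <= ip f f * ip g g.
Proof.
move=> lf lg.
have H t : 0 <= ip f f - 2 * (t * ip f g) + t ^+ 2 * ip g g.
  by rewrite -ip_sqrZ// -(ipC _ f) -ipZl// (ipC _ f) -ip_sqrB ?L2Z// ip_ge0.
have [g0|g0] := eqVneq (ip g g) 0.
  suff -> : ip f g = 0 by rewrite expr0n g0 mulr0.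
  (* The polynomial [H] is affine in [t] here; this [t] gives it the value -1. *)
  apply/eqP/negPn/negP => fg0; have := H ((ip f f + 1) / (2 * ip f g)).
  rewrite g0 mulr0 addr0; have -> : 2 * ((ip f f + 1) / (2 * ip f g) * ip f g) = ip f f + 1 by field.
  lra.
have gp : 0 < ip g g by rewrite lt_neqAle eq_sym g0 ip_ge0.
have := H (ip f g / ip g g).
rewrite (_ : _ + _ = (ip f f * ip g g - ip f g ^+ 2) / ip g g); last by field.
by rewrite pmulr_lge0 ?invr_gt0// subr_ge0.
Qed.

Lemma nrm_ge0 f : 0 <= nrm f. Proof. exact: sqrtr_ge0. Qed.

Lemma sqr_nrm f : nrm f ^+ 2 = ip f f.
Proof. by rewrite sqr_sqrtr ?ip_ge0. Qed.

Lemma ip_le_nrm f g : f \in L2 -> g \in L2 -> `|ip f g| <= nrm f * nrm g.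
Proof.
move=> lf lg; rewrite -(@ler_pXn2r _ 2) ?nnegrE ?mulr_ge0 ?nrm_ge0//.
by rewrite -normrX ger0_norm ?sqr_ge0// exprMn !sqr_nrm cauchy_schwarz.
Qed.

Lemma nrm_triangle f g : f \in L2 -> g \in L2 ->
  nrm (fun x => f x + g x) <= nrm f + nrm g.
Proof.
move=> lf lg; rewrite -(@ler_pXn2r _ 2) ?nnegrE ?addr_ge0 ?nrm_ge0//.
rewrite sqr_nrm ip_sqrD// sqrrD !sqr_nrm lerD2r lerD2l.
rewrite -[leRHS]mulr_natl ler_pM2l ?ltr0n//.
by rewrite (le_trans (ler_norm _))// ip_le_nrm.
Qed.

Lemma nrmZ c f : f \in L2 -> nrm (fun x => c * f x) = `|c| * nrm f.
Proof. by move=> lf; rewrite /nrm ip_sqrZ// sqrtrM ?sqr_ge0// sqrtr_sqr. Qed.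

Lemma nrm_subC f g : nrm (fun x => f x - g x) = nrm (fun x => g x - f x).
Proof. by rewrite /nrm /ip; congr Num.sqrt; apply: eq_Rintegral => x _; ring. Qed.

Lemma nrm_triangleB f g h : f \in L2 -> g \in L2 -> h \in L2 ->
  nrm (fun x => f x - h x) <= nrm (fun x => f x - g x) + nrm (fun x => g x - h x).
Proof.
move=> lf lg lh; have := nrm_triangle (L2B lf lg) (L2B lg lh).
by rewrite (_ : (fun x => _ + _) = (fun x => f x - h x))//; apply/funext => x; ring.
Qed.

Lemma Lnorm_nrm f : f \in L2 -> 'N[mu]_2%:E[EFin \o f]%E = (nrm f)%:E.
Proof.
move=> lf; have fi := L2_mul_integrable lf lf.
rewrite unlock /= (_ : (\int[mu]_x _)%E = (ip f f)%:E).
  by rewrite poweR_EFin powR12_sqrt ?ip_ge0.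
rewrite /ip /Rintegral fineK; last exact: integrable_fin_num.
by apply: eq_integral => x _; rewrite /= powR_mulrn// -normrX ger0_norm ?sqr_ge0// expr2.
Qed.

Lemma ip_EFin f g : f \in L2 -> g \in L2 -> (ip f g)%:E = (\int[mu]_x (f x * g x)%:E)%E.
Proof. by move=> lf lg; rewrite /ip /Rintegral fineK//; apply: integrable_fin_num => //; exact: L2_mul_integrable. Qed.

Lemma ip_le f g : f \in L2 -> g \in L2 -> (forall x, `|f x| <= `|g x|) -> ip f f <= ip g g.
Proof.
move=> lf lg fg; apply: le_Rintegral => //; [exact: L2_mul_integrable..|].
by move=> x _; rewrite -!expr2 -(real_normK (num_real (f x))) -(real_normK (num_real (g x))) lerXn2r ?nnegrE.
Qed.

End SquareIntegrable.

Local Notation sqnrm mu f := (ip mu f f).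

Section Pullback.
Context d1 d2 (T1 : measurableType d1) (T2 : measurableType d2) (R : realType).
Variables (mu1 : probability T1 R) (mu2 : probability T2 R) (n : nat).
Variables (phi : 'I_n -> T1 -> T2) (c : R).
Hypothesis c0 : 0 < c.
Hypothesis mphi : forall i, measurable_fun setT (phi i).
Hypothesis integral_phi : forall F : T2 -> \bar R, measurable_fun setT F ->
  (forall x, 0 <= F x)%E ->
  (\int[mu2]_x F x = c%:E * \sum_i \int[mu1]_p F (phi i p))%E.

(** One infinite summand would make the whole right-hand side of [integral_phi] infinite. The
    section is applied to the developing maps of the [m] squares with [c = 1 / m], and to a single
    measure-preserving map with [c = 1]. *)
Lemma pullback_L2 i (f : T2 -> R) :
  f \in Lfun mu2 2%:E -> (fun p => f (phi i p)) \in Lfun mu1 2%:E.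
Proof.
move=> lf; have mf := L2_measurable lf.
apply: integrable_sqr_L2; first exact: measurableT_comp mf (mphi i).
have /integrableP[mf2 f2] := Lfun2_integrable_sqr lf.
apply/integrableP; split; first exact: (measurableT_comp mf2 (mphi i)).
have mF : measurable_fun setT (fun x => `|(f x ^+ 2)%:E|%E).
  exact: (measurableT_comp (@abse_measurable R setT) mf2).
have F0 x : (0 <= `|(f x ^+ 2)%:E|)%E by [].
move: f2; rewrite (integral_phi mF F0) (bigD1 i)//= => f2.
have s0 : (0 <= \sum_(j < n | j != i) \int[mu1]_p `|(f (phi j p) ^+ 2)%:E|)%E.
  by apply: sume_ge0 => j _; apply: integral_ge0.
rewrite ltNge; apply/negP => h; move: f2; rewrite ltNge => /negP; apply.
move: h; rewrite leye_eq => /eqP ->.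
by rewrite addye ?gt0_muley ?lte_fin// (gt_eqF (lt_le_trans _ s0)).
Qed.

Let ip_pullback_sqr (f : T2 -> R) : f \in Lfun mu2 2%:E ->
  ip mu2 f f = c * \sum_i sqnrm mu1 (fun p => f (phi i p)).
Proof.
move=> lf; apply: EFin_inj; rewrite EFinM -sumEFin ip_EFin//.
rewrite integral_phi.
- congr (_ * _)%E; apply: eq_bigr => i _; rewrite -ip_EFin//; exact: pullback_L2.
- apply/measurable_EFinP; have mf := L2_measurable lf; exact: measurable_funM.
- by move=> x; rewrite lee_fin -expr2 sqr_ge0.
Qed.

(* By polarization from the case [f = g], where the integrands are nonnegative. *)
Lemma ip_pullback (f g : T2 -> R) : f \in Lfun mu2 2%:E -> g \in Lfun mu2 2%:E ->
  ip mu2 f g = c * \sum_i ip mu1 (fun p => f (phi i p)) (fun p => g (phi i p)).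
Proof.
move=> lf lg; have := ip_pullback_sqr (L2D lf lg).
rewrite ip_sqrD// (ip_pullback_sqr lf) (ip_pullback_sqr lg).
rewrite (eq_bigr _ (fun i _ => ip_sqrD (pullback_L2 i lf) (pullback_L2 i lg))).
rewrite !big_split /= -mulr_sumr !mulrDr => H.
by apply: (mulfI (lt0r_neq0 (ltr0n R 2))); lra.
Qed.

End Pullback.

Section MeasurePreserving.
Context d1 d2 (T1 : measurableType d1) (T2 : measurableType d2) (R : realType).
Variables (mu1 : probability T1 R) (mu2 : probability T2 R) (phi : T1 -> T2).
Hypothesis mphi : measurable_fun setT phi.
Hypothesis integral_phi : forall F : T2 -> \bar R, measurable_fun setT F ->
  (forall x, 0 <= F x)%E -> (\int[mu1]_p F (phi p) = \int[mu2]_x F x)%E.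

Let integral_phi1 (F : T2 -> \bar R) : measurable_fun setT F -> (forall x, 0 <= F x)%E ->
  (\int[mu2]_x F x = 1%:E * \sum_(i < 1) \int[mu1]_p F (phi p))%E.
Proof. by move=> mF F0; rewrite big_ord1 mul1e integral_phi. Qed.

Lemma comp_L2 (f : T2 -> R) :
  f \in Lfun mu2 2%:E -> (fun p => f (phi p)) \in Lfun mu1 2%:E.
Proof.
exact: (@pullback_L2 _ _ T1 T2 R mu1 mu2 1 (fun=> phi) 1 ltr01 (fun=> mphi) integral_phi1 ord0).
Qed.

Lemma ip_comp (f g : T2 -> R) : f \in Lfun mu2 2%:E -> g \in Lfun mu2 2%:E ->
  ip mu1 (fun p => f (phi p)) (fun p => g (phi p)) = ip mu2 f g.
Proof.
move=> lf lg.
rewrite (@ip_pullback _ _ T1 T2 R mu1 mu2 1 (fun=> phi) 1 ltr01 (fun=> mphi) integral_phi1 f g lf lg).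
by rewrite big_ord1 mul1r.
Qed.

End MeasurePreserving.

(** * Lebesgue measure on the unit square *)

Section LebesgueAffine.
Variable R : realType.
Local Notation leb := (@lebesgue_measure R).

Lemma measurable_affine (c s : R) :
  measurable_fun setT ((fun x => c * x + s) : measurableTypeR R -> measurableTypeR R).
Proof. by apply: measurable_funD => //; exact: measurable_funM. Qed.

(** Both sides are measures in [A], and half-open intervals determine Lebesgue measure. *)
Lemma lebesgue_measure_affine (c s : R) (A : set (measurableTypeR R)) :
  0 < c -> measurable A -> leb A = (c%:E * leb ((fun x => c * x + s)%R @^-1` A))%E.
Proof.
move=> c0; pose f : measurableTypeR R -> measurableTypeR R := fun x => c * x + s.
have mf : measurable_fun setT f by exact: measurable_affine.
have [mu muE] : exists mu : {measure set (measurableTypeR R) -> \bar R},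
    forall B, mu B = (c%:E * leb (f @^-1` B))%E.
  unshelve eexists (mscale (NngNum (ltW c0)) (pushforward leb f)); first exact: mf.
  by [].
move=> mA; rewrite -muE; apply: lebesgue_measure_unique mA => //= _ [[a b]] _ <-.
rewrite muE.
have -> : f @^-1` `]a, b] = `](a - s) / c, (b - s) / c]%classic.
  apply/seteqP; split => x; rewrite /f /= !in_itv /= ltr_pdivrMr// ler_pdivlMr// => /andP[? ?];
  apply/andP; split; lra.
rewrite !lebesgue_measure_itv /= !lte_fin ltr_pM2r ?invr_gt0// ltrD2r.
by case: ifPn => _; rewrite ?mule0// -EFinB -EFinM; congr EFin; field; rewrite gt_eqF.
Qed.

Lemma ge0_integral_affine (c s : R) (D : set (measurableTypeR R)) (f : R -> \bar R) :
  0 < c -> measurable D -> measurable_fun setT f -> (forall x, 0 <= f x)%E ->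
  (\int[leb]_(x in D) f x =
   c%:E * \int[leb]_(x in (fun x => (c * x + s)%R) @^-1` D) f (c * x + s)%R)%E.
Proof.
move=> c0 mD mf f0; pose g : measurableTypeR R -> measurableTypeR R := fun x => c * x + s.
have mg : measurable_fun setT g by exact: measurable_affine.
rewrite (@eq_measure_integral _ _ _ D
  (mscale (NngNum (ltW c0)) (pushforward leb g))) => [|A mA _]; last first.
  exact: (lebesgue_measure_affine s c0 mA).
rewrite ge0_integral_mscale//; last exact: measurable_funTS.
congr (_ * _)%E; rewrite ge0_integral_pushforward//; exact: measurable_funTS.
Qed.

(** Intervals are half-open here so that they can be cut and reassembled without overlap. *)
Lemma ge0_integral_shift_itv (a b s : R) (f : R -> \bar R) :
  measurable_fun setT f -> (forall x, 0 <= f x)%E ->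
  (\int[leb]_(x in `[a, b[) f (x + s)%R = \int[leb]_(x in `[(a + s)%R, (b + s)%R[) f x)%E.
Proof.
move=> mf f0; rewrite [RHS](@ge0_integral_affine 1 s)// mul1e.
have -> : (fun x => 1 * x + s) @^-1` `[a + s, b + s[ = `[a, b[%classic.
  by apply/seteqP; split => x; rewrite /= !in_itv /= mul1r lerD2r ltrD2r.
by under [RHS]eq_integral do rewrite mul1r.
Qed.

Lemma ge0_integral_itv_cat (a b c : R) (f : R -> \bar R) : a <= b -> b <= c ->
  measurable_fun setT f -> (forall x, 0 <= f x)%E ->
  (\int[leb]_(x in `[a, c[) f x = \int[leb]_(x in `[a, b[) f x + \int[leb]_(x in `[b, c[) f x)%E.
Proof.
move=> ab bc mf f0; rewrite -ge0_integral_setU//; last 2 first.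
- exact: measurable_funTS.
- apply/disj_set2P/seteqP; split => // x /=; rewrite !in_itv /= => -[/andP[_ xb] /andP[]].
  by rewrite leNgt xb.
congr integral; apply/seteqP; split => x /=; rewrite !in_itv /=.
  by move=> /andP[ax xc]; case: (ltP x b) => xb; [left|right]; rewrite ?ax ?xb.
by move=> [/andP[ax xb]|/andP[bx xc]]; apply/andP; split => //;
  [exact: lt_le_trans bc|exact: le_trans bx].
Qed.

Lemma ge0_integral_itv_closed (a b : R) (f : R -> \bar R) : measurable_fun setT f ->
  (\int[leb]_(x in `[a, b]) f x = \int[leb]_(x in `[a, b[) f x)%E.
Proof. by move=> mf; apply/esym/integral_itv_bndo_bndc; exact: measurable_funTS. Qed.

Lemma measurable_addr_cst (f : R -> \bar R) (s : R) : measurable_fun setT f ->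
  measurable_fun setT (fun x : R => f (x + s)).
Proof.
move=> mf; apply: measurableT_comp => //; under eq_fun do rewrite -[X in X + _]mul1r.
exact: measurable_affine.
Qed.

(** The window from [s] to [1 + s] is cut at the integer [k] in it. Moving the right piece back by 1
    produces the window from [k - 1] to [k], an integer translate of the unit one. *)
Lemma ge0_integral_periodic_shift (s : R) (f : R -> \bar R) :
  measurable_fun setT f -> (forall x, 0 <= f x)%E -> (forall x, f (x + 1) = f x) ->
  (\int[leb]_(x in `[0%R, 1%R]) f (x + s)%R = \int[leb]_(x in `[0%R, 1%R]) f x)%E.
Proof.
move=> mf f0 fper.
have mfs := measurable_addr_cst s mf.
have fperZ (k : int) x : f (x + k%:~R) = f x.
  have H m y : f (y + m%:R) = f y.
    elim: m => [|m IH]; first by rewrite addr0.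
    by rewrite -addn1 natrD addrA fper IH.
  by case: k => n; rewrite ?NegzE; [exact: H|rewrite -[LHS](H n.+1) mulrNz subrK].
rewrite !ge0_integral_itv_closed// ge0_integral_shift_itv// add0r.
pose k := Num.floor s + 1.
have sk : s < k%:~R by exact: floorD1_gt.
have ks : k%:~R <= 1 + s by rewrite /k intrD addrC lerD2l floor_le_tmp.
rewrite (ge0_integral_itv_cat (ltW sk) ks mf f0).
have -> : (\int[leb]_(x in `[k%:~R, (1 + s)%R[) f x = \int[leb]_(x in `[(k%:~R - 1)%R, s[) f x)%E.
  rewrite -[X in `[_, X[]addrC -[X in `[X, _[](subrK 1) -ge0_integral_shift_itv//.
  by under eq_integral do rewrite fper.
rewrite addeC -ge0_integral_itv_cat//; last 2 first.
- by rewrite lerBlDl.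
- exact: ltW.
have := @ge0_integral_shift_itv 0 1 (k%:~R - 1) f mf f0.
rewrite add0r [1 + _]addrC subrK => <-.
by apply: eq_integral => x _; rewrite -[X in _ - X]/(1%:~R) -intrB fperZ.
Qed.

Lemma ge0_integral_stretch (N : nat) (f : R -> \bar R) : (0 < N)%N ->
  measurable_fun setT f -> (forall x, 0 <= f x)%E ->
  (N%:R%:E * \int[leb]_(x in `[0%R, 1%R]) f (N%:R * x)%R =
   \sum_(k < N) \int[leb]_(x in `[0%R, 1%R]) f (x + k%:R)%R)%E.
Proof.
move=> N0 mf f0; have N0R : 0 < N%:R :> R by rewrite ltr0n.
have mfN : measurable_fun setT (fun x : R => f (N%:R * x)).
  by apply: measurableT_comp => //; exact: measurable_funM.
rewrite ge0_integral_itv_closed//.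
have -> : (N%:R%:E * \int[leb]_(x in `[0%R, 1%R[) f (N%:R * x)%R =
    \int[leb]_(x in `[0%R, N%:R[) f x)%E.
  rewrite [RHS](ge0_integral_affine 0 N0R)//.
  have -> : (fun x => N%:R * x + 0) @^-1` `[0, N%:R[ = `[0, 1[%classic :> set R.
    by apply/seteqP; split => x; rewrite /= !in_itv /= addr0 pmulr_rge0// gtr_pMr.
  by under [in RHS]eq_integral do rewrite addr0.
elim: N {N0 N0R mfN} => [|N IH].
  by rewrite big_ord0 set_itv_ge ?integral_set0//= bnd_simp ltxx.
rewrite big_ord_recr/= -IH (@ge0_integral_itv_cat _ N%:R)//; last by rewrite ler_nat.
rewrite ge0_integral_itv_closed; last exact: measurable_addr_cst.
by rewrite ge0_integral_shift_itv// add0r [1 + _]addrC -natr1.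
Qed.

End LebesgueAffine.

Lemma ge0_integral_mrestr d (T : measurableType d) (R : realType)
    (mu : {measure set T -> \bar R}) (D : set T) (mD : measurable D) (f : T -> \bar R) :
  measurable_fun setT f -> (forall x, 0 <= f x)%E ->
  (\int[mrestr mu mD]_x f x = \int[mu]_(x in D) f x)%E.
Proof.
move=> mf f0; rewrite -(setUv D) ge0_integral_setU//; last 3 first.
- exact: measurableC.
- by rewrite setUv.
- by apply/disj_set2P; rewrite setICr.
rewrite [X in (_ + X)%E](_ : _ = 0%E) ?adde0.
  apply: eq_measure_integral => A mA AD; rewrite /= /mrestr; congr (mu _).
  exact: setIidl.
rewrite (eq_measure_integral mzero) ?integral_measure_zero// => A mA AD.
rewrite /= /mrestr /mzero (_ : A `&` D = set0) ?measure0//.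
by apply/disjoints_subset.
Qed.

Lemma integral_comp_funposneg d (T : measurableType d) (R : realType)
    (mu : {measure set T -> \bar R}) (S : T -> T) (f : T -> \bar R) :
  (\int[mu]_x (f^\+)%E (S x) = \int[mu]_x (f^\+)%E x)%E ->
  (\int[mu]_x (f^\-)%E (S x) = \int[mu]_x (f^\-)%E x)%E ->
  (\int[mu]_x f (S x) = \int[mu]_x f x)%E.
Proof.
move=> fp fn; rewrite [LHS]integralE [RHS]integralE -fp -fn.
by rewrite (funepos_comp f S) (funeneg_comp f S).
Qed.

Section UnitSquare.
Variable R : realType.
Local Notation leb := (@lebesgue_measure R).
Local Notation plane := (measurableTypeR R * measurableTypeR R)%type.

(** A measure on the whole plane that is concentrated on the square: functions on the torus become
    periodic functions on the plane, and shears need no reduction modulo 1. *)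
Definition square_measure : set plane -> \bar R :=
  mrestr (leb \x leb)%E (@unit_square_measurable R).

HB.instance Definition _ := Measure.on square_measure.

Let square_measure_setT : square_measure setT = 1%E.
Proof.
rewrite /square_measure /mrestr setTI /unit_square.
have I1 : leb (`[0, 1] : set R) = 1%E.
  by rewrite lebesgue_measure_itv /= lte_fin ltr01 oppr0 adde0.
rewrite product_measure1E; [|exact: measurable_itv..].
by rewrite -[RHS]mul1e; congr (_ * _)%E.
Qed.

HB.instance Definition _ :=
  Measure_isProbability.Build _ _ _ square_measure square_measure_setT.

Lemma unit_square_patch (f : plane -> \bar R) x y : (f \_ (unit_square R)) (x, y) =
  if (x \in `[0, 1]%classic) && (y \in `[0, 1]%classic) then f (x, y) else 0%E.
Proof. by rewrite patchE /unit_square in_setX. Qed.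

Lemma ge0_integral_square (f : plane -> \bar R) :
  measurable_fun setT f -> (forall p, 0 <= f p)%E ->
  (\int[square_measure]_p f p =
   \int[leb]_(y in `[0%R, 1%R]) \int[leb]_(x in `[0%R, 1%R]) f (x, y))%E /\
  (\int[square_measure]_p f p =
   \int[leb]_(x in `[0%R, 1%R]) \int[leb]_(y in `[0%R, 1%R]) f (x, y))%E.
Proof.
move=> mf f0; rewrite ge0_integral_mrestr// integral_mkcond.
have g0 p : (0 <= (f \_ (unit_square R)) p)%E by rewrite patchE; case: ifP.
have mg : measurable_fun (setT : set plane) (f \_ (unit_square R : set plane)).
  apply/(measurable_restrictT _ (@unit_square_measurable R)); exact: measurable_funTS.
split.
  rewrite (@fubini_tonelli2 _ _ _ _ _ leb leb _ mg g0) [RHS]integral_mkcond.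
  apply: eq_integral => y _; rewrite /fubini_G patchE; case: ifPn => yI.
    by rewrite [RHS]integral_mkcond; apply: eq_integral => x _; rewrite unit_square_patch patchE yI andbT.
  by apply: integral0_eq => x _; rewrite unit_square_patch (negPf yI) andbF.
rewrite (@fubini_tonelli1 _ _ _ _ _ leb leb _ mg g0) [RHS]integral_mkcond.
apply: eq_integral => x _; rewrite /fubini_F patchE; case: ifPn => xI.
  by rewrite [RHS]integral_mkcond; apply: eq_integral => y _; rewrite unit_square_patch patchE xI.
by apply: integral0_eq => y _; rewrite unit_square_patch (negPf xI).
Qed.

Definition flip (p : R * R) : R * R := (p.2, p.1).

Lemma measurable_flip : measurable_fun setT (flip : plane -> plane).
Proof. exact: measurable_swap. Qed.

Lemma ge0_integral_flip (f : plane -> \bar R) :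
  measurable_fun setT f -> (forall p, 0 <= f p)%E ->
  (\int[square_measure]_p f (flip p) = \int[square_measure]_p f p)%E.
Proof.
move=> mf f0; have mff := measurableT_comp mf measurable_flip.
by rewrite (ge0_integral_square mff (fun p => f0 _)).1 (ge0_integral_square mf f0).2.
Qed.

Lemma measurable_shear (phi : R -> R) : measurable_fun setT phi ->
  measurable_fun setT ((fun p => (p.1 + phi p.2, p.2)) : plane -> plane).
Proof.
move=> mphi; apply/measurable_fun_pair => //=.
by apply: measurable_funD => //; exact: measurableT_comp.
Qed.

(** On each row the shear is a translation, and the integral of a 1-periodic function over a period
    does not see it. *)
Lemma ge0_integral_shear (phi : R -> R) (f : plane -> \bar R) :
  measurable_fun setT phi ->
  measurable_fun setT f -> (forall p, 0 <= f p)%E ->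
  (forall x y, 0 <= y <= 1 -> f (x + 1, y) = f (x, y)) ->
  (\int[square_measure]_p f ((p.1 + phi p.2)%R, p.2) = \int[square_measure]_p f p)%E.
Proof.
move=> mphi mf f0 fper; have mfs := measurableT_comp mf (measurable_shear mphi).
rewrite (ge0_integral_square mfs (fun p => f0 _)).1 (ge0_integral_square mf f0).1.
apply: eq_integral => y /set_mem /= yI /=.
apply: (@ge0_integral_periodic_shift _ (phi y) (fun x => f (x, y))) => //.
  by apply: measurableT_comp => //; exact: measurable_pair2.
by move=> x; apply: fper; move: yI; rewrite in_itv.
Qed.

Lemma integral_shear (phi : R -> R) (f : plane -> \bar R) :
  measurable_fun setT phi -> measurable_fun setT f ->
  (forall x y, 0 <= y <= 1 -> f (x + 1, y) = f (x, y)) ->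
  (\int[square_measure]_p f ((p.1 + phi p.2)%R, p.2) = \int[square_measure]_p f p)%E.
Proof.
move=> mphi mf fper; apply: integral_comp_funposneg.
- apply: (@ge0_integral_shear phi (f^\+)%E mphi (measurable_funepos mf)) => [p|x y yI].
    exact: funepos_ge0.
  by rewrite !funeposE fper.
- apply: (@ge0_integral_shear phi (f^\-)%E mphi (measurable_funeneg mf)) => [p|x y yI].
    exact: funeneg_ge0.
  by rewrite !funenegE fper.
Qed.

Lemma Rintegral_shear (phi : R -> R) (f : plane -> R) :
  measurable_fun setT phi -> measurable_fun setT f ->
  (forall x y, 0 <= y <= 1 -> f (x + 1, y) = f (x, y)) ->
  \int[square_measure]_p f (p.1 + phi p.2, p.2) = \int[square_measure]_p f p.
Proof.
move=> mphi mf fper; rewrite /Rintegral; congr fine.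
apply: (@integral_shear phi (EFin \o f)) => //; first exact/measurable_EFinP.
by move=> x y yI; rewrite /= fper.
Qed.

Lemma Rintegral_flip (f : plane -> R) : measurable_fun setT f ->
  \int[square_measure]_p f (flip p) = \int[square_measure]_p f p.
Proof.
move=> mf; have mEf : measurable_fun setT (EFin \o f) by exact/measurable_EFinP.
rewrite /Rintegral; congr fine; apply: (@integral_comp_funposneg _ _ _ square_measure flip (EFin \o f)).
- exact: (ge0_integral_flip (measurable_funepos mEf) (funepos_ge0 _)).
- exact: (ge0_integral_flip (measurable_funeneg mEf) (funeneg_ge0 _)).
Qed.

Lemma measurable_row_integral (f : plane -> \bar R) :
  measurable_fun setT f -> (forall p, 0 <= f p)%E ->
  measurable_fun setT (fun y : R => \int[leb]_(x in `[0%R, 1%R]) f (x, y))%E.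
Proof.
move=> mf f0; pose D : set plane := `[0, 1] `*` setT.
have mD : measurable D by exact: measurableX.
have := @measurable_fun_fubini_tonelli_G _ _ _ _ _ leb (f \_ D); rewrite /fubini_G.
have -> : (fun y => \int[leb]_x (f \_ D) (x, y))%E =
    (fun y => \int[leb]_(x in `[0%R, 1%R]) f (x, y))%E.
  apply/funext => y; rewrite [RHS]integral_mkcond; apply: eq_integral => x _.
  by rewrite !patchE; congr (if _ then _ else _); apply/idP/idP => /set_mem;
    [move=> [/= xI _]; exact: mem_set|move=> xI; apply: mem_set; split].
apply.
- by apply/(measurable_restrictT _ mD); exact: measurable_funTS.
- by move=> p; rewrite patchE; case: ifP.
Qed.

Lemma ge0_integral_square_stretch (N : nat) (f : plane -> \bar R) :
  (0 < N)%N -> measurable_fun setT f -> (forall p, 0 <= f p)%E ->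
  (N%:R%:E * \int[square_measure]_p f ((N%:R * p.1)%R, p.2) =
   \sum_(k < N) \int[square_measure]_p f ((p.1 + k%:R)%R, p.2))%E.
Proof.
move=> N0 mf f0.
have N0R : 0 < N%:R :> R by rewrite ltr0n.
have mfk (k : R) : measurable_fun setT (fun p : plane => f (p.1 + k, p.2)).
  exact: (measurableT_comp mf (@measurable_shear (cst k) _)).
have mfN : measurable_fun setT (fun p : plane => f (N%:R * p.1, p.2)).
  apply: (measurableT_comp mf); apply/measurable_fun_pair => //=.
  exact: measurable_funM.
rewrite (ge0_integral_square mfN (fun p => f0 _)).1.
rewrite (eq_bigr _ (fun (k : 'I_N) _ => (ge0_integral_square (mfk k%:R) (fun p => f0 _)).1)).
rewrite -ge0_integral_sum//; last 2 first.
- move=> k; apply: measurable_funTS.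
  exact: (measurable_row_integral (mfk _)).
- by move=> k y _; exact: integral_ge0.
rewrite -ge0_integralZl//; last 2 first.
- by apply: measurable_funTS; exact: (measurable_row_integral mfN).
- by move=> y _; exact: integral_ge0.
apply: eq_integral => y _ /=.
apply: (@ge0_integral_stretch _ N (fun x => f (x, y))) => //.
by apply: measurableT_comp => //; exact: measurable_pair2.
Qed.

End UnitSquare.

(** * Density of trigonometric polynomials *)

Section DenseAlgebra.
Context d (T : measurableType d) (R : realType) (mu : probability T R).
Local Notation L2 := (Lfun mu 2%:E).
Local Notation norm2 := (nrm mu).

Variable V : set (T -> R).
Hypothesis V_measurable : forall f, V f -> measurable_fun setT f.
Hypothesis V_bounded : forall f, V f -> exists c, forall x, `|f x| <= c.
Hypothesis V_one : V (fun=> 1).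
Hypothesis V_add : forall f g, V f -> V g -> V (fun x => f x + g x).
Hypothesis V_scale : forall c f, V f -> V (fun x => c * f x).
Hypothesis V_mul : forall f g, V f -> V g -> V (fun x => f x * g x).

Definition L2_closure (f : T -> R) :=
  f \in L2 /\ forall e, 0 < e -> exists2 g, V g & norm2 (fun x => f x - g x) < e.
Local Notation cl := L2_closure.

Lemma alg_L2 f : V f -> f \in L2.
Proof. by move=> Vf; have [c fc] := V_bounded Vf; apply: bounded_L2 fc; exact: V_measurable. Qed.

Lemma nrm0 : norm2 (fun=> 0) = 0.
Proof. by rewrite /nrm ip0l sqrtr0. Qed.

Lemma L2_closure_alg f : V f -> cl f.
Proof.
move=> Vf; split; first exact: alg_L2.
move=> e e0; exists f => //; rewrite (_ : (fun x => _) = fun=> 0) ?nrm0//.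
by apply/funext => x; rewrite subrr.
Qed.

Lemma L2_closure_lim f : f \in L2 ->
  (forall e, 0 < e -> exists2 g, cl g & norm2 (fun x => f x - g x) < e) -> cl f.
Proof.
move=> lf H; split => // e e0; have e20 : 0 < e / 2 by rewrite divr_gt0.
have [g [lg /(_ _ e20)[h Vh gh]] fg] := H _ e20.
exists h => //; apply: le_lt_trans (nrm_triangleB lf lg (alg_L2 Vh)) _.
by rewrite [e]splitr ltrD.
Qed.

Lemma L2_closureD f g : cl f -> cl g -> cl (fun x => f x + g x).
Proof.
move=> [lf Hf] [lg Hg]; split; first exact: L2D.
move=> e e0; have e20 : 0 < e / 2 by rewrite divr_gt0.
have [[f' Vf' ff'] [g' Vg' gg']] := (Hf _ e20, Hg _ e20).
exists (fun x => f' x + g' x); first exact: V_add.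
rewrite (_ : (fun x => _) = fun x => (f x - f' x) + (g x - g' x)); last first.
  by apply/funext => x; ring.
apply: le_lt_trans (nrm_triangle (L2B lf (alg_L2 Vf')) (L2B lg (alg_L2 Vg'))) _.
by rewrite [e]splitr ltrD.
Qed.

Lemma L2_closureZ c f : cl f -> cl (fun x => c * f x).
Proof.
move=> [lf Hf]; split; first exact: L2Z.
move=> e e0; have c0 : 0 < `|c| + 1 by rewrite ltr_wpDl.
have [f' Vf' ff'] := Hf _ (divr_gt0 e0 c0).
exists (fun x => c * f' x); first exact: V_scale.
rewrite (_ : (fun x => _) = fun x => c * (f x - f' x)); last first.
  by apply/funext => x; ring.
rewrite nrmZ; last exact: L2B (alg_L2 Vf').
move: ff'; rewrite ltr_pdivlMr//; apply: le_lt_trans.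
by rewrite mulrC ler_wpM2l ?nrm_ge0// lerDl.
Qed.

Lemma L2_closureB f g : cl f -> cl g -> cl (fun x => f x - g x).
Proof.
move=> cf cg; have := L2_closureD cf (L2_closureZ (-1) cg).
by rewrite (_ : (fun x => _ + _) = (fun x => f x - g x))//; apply/funext => x; ring.
Qed.

Lemma L2_closure_sum (I : Type) (s : seq I) (f : I -> T -> R) :
  (forall i, cl (f i)) -> cl (fun x => \sum_(i <- s) f i x).
Proof.
move=> cf; elim: s => [|i s IH].
  under eq_fun do rewrite big_nil.
  by under eq_fun do rewrite -(mul0r 1); apply: L2_closureZ; exact: L2_closure_alg.
by under eq_fun do rewrite big_cons; exact: L2_closureD.
Qed.

Lemma nrm_mul_bounded (c : R) (f g : T -> R) : 0 <= c -> measurable_fun setT f ->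
  (forall x, `|f x| <= c) -> g \in L2 ->
  (fun x => f x * g x) \in L2 /\ norm2 (fun x => f x * g x) <= c * norm2 g.
Proof.
move=> c0 mf fc lg; have fg x : `|f x * g x| <= `|c * g x|.
  by rewrite !normrM ler_wpM2r// (ger0_norm c0).
have lfg : (fun x => f x * g x) \in L2.
  apply: le_L2 (L2Z c lg) fg; apply: measurable_funM => //; exact: L2_measurable lg.
split=> //; rewrite -[c in leRHS]ger0_norm// -nrmZ// /nrm ler_wsqrtr//.
by apply: ip_le => //; exact: L2Z.
Qed.

(** The order of the approximations matters: first [g] by a bounded [g'], at the cost of the bound
    on [f]; then [f] by [f'], at the cost of the bound on [g']. *)
Lemma L2_closureM (c : R) (f g : T -> R) : measurable_fun setT f -> (forall x, `|f x| <= c) ->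
  cl f -> cl g -> cl (fun x => f x * g x).
Proof.
move=> mf fc cf [lg Hg].
(* A point is needed for [0 <= c]; without points all functions coincide. *)
case: (pselect (exists x : T, True)) => [[x0 _]|T0]; last first.
  rewrite (_ : (fun x => _) = g) //; apply/funext => x; exfalso; apply: T0; by exists x.
have c0 : 0 <= c by rewrite (le_trans _ (fc x0)).
have [lfg _] := nrm_mul_bounded c0 mf fc lg.
apply: L2_closure_lim => // e e0; have c10 : 0 < c + 1 by rewrite ltr_wpDl.
have [g' Vg' gg'] := Hg _ (divr_gt0 e0 c10); exists (fun x => f x * g' x).
  have [c' g'c'] := V_bounded Vg'; have c'0 : 0 <= c' by rewrite (le_trans _ (g'c' x0)).
  have [lf Hf] := cf; split.
    by have [] := nrm_mul_bounded c0 mf fc (alg_L2 Vg').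
  move=> e' e'0; have c'10 : 0 < c' + 1 by rewrite ltr_wpDl.
  have [f' Vf' ff'] := Hf _ (divr_gt0 e'0 c'10).
  exists (fun x => f' x * g' x); first exact: V_mul.
  rewrite (_ : (fun x => _) = fun x => g' x * (f x - f' x)); last first.
    by apply/funext => x; ring.
  have [_] := nrm_mul_bounded c'0 (V_measurable Vg') g'c' (L2B lf (alg_L2 Vf')).
  move=> /le_lt_trans; apply; move: ff'; rewrite ltr_pdivlMr//; apply: le_lt_trans.
  by rewrite mulrC ler_wpM2l ?nrm_ge0// lerDl.
rewrite (_ : (fun x => _) = fun x => f x * (g x - g' x)); last first.
  by apply/funext => x; ring.
have [_] := nrm_mul_bounded c0 mf fc (L2B lg (alg_L2 Vg')).
move=> /le_lt_trans; apply; move: gg'; rewrite ltr_pdivlMr//; apply: le_lt_trans.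
by rewrite mulrC ler_wpM2l ?nrm_ge0// lerDl.
Qed.

(** Dominated convergence for the squared distances, with [(2 * h) ^+ 2] as the dominating
    function. *)
Lemma L2_closure_dominated (f_ : nat -> T -> R) (f h : T -> R) : h \in L2 ->
  (forall n, cl (f_ n)) -> measurable_fun setT f ->
  (forall n x, `|f_ n x| <= h x) -> (forall x, `|f x| <= h x) ->
  {ae mu, forall x, f_ ^~ x @ \oo --> f x} -> cl f.
Proof.
move=> lh cf mf fh f0h ff.
have hn x : `|h x| = h x by rewrite ger0_norm// (le_trans _ (f0h x)).
have lf : f \in L2 by apply: le_L2 lh _ => // x; rewrite hn.
apply: L2_closure_lim => // e e0.
pose g_ n (x : T) := ((f x - f_ n x) ^+ 2)%:E.
have lfn n : (fun x => f x - f_ n x) \in L2 by apply: L2B => //; exact: (cf n).1.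
have l2h := L2Z 2 lh.
have [] := @dominated_convergence _ _ _ mu setT measurableT g_ (fun=> 0%E)
  (fun x => ((2 * h x) * (2 * h x))%:E).
- by move=> n; apply/measurable_EFinP/measurable_funX; exact: (L2_measurable (lfn n)).
- exact: measurable_cst.
- apply: filterS ff => x ff _; apply/cvg_EFin; first by near=> n.
  have -> : (fine \o g_ ^~ x) = (fun n => (f x - f_ n x) * (f x - f_ n x)).
    by apply/funext => n; rewrite /= expr2.
  rewrite -[0](mulr0 (0 : R)) /= -[X in X * _](subrr (f x)) -[X in _ * X](subrr (f x)).
  by apply: cvgM; apply: cvgB => //; exact: cvg_cst.
- exact: L2_mul_integrable.
- apply: aeW => x n _; rewrite /= lee_fin -expr2 normrX lerXn2r ?nnegrE//.
    by rewrite mulr_ge0// -hn.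
  by rewrite (le_trans (ler_normB _ _))// mulr2n mulrDl mul1r lerD.
move=> _ _; rewrite integral0 => H.
have /cvg_ballP/(_ (e ^+ 2)) : fine (\int[mu]_x g_ n x) @[n --> \oo] --> 0.
  exact: fine_cvg H.
rewrite exprn_gt0// => /(_ isT)[N _ /(_ N (leqnn N))].
rewrite /ball /= sub0r normrN => Hn; exists (f_ N) => //.
rewrite -(@ltr_pXn2r _ 2) ?nnegrE ?nrm_ge0 ?ltW// sqr_nrm.
rewrite /ip /Rintegral; under eq_integral do rewrite -expr2.
exact: le_lt_trans (ler_norm _) Hn.
Unshelve. all: by end_near. Qed.

(* These sets form a sigma-algebra, so that it suffices to catch its generators. *)
Definition cl_sets := [set E : set T | measurable E /\ cl (\1_E)].

Lemma indic_bounded (E : set T) x : `|(\1_E x : R)| <= 1.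
Proof. by rewrite indicE; case: (_ \in _); rewrite ?normr1 ?normr0. Qed.

Lemma cl_sets_setC E : cl_sets E -> cl_sets (~` E).
Proof.
move=> [mE cE]; split; first exact: measurableC.
rewrite (_ : \1_(~` E) = fun x => 1 - \1_E x).
  by apply: L2_closureB => //; exact: L2_closure_alg.
apply/funext => x; rewrite !indicE in_setC; case: (_ \in _); rewrite ?subrr ?subr0//.
Qed.

Lemma cl_sets_setI E F : cl_sets E -> cl_sets F -> cl_sets (E `&` F).
Proof.
move=> [mE cE] [mF cF]; split; first exact: measurableI.
rewrite (_ : \1_(E `&` F) = fun x => \1_E x * \1_F x); last by rewrite indicI.
by apply: (@L2_closureM 1) => // x; exact: indic_bounded.
Qed.

Lemma cl_sets_lim (f_ : nat -> T -> R) (E N : set T) : measurable E ->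
  (forall n, V (f_ n)) -> (forall n x, `|f_ n x| <= 1) -> mu.-negligible N ->
  (forall x, ~ N x -> f_ ^~ x @ \oo --> (\1_E x : R)) -> cl_sets E.
Proof.
move=> mE Vf f1 N0 ff; split => //.
apply: (@L2_closure_dominated f_ _ (fun=> 1)) => //.
- exact: cst_L2.
- by move=> n; exact: L2_closure_alg.
- by move=> x; exact: indic_bounded.
by apply: negligibleS N0 => x /= nx; apply: contrapT => /ff.
Qed.

Lemma cl_sets_sigma_algebra : sigma_algebra setT cl_sets.
Proof.
have cT : cl_sets setT.
  split => //; rewrite indicT; exact: L2_closure_alg.
split.
- by rewrite -setCT; exact: cl_sets_setC.
- by move=> E cE; rewrite setTD; exact: cl_sets_setC.
(* [G n] is the union of the first [n] sets, in terms of complements and intersections. At each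
   point the indicators of the [G n] are eventually constant. *)
- move=> F cF; pose G n := ~` (\big[setI/setT]_(i < n) ~` F i).
  have cG n : cl_sets (G n).
    apply: cl_sets_setC; elim: n => [|n IH]; first by rewrite big_ord0.
    by rewrite big_ord_recr /=; apply: cl_sets_setI => //; apply: cl_sets_setC.
  have mF : measurable (\bigcup_n F n) by apply: bigcup_measurable => n _; exact: (cF n).1.
  split => //; apply: (@L2_closure_dominated (fun n => \1_(G n)) _ (fun=> 1)).
  + exact: cst_L2.
  + by move=> n; exact: (cG n).2.
  + exact: measurable_indic.
  + by move=> n x; exact: indic_bounded.
  + by move=> x; exact: indic_bounded.
  apply: aeW => x; apply: (@cvg_near_cst _ _ _ _ _ _ _).
  have [[k _ Fkx]|nF] := pselect ((\bigcup_n F n) x).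
    near=> n; have kn : (k < n)%N by near: n; exact: nbhs_infty_gt.
    rewrite !indicE [in RHS]mem_set ?mem_set//; last by exists k.
    by rewrite /G -(bigcap_mkord _ (fun i => ~` F i)) => /(_ k kn); exact.
  near=> n; rewrite !indicE !memNset// /G; apply.
  rewrite -(bigcap_mkord _ (fun i => ~` F i)) => i /= _.
  by move=> Fix; apply: nF; exists i.
Unshelve. all: by end_near. Qed.

Import HBNNSimple.

Lemma L2_closure_full : (forall E, measurable E -> cl_sets E) ->
  forall f, f \in L2 -> cl f.
Proof.
move=> H; have pos (f : T -> R) : f \in L2 -> (forall x, 0 <= f x) -> cl f.
  move=> lf f0; have mf := L2_measurable lf.
  have mEf : measurable_fun setT (EFin \o f) by exact/measurable_EFinP.
  pose f_ := nnsfun_approx measurableT mEf.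
  apply: (@L2_closure_dominated f_ _ f) => //.
  - move=> n; rewrite (_ : (f_ n : T -> R) = fun x =>
        \sum_(y \in range (f_ n)) (y * \1_(f_ n @^-1` [set y]) x)); last first.
      by apply/funext => x; rewrite fimfunE.
    under eq_fun do rewrite fsbig_finite//=.
    apply: L2_closure_sum => y; apply: L2_closureZ; apply: (H _ _).2.
    by rewrite -[X in measurable X]setTI; exact: measurable_funP.
  - move=> n x; rewrite ger0_norm// -lee_fin /f_ nnsfun_approxE.
    by apply: le_approx => //= y _; rewrite lee_fin.
  - by move=> x; rewrite ger0_norm.
  apply: aeW => x.
  have Ef0 y : setT y -> (0 <= (EFin \o f) y)%E by rewrite lee_fin.
  have := cvg_nnsfun_approx measurableT mEf Ef0 (I : setT x); exact: fine_cvg.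
move=> f lf; have mf := L2_measurable lf.
have := L2_closureB (pos (fun x => Num.max (f x) 0) _ _) (pos (fun x => Num.max (- f x) 0) _ _).
rewrite (_ : (fun x => _ - _) = f); last first.
  apply/funext => x; rewrite /Order.max; case: ltP => f1; case: ltP => f2; lra.
apply.
- apply: le_L2 lf _; first exact: measurable_maxr.
  by move=> x; rewrite /Order.max; case: ltP => // _; rewrite normr0.
- by move=> x; rewrite le_max lexx orbT.
- apply: le_L2 lf _; first by apply: measurable_maxr => //; exact: measurableT_comp.
  by move=> x; rewrite /Order.max; case: ltP => // _; rewrite ?normr0// normrN.
- by move=> x; rewrite le_max lexx orbT.
Qed.

End DenseAlgebra.

(** * Fourier analysis on the torus *)

Section TorusCharacters.
Variable R : realType.
Local Notation plane := (measurableTypeR R * measurableTypeR R)%type.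
Local Notation mu := (@square_measure R).
Local Notation L2 := (Lfun mu 2%:E).
Local Notation inner := (ip mu).
Implicit Types (z w : int * int) (p : plane).

Definition phase z (p : R * R) : R := 2 * pi * (z.1%:~R * p.1 + z.2%:~R * p.2).
(* [cos + sin] of the phases: a real orthonormal basis indexed by all of Z^2. *)
Definition character z (p : R * R) : R := cos (phase z p) + sin (phase z p).

Lemma measurable_phase z : measurable_fun setT (phase z : plane -> R).
Proof.
apply: measurable_funM => //; apply: measurable_funD; apply: measurable_funM => //.
Qed.

Lemma phaseD z w p : phase (z + w) p = phase z p + phase w p.
Proof. by rewrite /phase /= !intrD; ring. Qed.

Lemma phaseN z p : phase (- z) p = - phase z p.
Proof. by rewrite /phase /= !intrN; ring. Qed.

Lemma phaseB z w p : phase (z - w) p = phase z p - phase w p.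
Proof. by rewrite phaseD phaseN. Qed.

Lemma measurable_cosR : measurable_fun setT (@cos R).
Proof. by apply: continuous_measurable_fun; exact: continuous_cos. Qed.

Lemma measurable_sinR : measurable_fun setT (@sin R).
Proof. by apply: continuous_measurable_fun; exact: continuous_sin. Qed.

Lemma measurable_character z : measurable_fun setT (character z : plane -> R).
Proof.
apply: measurable_funD.
  exact: measurableT_comp measurable_cosR (measurable_phase z).
exact: measurableT_comp measurable_sinR (measurable_phase z).
Qed.

Lemma character_bounded z p : `|character z p| <= 2.
Proof.
by rewrite (le_trans (ler_normD _ _))// (_ : 2 = 1 + 1)// lerD ?cos_max ?sin_max.
Qed.

Lemma character_L2 z : character z \in L2.
Proof. by apply: bounded_L2 (character_bounded z); exact: measurable_character. Qed.

Lemma alternating_int (h : R -> R) : (forall t, h (t + pi) = - h t) ->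
  forall (k : int) t, h (t + 2 * pi * k%:~R) = h t.
Proof.
move=> hpi; have hp t : h (t + 2 * pi) = h t.
  by rewrite (_ : t + 2 * pi = t + pi + pi) ?hpi ?opprK//; ring.
have hn (n : nat) t : h (t + 2 * pi * n%:R) = h t.
  elim: n => [|n IH]; first by rewrite mulr0 addr0.
  by rewrite -(hp (t + 2 * pi * n%:R)) in IH; rewrite -IH -natr1; congr h; ring.
case=> n t; first exact: hn.
by rewrite NegzE -[LHS](hn n.+1); congr h; rewrite mulrNz; ring.
Qed.

(** Translating [x] by [1 / (2 w.1)] adds [pi] to the phase, hence changes the sign of the
    integrand, while periodicity preserves the integral. If [z.1 = 0], the coordinates are
    exchanged. *)
Lemma Rintegral_alternating (h : R -> R) z : measurable_fun setT h ->
  (forall t, `|h t| <= 1) -> (forall t, h (t + pi) = - h t) -> z != 0 ->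
  \int[mu]_p h (phase z p) = 0.
Proof.
move=> mh h1 hpi.
have main w : w.1 != 0 -> \int[mu]_p h (phase w p) = 0.
  move=> w10; have w10' : w.1%:~R != 0 :> R by rewrite intr_eq0.
  have mf : measurable_fun setT ((fun p => h (phase w p)) : plane -> R).
    exact: measurableT_comp mh (measurable_phase w).
  have ff : mu.-integrable setT (EFin \o (fun p => h (phase w p))).
    by apply: (@integrable_bounded _ _ _ _ _ 1).
  have := @Rintegral_shear R (cst (w.1%:~R^-1 / 2)) (fun p => h (phase w p)).
  rewrite (_ : (fun p => h (phase w (p.1 + _, p.2))) = (fun p => -1 * h (phase w p))).
    rewrite RintegralZl// => /(_ (measurable_cst _) mf) H.
    suff : -1 * \int[mu]_p h (phase w p) = \int[mu]_p h (phase w p) by lra.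
    apply: H => x y _; rewrite -[RHS](alternating_int hpi w.1).
    by congr h; rewrite /phase /=; ring.
  apply/funext => p; rewrite mulN1r -hpi; congr h; rewrite /phase /=.
  by field.
move=> z0; have [z10|] := eqVneq z.1 0; last exact: main.
have z20 : z.2 != 0.
  by apply: contraNneq z0 => z20; case: z z10 z20 => /= a b -> ->.
have mf : measurable_fun setT ((fun p => h (phase z p)) : plane -> R).
  exact: measurableT_comp mh (measurable_phase z).
rewrite -(Rintegral_flip mf) -(main (z.2, z.1))//.
by apply: eq_Rintegral => p _; congr h; rewrite /phase /=; ring.
Qed.

Lemma Rintegral_sq_cst c : \int[mu]_p (cst c p) = c.
Proof.
have mu1 : mu setT = 1%E := probability_setT mu.
transitivity (c * fine (mu setT)); first exact: Rintegral_cst.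
by rewrite mu1 mulr1.
Qed.

Lemma Rintegral_cos_phase z : \int[mu]_p cos (phase z p) = (z == 0)%:R.
Proof.
have [->|z0] := eqVneq z 0.
  rewrite -[RHS](Rintegral_sq_cst 1); apply: eq_Rintegral => p _.
  by rewrite /phase /= !mul0r addr0 mulr0 cos0.
apply: Rintegral_alternating => //; [exact: measurable_cosR|exact: cos_max|].
exact: cosDpi.
Qed.

Lemma Rintegral_sin_phase z : \int[mu]_p sin (phase z p) = 0.
Proof.
have [->|z0] := eqVneq z 0.
  rewrite -[RHS](Rintegral_sq_cst 0); apply: eq_Rintegral => p _.
  by rewrite /phase /= !mul0r addr0 mulr0 sin0.
apply: Rintegral_alternating => //; [exact: measurable_sinR|exact: sin_max|].
exact: sinDpi.
Qed.

(** Only the cosine of the difference and the sine of the sum occur. This gives orthonormality, and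
    it keeps products of characters in their span. *)
Lemma characterM z w p :
  character z p * character w p = cos (phase (z - w) p) + sin (phase (z + w) p).
Proof. by rewrite /character phaseB phaseD cosB sinD; ring. Qed.

Lemma character_orthonormal z w : inner (character z) (character w) = (z == w)%:R.
Proof.
rewrite /ip; under eq_Rintegral do rewrite characterM.
rewrite RintegralD//; first by rewrite Rintegral_cos_phase Rintegral_sin_phase addr0 subr_eq0.
- apply: (@integrable_bounded _ _ _ _ _ 1) => [|p]; last exact: cos_max.
  exact: measurableT_comp measurable_cosR (measurable_phase _).
- apply: (@integrable_bounded _ _ _ _ _ 1) => [|p]; last exact: sin_max.
  exact: measurableT_comp measurable_sinR (measurable_phase _).
Qed.

Definition coef z (f : plane -> R) : R := inner f (character z).
Definition trig_sum (s : seq (int * int)) (a : int * int -> R) p : R :=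
  \sum_(z <- s) a z * character z p.

Lemma trig_sum_L2 s a : trig_sum s a \in L2.
Proof. by apply: L2_sum => z _; apply: L2Z; exact: character_L2. Qed.

Lemma ip_trig_sum f s a : f \in L2 -> inner (trig_sum s a) f = \sum_(z <- s) a z * coef z f.
Proof.
move=> lf; rewrite ip_suml//; last by move=> z _; apply: L2Z; exact: character_L2.
by apply: eq_bigr => z _; rewrite ipZl ?character_L2// ipC.
Qed.

Lemma coef_trig_sum s a z : uniq s -> coef z (trig_sum s a) = if z \in s then a z else 0.
Proof.
move=> us; rewrite /coef ip_trig_sum ?character_L2//.
under eq_bigr do rewrite /coef character_orthonormal eq_sym.
case: ifPn => zs.
  by rewrite (bigD1_seq z)//= eqxx mulr1 big1 ?addr0// => w /negPf ->; rewrite mulr0.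
by rewrite big_seq big1// => w ws; case: eqP => [wz|]; rewrite ?mulr0//; move: zs; rewrite -wz ws.
Qed.

(** Pythagoras for the projection to the span of the characters in [s]. It contains Bessel's
    inequality ([a] the Fourier coefficients) and the optimality of these coefficients. *)
Lemma dist_trig_sum f s a : f \in L2 -> uniq s ->
  sqnrm mu (fun p => f p - trig_sum s a p) =
  inner f f - \sum_(z <- s) coef z f ^+ 2 + \sum_(z <- s) (coef z f - a z) ^+ 2.
Proof.
move=> lf us; rewrite ip_sqrB ?trig_sum_L2// (ipC _ f) !ip_trig_sum ?trig_sum_L2//.
rewrite -addrA -[RHS]addrA; congr (_ + _); rewrite -!sumrN mulr_sumr -sumrN -!big_split /=.
rewrite big_seq [RHS]big_seq; apply: eq_bigr => z zs.
by rewrite coef_trig_sum// zs; ring.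
Qed.

Lemma bessel f s : f \in L2 -> uniq s -> \sum_(z <- s) coef z f ^+ 2 <= inner f f.
Proof.
move=> lf us; rewrite -subr_ge0; have := dist_trig_sum (coef^~ f) lf us.
rewrite [X in _ + X]big1 ?addr0 => [<-|z _]; first exact: ip_ge0.
by rewrite subrr expr0n.
Qed.

Inductive trig : (plane -> R) -> Prop :=
| trig_character z : trig (character z)
| trigD f g : trig f -> trig g -> trig (fun p => f p + g p)
| trigZ c f : trig f -> trig (fun p => c * f p).

Lemma trig_cos z : trig (fun p => cos (phase z p)).
Proof.
have := trigZ (2^-1) (trigD (trig_character z) (trig_character (- z))).
rewrite (_ : (fun p => _) = (fun p => cos (phase z p)))//.
by apply/funext => p; rewrite /character phaseN cosN sinN; field.
Qed.

Lemma trig_sin z : trig (fun p => sin (phase z p)).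
Proof.
have := trigZ (2^-1) (trigD (trig_character z) (trigZ (-1) (trig_character (- z)))).
rewrite (_ : (fun p => _) = (fun p => sin (phase z p)))//.
by apply/funext => p; rewrite /character phaseN cosN sinN; field.
Qed.

Lemma trigM f g : trig f -> trig g -> trig (fun p => f p * g p).
Proof.
elim=> [z|f1 f2 _ IH1 _ IH2|c f1 _ IH] tg.
- elim: tg => [w|g1 g2 _ IH1 _ IH2|c g1 _ IH].
  + have := trigD (trig_cos (z - w)) (trig_sin (z + w)).
    by under [in X in _ -> X]eq_fun do rewrite characterM.
  + by under eq_fun do rewrite mulrDr; exact: trigD.
  + by under eq_fun do rewrite mulrCA; exact: trigZ.
- by under eq_fun do rewrite mulrDl; apply: trigD; [exact: IH1|exact: IH2].
- by under eq_fun do rewrite -mulrA; apply: trigZ; exact: IH.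
Qed.

Lemma trig_one : trig (fun=> 1).
Proof.
have := trig_cos 0; rewrite (_ : (fun p => _) = (fun=> 1))//.
by apply/funext => p; rewrite /phase /= !mul0r addr0 mulr0 cos0.
Qed.

Lemma trig_cst c : trig (fun=> c).
Proof. by have := trigZ c trig_one; under eq_fun do rewrite mulr1. Qed.

Lemma trigX f n : trig f -> trig (fun p => f p ^+ n).
Proof.
move=> tf; elim: n => [|n IH]; first exact: trig_one.
by under eq_fun do rewrite exprS; exact: trigM.
Qed.

Lemma trig_measurable f : trig f -> measurable_fun setT f.
Proof.
elim=> [z|f1 f2 _ IH1 _ IH2|c f1 _ IH]; first exact: measurable_character.
- exact: measurable_funD.
- exact: measurable_funM.
Qed.

Lemma trig_bounded f : trig f -> exists c, forall p, `|f p| <= c.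
Proof.
elim=> [z|f1 f2 _ [c1 IH1] _ [c2 IH2]|c f1 _ [c1 IH]].
- by exists 2; exact: character_bounded.
- by exists (c1 + c2) => p; rewrite (le_trans (ler_normD _ _))// lerD.
- by exists (`|c| * c1) => p; rewrite normrM ler_wpM2l.
Qed.

Lemma trig_sum_widen s s' a p : uniq s -> uniq s' -> {subset s <= s'} ->
  trig_sum s a p = trig_sum s' (fun z => if z \in s then a z else 0) p.
Proof.
move=> us us' ss; rewrite /trig_sum [RHS](bigID (mem s))/= [X in _ = _ + X]big1 ?addr0; last first.
  by move=> z /negPf ->; rewrite mul0r.
rewrite -[RHS]big_filter [RHS](perm_big s)/=.
  by rewrite big_seq [RHS]big_seq; apply: eq_bigr => z ->.
apply: uniq_perm => //; first by rewrite filter_uniq.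
by move=> z; rewrite mem_filter /=; case: (boolP (z \in s)) => //= /ss ->.
Qed.

Lemma trigE f : trig f -> exists s a, uniq s /\ f = trig_sum s a.
Proof.
elim=> [z|f1 f2 _ [s1 [a1 [u1 ->]]] _ [s2 [a2 [u2 ->]]]|c f1 _ [s1 [a1 [u1 ->]]]].
- exists [:: z], (fun=> 1); split => //; apply/funext => p.
  by rewrite /trig_sum big_seq1 mul1r.
- pose s := undup (s1 ++ s2).
  exists s, (fun z => (if z \in s1 then a1 z else 0) + (if z \in s2 then a2 z else 0)).
  split; [exact: undup_uniq|apply/funext => p].
  rewrite (@trig_sum_widen s1 s)// ?undup_uniq//; last first.
    by move=> z z1; rewrite mem_undup mem_cat z1.
  rewrite (@trig_sum_widen s2 s)// ?undup_uniq//; last first.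
    by move=> z z2; rewrite mem_undup mem_cat z2 orbT.
  by rewrite /trig_sum -big_split; apply: eq_bigr => z _; rewrite mulrDl.
- exists s1, (fun z => c * a1 z); split => //; apply/funext => p.
  by rewrite /trig_sum mulr_sumr; apply: eq_bigr => z _; rewrite mulrA.
Qed.

End TorusCharacters.

Lemma mrestr_null d (T : measurableType d) (R : realType)
    (mu : {measure set T -> \bar R}) (D A : set T) (mD : measurable D) :
  measurable A -> mu A = 0%E -> mrestr mu mD A = 0%E.
Proof. by move=> mA A0; apply: (subset_measure0 _ _ _ A0) => //; exact: measurableI. Qed.

Section StepLimit.
Variable R : realType.

Lemma bernoulli_sub (t : R) m : 0 <= t <= 1 -> 1 - m%:R * t <= (1 - t) ^+ m.
Proof.
move=> /andP[t0 t1]; elim: m => [|m IH]; first by rewrite mul0r subr0.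
rewrite exprS; apply: le_trans (ler_wpM2l _ IH); last by rewrite subr_ge0.
rewrite -natr1 -subr_ge0 (_ : _ - _ = m%:R * t ^+ 2); last by ring.
by rewrite mulr_ge0// sqr_ge0.
Qed.

Lemma bernoulli_add (t : R) m : 0 <= t -> 1 + m%:R * t <= (1 + t) ^+ m.
Proof.
move=> t0; elim: m => [|m IH]; first by rewrite mul0r addr0.
rewrite exprS; apply: le_trans (ler_wpM2l _ IH); last by rewrite addr_ge0.
rewrite -natr1 -subr_ge0 (_ : _ - _ = m%:R * t ^+ 2); last by ring.
by rewrite mulr_ge0// sqr_ge0.
Qed.

(* As [n] grows this tends to 1 for [q < 1/2] and to 0 for [q > 1/2], which makes
   half-planes limits of polynomials in a trigonometric polynomial. *)
Definition step_approx n (q : R) : R := (1 - q ^+ n) ^+ (2 ^ n)%N.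

Lemma step_approx_itv n q : 0 <= q <= 1 -> 0 <= step_approx n q <= 1.
Proof.
move=> /andP[q0 q1]; have qn0 : 0 <= q ^+ n by rewrite exprn_ge0.
have qn1 : q ^+ n <= 1 by rewrite exprn_ile1.
rewrite /step_approx exprn_ge0 ?exprn_ile1 ?subr_ge0//=.
by rewrite lerBlDl lerDr.
Qed.

(** By Bernoulli's inequality the value is at least [1 - 2^n q^n]. *)
Lemma cvg_step_approx_low q : 0 <= q -> q < 2^-1 -> step_approx ^~ q @ \oo --> (1 : R).
Proof.
move=> q0 q1; have q2 : `|2 * q| < 1.
  rewrite ger0_norm ?mulr_ge0//; lra.
apply: (@squeeze_cvgr _ _ _ _ (fun n => 1 - (2 * q) ^+ n) (cst 1)); last 2 first.
- rewrite -[X in _ --> X]subr0; apply: cvgB; first exact: cvg_cst.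
  exact: cvg_expr.
- exact: cvg_cst.
near=> n; have /andP[_ ->] : 0 <= step_approx n q <= 1 by apply: step_approx_itv; lra.
rewrite andbT exprMn -natrX; apply: bernoulli_sub.
by rewrite exprn_ge0// exprn_ile1//; lra.
Unshelve. all: by end_near. Qed.

(** With [t = q^n] and [M = 2^n], the product [(1 - t)^M (1 + t)^M] is at most 1 and
    [(1 + t)^M >= M t], so the value is at most [(2 q)^-n]. *)
Lemma cvg_step_approx_high q : 2^-1 < q -> q <= 1 -> step_approx ^~ q @ \oo --> (0 : R).
Proof.
move=> q1 q2; have q3 : `|(2 * q)^-1| < 1.
  by rewrite ger0_norm ?invr_ge0 ?invf_lt1; lra.
apply: (@squeeze_cvgr _ _ _ _ (cst 0) (fun n => (2 * q)^-1 ^+ n)); last 2 first.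
- exact: cvg_cst.
- exact: cvg_expr.
near=> n; have /andP[-> _] : 0 <= step_approx n q <= 1 by apply: step_approx_itv; lra.
rewrite /= exprVn.
have qn0 : 0 <= q ^+ n by rewrite exprn_ge0//; lra.
have qn1 : q ^+ n <= 1 by rewrite exprn_ile1//; lra.
have q2n : 0 < (2 * q) ^+ n by rewrite exprn_gt0//; lra.
rewrite -[leRHS]mul1r ler_pdivlMr//.
apply: (@le_trans _ _ (step_approx n q * (1 + q ^+ n) ^+ (2 ^ n)%N)).
  apply: ler_wpM2l; first by have /andP[] : 0 <= step_approx n q <= 1 by apply: step_approx_itv; lra.
  by apply: le_trans (bernoulli_add _ qn0); rewrite natrX -exprMn lerDr.
rewrite /step_approx -exprMn exprn_ile1//.
  by apply: mulr_ge0; lra.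
rewrite (_ : _ * _ = 1 - (q ^+ n) ^+ 2); last by ring.
by rewrite gerBl sqr_ge0.
Unshelve. all: by end_near. Qed.

(** The points [x] between 0 and [a] are those whose angle [2 pi x] is closer than [pi a] to the
    middle [pi a] of the arc, and the cosine decreases with this distance. *)
Lemma cos_arc_in (a x : R) : 0 < a < 1 -> 0 < x < 1 -> x < a ->
  cos (pi * a) < cos (2 * pi * x - pi * a).
Proof.
move=> /andP[a0 a1] /andP[x0 x1] xa; have pi0 := pi_gt0 R.
have pia0 : 0 < pi * a by rewrite mulr_gt0.
have pia1 : pi * a < pi by rewrite gtr_pMr.
have pix0 : 0 < pi * x by rewrite mulr_gt0.
have pix1 : pi * x < pi * a by rewrite ltr_pM2l.
have nlt : `|2 * pi * x - pi * a| < pi * a by rewrite ltr_norml; apply/andP; lra.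
rewrite -[X in _ < X]cos_norm ltr_cos// in_itv /=.
  by rewrite normr_ge0 (le_trans (ltW nlt))// ltW.
by rewrite !ltW.
Qed.

Lemma cos_arc_out (a x : R) : 0 < a < 1 -> 0 < x < 1 -> a < x ->
  cos (2 * pi * x - pi * a) < cos (pi * a).
Proof.
move=> /andP[a0 a1] /andP[x0 x1] xa; have pi0 := pi_gt0 R.
have pia0 : 0 < pi * a by rewrite mulr_gt0.
have pia1 : pi * a < pi by rewrite gtr_pMr.
have pix0 : pi * a < pi * x by rewrite ltr_pM2l.
have pix1 : pi * x < pi by rewrite gtr_pMr.
have iv1 : pi * a \in `[0, pi] by rewrite in_itv /= !ltW.
have [tpi|tpi] := leP (2 * pi * x - pi * a) pi.
  by rewrite ltr_cos// ?in_itv /=; [lra|apply/andP; lra].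
(* An angle beyond [pi] is reflected to its difference from [2 pi], which exceeds [pi a] because
   [x < 1]. *)
rewrite -cosN -(cosD2pi (- _)) mulr2n ltr_cos// ?in_itv /=; [lra|apply/andP; lra].
Qed.

End StepLimit.

Section TrigDense.
Variable R : realType.
Local Notation leb := (@lebesgue_measure R).
Local Notation plane := (measurableTypeR R * measurableTypeR R)%type.
Local Notation mu := (@square_measure R).
Local Notation L2 := (Lfun mu 2%:E).
Local Notation cls := (cl_sets mu (@trig R)).

Lemma negligible_outside : mu.-negligible (~` (unit_square R : set plane)).
Proof.
exists (~` unit_square R); split => //; first exact: measurableC (@unit_square_measurable R).
by rewrite /square_measure /mrestr setICl measure0.
Qed.

Lemma negligible_line (c : R) : mu.-negligible [set p : plane | p.1 = c].
Proof.
have -> : [set p : plane | p.1 = c] = [set c] `*` setT.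
  by apply/seteqP; split => p //= [].
have mA : measurable ([set c] `*` setT : set plane) by exact: measurableX.
exists ([set c] `*` setT); split => //.
apply: mrestr_null => //.
rewrite -[LHS]/((leb \x leb) ([set c] `*` setT))%E product_measure1E//.
by rewrite -[X in (X * _)%E]/(leb [set c]) lebesgue_measure_set1 mul0e.
Qed.

(** The sides [p.1 = 0], [p.1 = 1] and the line [p.1 = c] are discarded because periodic
    approximations of the half-plane [p.1 < c] cannot be controlled at its two jumps on the
    circle. *)
Lemma negligible_boundary (c : R) :
  mu.-negligible [set p : plane | ~ (0 < p.1 < 1 /\ p.1 != c)].
Proof.
have := negligibleU (negligible_outside) (negligibleU (negligible_line 0)
  (negligibleU (negligible_line 1) (negligible_line c))).
apply: negligibleS => p /= H; apply: contrapT => /not_orP[/contrapT[/= + _] /not_orP[p0 /not_orP[p1 pc]]].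
rewrite in_itv /= => /andP[p0' p1']; apply: H; split; last exact/eqP.
by rewrite !lt_neqAle p0' p1' eq_sym (introN eqP p0) (introN eqP p1).
Qed.

Lemma cl_sets_strip (a : R) : cls [set p | p.1 < a].
Proof.
have mE : measurable [set p : plane | p.1 < a].
  rewrite (_ : [set p : plane | p.1 < a] = `]-oo, a[%classic `*` setT); first exact: measurableX.
  by apply/seteqP; split => p /=; rewrite in_itv //= => -[].
have VM := @trig_measurable R; have VB := @trig_bounded R.
have [a0|a0] := leP a 0.
  apply: (cl_sets_lim VM VB (N := [set p | ~ (0 < p.1 < 1 /\ p.1 != a)]) (f_ := fun _ _ => 0)) => //.
  - by move=> n; exact: trig_cst.
  - by move=> n x; rewrite normr0.
  - exact: negligible_boundary.
  move=> p /contrapT[/andP[p0 p1] _].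
  rewrite indicE memNset; first exact: cvg_cst.
  by move=> /= pa; have := lt_trans p0 (lt_le_trans pa a0); rewrite ltxx.
have [a1|a1] := leP 1 a.
  apply: (cl_sets_lim VM VB (N := [set p | ~ (0 < p.1 < 1 /\ p.1 != a)]) (f_ := fun _ _ => 1)) => //.
  - by move=> n; exact: trig_one.
  - by move=> n x; rewrite normr1.
  - exact: negligible_boundary.
  move=> p /contrapT[/andP[p0 p1] _].
  rewrite indicE mem_set; first exact: cvg_cst.
  exact: lt_le_trans a1.
(* By the arc lemmas [q < 1/2] to the left of [a] and [q > 1/2] to the right; the factor [1/4] keeps
   [q] between 0 and 1. *)
pose q (p : plane) := 2^-1 + 4^-1 * (cos (pi * a) - cos (2 * pi * p.1 - pi * a)).
have tq : trig q.
  apply: (trigD (trig_cst _)); apply: (trigZ); apply: (trigD (trig_cst _)).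
  rewrite (_ : (fun p => _) = (fun p : plane => -1 * (cos (pi * a) * cos (phase (1, 0) p) + sin (pi * a) * sin (phase (1, 0) p)))).
    apply: trigZ; apply: trigD; apply: trigZ; [exact: trig_cos|exact: trig_sin].
  apply/funext => p; rewrite cosB (_ : phase (1, 0) p = 2 * pi * p.1); first by ring.
  by rewrite /phase /=; ring.
have q01 p : 0 <= q p <= 1.
  rewrite /q; have := cos_le1 (pi * a); have := cos_geN1 (pi * a).
  by have := cos_le1 (2 * pi * p.1 - pi * a); have := cos_geN1 (2 * pi * p.1 - pi * a); lra.
apply: (cl_sets_lim VM VB (N := [set p | ~ (0 < p.1 < 1 /\ p.1 != a)]) (f_ := fun n p => step_approx n (q p))) => //.
- move=> n; rewrite /step_approx.
  have := trigX (2 ^ n)%N (trigD (trig_one R) (trigZ (-1) (trigX n tq))).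
  by under eq_fun do rewrite mulN1r.
- by move=> n p; have /andP[s0 s1] := step_approx_itv n (q01 p); rewrite ger0_norm.
- exact: negligible_boundary.
move=> p /contrapT[/andP[p0 p1] pa].
have /andP[q0 q1] := q01 p.
have a01 : 0 < a < 1 by rewrite a0.
have p01 : 0 < p.1 < 1 by rewrite p0.
have [pa'|pa'] := ltP p.1 a.
  rewrite indicE mem_set//; apply: cvg_step_approx_low => //.
  by have := cos_arc_in a01 p01 pa'; rewrite /q; lra.
rewrite indicE memNset; last by apply/negP; rewrite -leNgt.
apply: cvg_step_approx_high => //.
have ap : a < p.1 by rewrite lt_neqAle eq_sym pa.
by have := cos_arc_out a01 p01 ap; rewrite /q; lra.
Qed.

Lemma Rintegral_flip_ip (f g : plane -> R) : measurable_fun setT f -> measurable_fun setT g ->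
  ip mu (f \o (@flip R)) (g \o (@flip R)) = ip mu f g.
Proof.
move=> mf mg; rewrite /ip -[RHS]Rintegral_flip//; exact: measurable_funM.
Qed.

Lemma flip_L2 (f : plane -> R) : f \in L2 -> (f \o (@flip R)) \in L2.
Proof. exact: (comp_L2 (@measurable_flip R) (@ge0_integral_flip R)). Qed.

Lemma trig_flip (f : plane -> R) : trig f -> trig (f \o (@flip R)).
Proof.
elim=> [z|f1 f2 _ IH1 _ IH2|c f1 _ IH]; last 2 first.
- exact: (trigD IH1 IH2).
- exact: (trigZ c IH).
rewrite (_ : _ \o _ = character (z.2, z.1)); first exact: trig_character.
by apply/funext => p; rewrite /character /phase /= [_ * p.2 + _]addrC.
Qed.

Lemma cl_sets_flip E : cls E -> cls ((@flip R) @^-1` E).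
Proof.
move=> [mE [lE cE]]; split.
  by rewrite -[X in measurable X]setTI; exact: measurable_flip.
have -> : \1_((@flip R) @^-1` E) = \1_E \o (@flip R) :> (plane -> R) by [].
split; first exact: flip_L2.
move=> e /cE[g tg ge]; exists (g \o (@flip R)); first exact: trig_flip.
rewrite /nrm -[X in ip _ X _]/((fun p => \1_E p - g p) \o (@flip R)).
rewrite (Rintegral_flip_ip (f := fun p => \1_E p - g p) (g := fun p => \1_E p - g p))//.
- by apply: measurable_funB => //; exact: trig_measurable.
- by apply: measurable_funB => //; exact: trig_measurable.
Qed.

(** The product sigma-algebra is generated by columns and rows over Borel sets, the Borel sets of
    the line by the half-lines [x < a], and the flip carries columns to rows. *)
Lemma trig_dense (f : plane -> R) : f \in L2 -> L2_closure mu (@trig R) f.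
Proof.
have VM := @trig_measurable R; have VB := @trig_bounded R.
have salg := cl_sets_sigma_algebra mu VM VB (@trig_one R) (@trigD R) (@trigZ R) (@trigM R).
apply: (L2_closure_full VM VB (@trig_one R) (@trigD R) (@trigZ R)) => E mE.
have col (A : set (measurableTypeR R)) : measurable A -> cls (fst @^-1` A).
  suff : measurable `<=` [set A | cls ((fst : plane -> _) @^-1` A)] by apply.
  rewrite RGenInftyO.measurableE; apply: smallest_sub => [|_ [x ->]]; last first.
    rewrite /= (_ : _ @^-1` _ = [set p | p.1 < x]); first exact: cl_sets_strip.
    by apply/seteqP; split => p; rewrite /= in_itv.
  have [s0 sC sU] := salg; split => [|B /= cB|F /= cF].
  - by rewrite /= preimage_set0.
  - by rewrite /= setTD preimage_setC -setTD; exact: sC.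
  - by rewrite /= preimage_bigcup; exact: sU.
have row (A : set (measurableTypeR R)) : measurable A -> cls (snd @^-1` A).
  by move=> mA; have := cl_sets_flip (col _ mA).
suff : measurable `<=` cls by apply.
apply: smallest_sub => // _ [[A mA <-]|[A mA <-]]; rewrite setTI; [exact: col|exact: row].
Qed.

(** A close trigonometric polynomial only gets closer when its coefficients are replaced by the
    Fourier coefficients of [f]. *)
Lemma trig_sum_dense (f : plane -> R) e : f \in L2 -> 0 < e ->
  exists s, [/\ uniq s, ip mu f f - \sum_(z <- s) coef z f ^+ 2 < e &
    sqnrm mu (fun p => f p - trig_sum s (fun z => coef z f) p) < e].
Proof.
move=> lf e0; have [_ H] := trig_dense lf.
have se0 : 0 < Num.sqrt e by rewrite sqrtr_gt0.
have [g /trigE[s [a [us ->]]] ge] := H _ se0.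
exists s; split => //.
  have := dist_trig_sum a lf us; move: ge; rewrite /nrm ltr_sqrt// => ge gE.
  apply: le_lt_trans ge; rewrite gE lerDl; apply: sumr_ge0 => z _; exact: sqr_ge0.
have := dist_trig_sum a lf us; move: ge; rewrite /nrm ltr_sqrt// => ge gE.
rewrite dist_trig_sum// [X in _ + X]big1 ?addr0 => [|z _]; last by rewrite subrr expr0n.
by apply: le_lt_trans ge; rewrite gE lerDl; apply: sumr_ge0 => z _; exact: sqr_ge0.
Qed.

End TrigDense.

(** * Spectral gap on the torus *)

(** Lagrange's identity. *)
Lemma sum_cauchy_schwarz (R : realFieldType) (n : nat) (v w : 'I_n -> R) :
  (\sum_i v i * w i) ^+ 2 <= (\sum_i v i ^+ 2) * (\sum_i w i ^+ 2).
Proof.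
have E1 : \sum_i \sum_j (v i * w j - v j * w i) ^+ 2 =
    2 * ((\sum_i v i ^+ 2) * (\sum_i w i ^+ 2) - (\sum_i v i * w i) ^+ 2).
  rewrite (eq_bigr (fun i => \sum_j (v i ^+ 2 * w j ^+ 2) + \sum_j (v j ^+ 2 * w i ^+ 2)
    + \sum_j (- 2 * (v i * w i) * (v j * w j)))); last first.
    by move=> i _; rewrite -!big_split /=; apply: eq_bigr => j _; ring.
  rewrite !big_split /= [X in _ + X + _]exchange_big /=.
  rewrite (eq_bigr (fun i => v i ^+ 2 * \sum_j w j ^+ 2)); last by move=> i _; rewrite mulr_sumr.
  rewrite [X in _ + X](eq_bigr (fun i => (v i * w i) * (- 2 * \sum_j (v j * w j)))); last first.
    by move=> i _; rewrite !mulr_sumr; apply: eq_bigr => j _; ring.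
  by rewrite -!mulr_suml; ring.
have : 0 <= \sum_i \sum_j (v i * w j - v j * w i) ^+ 2.
  by apply: sumr_ge0 => i _; apply: sumr_ge0 => j _; exact: sqr_ge0.
by rewrite E1 pmulr_rge0 ?ltr0n// subr_ge0.
Qed.

Section Spreading.
Variable R : realType.
Implicit Types (u e : nat -> R).

Lemma sqr_sum_le e n : (\sum_(i < n) e i) ^+ 2 <= n%:R * \sum_(i < n) e i ^+ 2.
Proof.
have := sum_cauchy_schwarz (fun=> 1 : R) (fun i : 'I_n => e i).
under eq_bigr do rewrite mul1r.
by under [X in _ <= X * _]eq_bigr do rewrite expr1n; rewrite sumr_const card_ord.
Qed.

(** If [u] varies slowly, [u 0] is nearly repeated [K] times, so a bound on the sum of the squares
    improves by the factor [K] for the single term. *)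
Lemma spread_sequence u K :
  K%:R * u 0%N ^+ 2 <= 2 * \sum_(j < K) u j ^+ 2 +
    2 * K%:R ^+ 2 * \sum_(i < K) (u i.+1 - u i) ^+ 2.
Proof.
set D := \sum_(i < K) (u i.+1 - u i) ^+ 2.
have D0 : 0 <= D by apply: sumr_ge0 => i _; exact: sqr_ge0.
have dist j : (j <= K)%N -> (u j - u 0%N) ^+ 2 <= K%:R * D.
  move=> jK; have -> : u j - u 0%N = \sum_(i < j) (u i.+1 - u i).
    by elim: j {jK} => [|j IH]; rewrite ?big_ord0 ?subrr// big_ord_recr /= -IH; ring.
  apply: le_trans (sqr_sum_le (fun i => u i.+1 - u i) j) _.
  rewrite ler_pM ?ler_nat//; first by apply: sumr_ge0 => i _; exact: sqr_ge0.
  rewrite /D (big_ord_widen _ (fun i => (u i.+1 - u i) ^+ 2) jK) [leRHS](bigID (fun i : 'I_K => (i < j)%N))/=.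
  by rewrite lerDl sumr_ge0// => i _; exact: sqr_ge0.
have H (j : 'I_K) : u 0%N ^+ 2 <= 2 * u j ^+ 2 + 2 * K%:R * D.
  (* This square equals [2 u_j^2 + 2 (u_j - u_0)^2 - u_0^2]. *)
  have := dist j (ltnW (ltn_ord j)); have := sqr_ge0 (2 * u j - u 0%N).
  by rewrite !sqrrB; lra.
move: (u 0%N ^+ 2) H => a H; clear dist.
have : \sum_(j < K) a <= \sum_(j < K) (2 * u j ^+ 2 + 2 * K%:R * D).
  by apply: ler_sum => j _; exact: H.
rewrite big_split /= -mulr_sumr !sumr_const !card_ord -[X in X <= _]mulr_natl.
rewrite -[X in _ <= _ + X]mulr_natl => /le_trans; apply.
by rewrite lerD2l le_eqVlt; apply/orP; left; apply/eqP; ring.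
Qed.

End Spreading.

Section TorusGap.
Variable R : realType.
Local Notation plane := (measurableTypeR R * measurableTypeR R)%type.
Local Notation mu := (@square_measure R).
Local Notation L2 := (Lfun mu 2%:E).
Local Notation inner := (ip mu).
Implicit Types (z w : int * int) (p : plane).

Definition shear (t : R) (p : R * R) : R * R := (p.1 + t * p.2, p.2).
(** The [j]-th power of the inverse transpose of the shear by [N]: composing a function with the
    shear moves its frequencies by this matrix. *)
Definition shear_dual (N : int) z (j : nat) : int * int := (z.1, z.2 - j%:Z * N * z.1).

Lemma measurable_shear_lin (t : R) : measurable_fun setT (shear t : plane -> plane).
Proof. by apply: (@measurable_shear _ (fun y => t * y)); exact: measurable_funM. Qed.

Lemma shear_L2 (t : R) (g : plane -> R) :
  (forall x y, 0 <= y <= 1 -> g (x + 1, y) = g (x, y)) -> g \in L2 -> g \o shear t \in L2.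
Proof.
move=> gper lg; have mg := L2_measurable lg.
have mt : measurable_fun setT (fun y : R => t * y) by exact: measurable_funM.
apply: integrable_sqr_L2; first exact: measurableT_comp (measurable_shear_lin t).
have /integrableP[mf2 f2] := Lfun2_integrable_sqr lg.
apply/integrableP; split; first exact: (measurableT_comp mf2 (measurable_shear_lin t)).
rewrite (@ge0_integral_shear R (fun y => t * y) (fun p => `|(g p ^+ 2)%:E|)%E)//.
  exact: measurableT_comp mf2.
by move=> x y yI; rewrite gper.
Qed.

Lemma character_periodic z x y : character z (x + 1, y) = character z (x, y) :> R.
Proof.
rewrite /character (_ : phase z (x + 1, y) = phase z (x, y) + 2 * pi * z.1%:~R).
  by rewrite (alternating_int (@cosDpi R)) (alternating_int (@sinDpi R)).
by rewrite /phase /=; ring.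
Qed.

Lemma coef_shear (N : int) z (g : plane -> R) :
  (forall x y, 0 <= y <= 1 -> g (x + 1, y) = g (x, y)) -> g \in L2 ->
  coef z (g \o shear N%:~R) = coef (shear_dual N z 1) g.
Proof.
move=> gper lg; have mg := L2_measurable lg.
rewrite /coef /ip -(@Rintegral_shear R (fun y => N%:~R * y) (fun p => g p * character (shear_dual N z 1) p)).
- apply: eq_Rintegral => p _; congr (_ * _).
  by rewrite /character /phase /= !intrB !intrM; congr (cos (_ * _) + sin (_ * _)); ring.
- exact: measurable_funM.
- by apply: measurable_funM => //; exact: measurable_character.
- by move=> x y yI; rewrite gper// character_periodic.
Qed.

(* Bessel bounds the coefficients of [g] along the dual-shear orbits of [S], provided
   that these orbits are disjoint. *)
Lemma spread_coef (N : int) (S : seq (int * int)) (K : nat) (g : plane -> R) :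
  (forall x y, 0 <= y <= 1 -> g (x + 1, y) = g (x, y)) -> g \in L2 ->
  uniq [seq shear_dual N z j | z <- S, j <- iota 0 K] -> (0 < K)%N ->
  \sum_(z <- S) coef z g ^+ 2 <= 2 / K%:R * inner g g +
    2 * K%:R * sqnrm mu (fun p => g (shear N%:~R p) - g p).
Proof.
move=> gper lg uS K0; have K0R : 0 < K%:R :> R by rewrite ltr0n.
have lgs := shear_L2 N%:~R gper lg.
set h : plane -> R := fun p => g (shear N%:~R p) - g p; have lh : h \in L2 by exact: L2B.
have dualS z j : shear_dual N (shear_dual N z j) 1 = shear_dual N z j.+1.
  by rewrite /shear_dual /=; congr (_, _); rewrite -addn1 PoszD; ring.
have eh z j : coef (shear_dual N z j.+1) g - coef (shear_dual N z j) g = coef (shear_dual N z j) h.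
  by rewrite -dualS -coef_shear// /coef -ipBl ?character_L2.
have dual0 z : shear_dual N z 0 = z.
  by case: z => a b; rewrite /shear_dual /= !mul0r subr0.
have H z : K%:R * coef z g ^+ 2 <= 2 * \sum_(j < K) coef (shear_dual N z j) g ^+ 2 +
    2 * K%:R ^+ 2 * \sum_(j < K) coef (shear_dual N z j) h ^+ 2.
  have := spread_sequence (fun j => coef (shear_dual N z j) g) K.
  by rewrite dual0; under [X in _ + _ * X]eq_bigr do rewrite eh.
have B f : f \in L2 -> \sum_(z <- S) \sum_(j < K) coef (shear_dual N z j) f ^+ 2 <= inner f f.
  move=> lf; apply: le_trans (bessel lf uS); rewrite big_allpairs_dep /=.
  by apply: ler_sum => z _; rewrite -[X in iota _ X]subn0 -/(index_iota 0 K) big_mkord.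
have : \sum_(z <- S) K%:R * coef z g ^+ 2 <= 2 * inner g g + 2 * K%:R ^+ 2 * inner h h.
  apply: le_trans (ler_sum _ (fun z _ => H z)) _.
  rewrite big_split /= -!mulr_sumr; apply: lerD; apply: ler_wpM2l => //; try exact: B.
rewrite -mulr_sumr -ler_pdivlMl//; move=> /le_trans; apply.
by rewrite le_eqVlt; apply/orP; left; apply/eqP; field; rewrite gt_eqF.
Qed.

(* Ping-pong: as [N >= 3], the dual shear moves a frequency of the cone [|l| <= |n|]
   out of the cone, by at least [3 |n|]. *)
Lemma cone_uniq (N : int) (S : seq (int * int)) (K : nat) : 3 <= N -> uniq S ->
  (forall z, z \in S -> z.1 != 0 /\ `|z.2| <= `|z.1|) ->
  uniq [seq shear_dual N z j | z <- S, j <- iota 0 K].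
Proof.
move=> N3 uS HS; apply: allpairs_uniq => //; first exact: iota_uniq.
move=> [z j] [w k] /allpairsP[[z1 j1] [/= z1S _ [-> ->]]] /allpairsP[[w1 k1] [/= w1S _ [-> ->]]].
move=> {z j w k} [e1 e2].
have [z0 zl] := HS _ z1S; have [w0 wl] := HS _ w1S.
(* With different exponents the second coordinates would differ by at least [3 |z1.1|], whereas the
   cone allows only [2 |z1.1|]. *)
have jk : j1%:Z = k1%:Z.
  apply/eqP; rewrite -subr_eq0; apply: contraT => jk0.
  have : `|z1.2 - w1.2| = `|j1%:Z - k1%:Z| * N * `|z1.1|.
    rewrite -[N in RHS]ger0_norm; last by lia.
    rewrite -!normrM (_ : z1.2 = w1.2 - k1%:Z * N * w1.1 + j1%:Z * N * z1.1).
      by rewrite -e1; congr `|_|; ring.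
    by rewrite -e2 subrK.
  have := ler_normB z1.2 w1.2; rewrite -e1 in wl.
  have j1k : 1 <= `|j1%:Z - k1%:Z| by rewrite -gtz0_ge1 normr_gt0.
  have z1p : 1 <= `|z1.1| by rewrite -gtz0_ge1 normr_gt0.
  have : 3 * `|z1.1| <= `|j1%:Z - k1%:Z| * N * `|z1.1|.
    by rewrite ler_wpM2r// (le_trans N3)// ler_peMl// (le_trans _ N3).
  by move=> h1 h2 h3; rewrite h3 in h2; lra.
case: jk e2 => -> e2; rewrite e1 in e2.
congr (_, _); case: z1 w1 e1 e2 {z1S w1S z0 zl w0 wl} => a b [c d] /= -> /=.
by move/addIr => ->.
Qed.

Lemma coef_flip z (g : plane -> R) : measurable_fun setT g ->
  coef z (g \o (@flip R)) = coef (z.2, z.1) g.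
Proof.
move=> mg; rewrite /coef -(@Rintegral_flip_ip R g); last 2 first.
- exact: mg.
- exact: measurable_character.
apply: eq_ip => // p.
by rewrite /character /phase /= [_ * p.2 + _]addrC.
Qed.

(** Every nonzero frequency lies in one of the cones [|l| <= |n|] and [|n| <= |l|], and mean zero
    removes the frequency 0. With orbits of length 8 each cone carries at most a quarter of
    [inner g g] plus 16 times a displacement; absorbing the resulting half turns 16 into 32. *)
Lemma torus_gap_mean0 (N : int) (g : plane -> R) : 3 <= N ->
  (forall x y, g (x + 1, y) = g (x, y)) -> (forall x y, g (x, y + 1) = g (x, y)) ->
  g \in L2 -> \int[mu]_p g p = 0 ->
  inner g g <= 32 *
    (sqnrm mu (fun p => g (p.1 + N%:~R * p.2, p.2) - g p) +
     sqnrm mu (fun p => g (p.1, p.2 + N%:~R * p.1) - g p)).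
Proof.
move=> N3 g1 g2 lg g0; have mg := L2_measurable lg.
set ea := inner (fun p => g (p.1 + N%:~R * p.2, p.2) - g p) _.
set eb := inner (fun p => g (p.1, p.2 + N%:~R * p.1) - g p) _.
have eaE : ea = sqnrm mu (fun p => g (shear N%:~R p) - g p) by [].
apply/ler_addgt0Pr => e e0.
have [s [us sg _]] := trig_sum_dense lg (divr_gt0 e0 (ltr0n _ 2)).
pose S1 := [seq z <- s | (z.1 != 0) && (`|z.2| <= `|z.1|)].
pose S2 := [seq (z.2, z.1) | z <- [seq z <- s | (z.2 != 0) && (`|z.1| <= `|z.2|)]].
have uS1 : uniq S1 by rewrite filter_uniq.
have uS2 : uniq S2 by rewrite map_inj_uniq ?filter_uniq// => -[a b] [c d] [-> ->].
have B1 : \sum_(z <- S1) coef z g ^+ 2 <= 4^-1 * inner g g + 16 * ea.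
  have := @spread_coef N S1 8 g (fun x y _ => g1 x y) lg.
  rewrite cone_uniq// -?eaE; last by move=> z; rewrite mem_filter => /andP[/andP[]].
  by move=> /(_ isT isT); lra.
have gf1 x y : 0 <= y <= 1 -> (g \o (@flip R)) (x + 1, y) = (g \o (@flip R)) (x, y).
  by move=> _; exact: g2.
have B2 : \sum_(z <- S2) coef (z.2, z.1) g ^+ 2 <= 4^-1 * inner g g + 16 * eb.
  have := @spread_coef N S2 8 (g \o (@flip R)) gf1 (flip_L2 lg).
  rewrite cone_uniq//; last first.
    by move=> z /mapP[w]; rewrite mem_filter => /andP[/andP[w2 w12] _] ->.
  have mgs : measurable_fun setT (fun p : plane => g (p.1, p.2 + N%:~R * p.1) - g p).
    apply: measurable_funB => //.
    exact: (L2_measurable (flip_L2 (shear_L2 N%:~R gf1 (flip_L2 lg)))).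
  have -> : sqnrm mu (fun p => (g \o (@flip R)) (shear N%:~R p) - (g \o (@flip R)) p) = eb.
    exact: (Rintegral_flip_ip mgs mgs).
  rewrite (Rintegral_flip_ip mg mg); under eq_bigr do rewrite coef_flip//.
  by move=> /(_ isT isT); lra.
have c0 z : z == 0 -> coef z g ^+ 2 = 0.
  move=> /eqP ->; rewrite /coef /ip (_ : \int[mu]_p _ = 0) ?expr0n// -[RHS]g0.
  by apply: eq_Rintegral => p _; rewrite /character /phase /= !mul0r addr0 mulr0 cos0 sin0 addr0 mulr1.
have split_sum : \sum_(z <- s) coef z g ^+ 2 <=
    \sum_(z <- S1) coef z g ^+ 2 + \sum_(z <- S2) coef (z.2, z.1) g ^+ 2.
  rewrite /S1 /S2 big_map !big_filter /=.
  under [X in _ + X]eq_bigr do rewrite -surjective_pairing.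
  rewrite [X in _ <= X + _]big_mkcond [X in _ <= _ + X]big_mkcond -big_split /=.
  apply: ler_sum => z _; have cz := sqr_ge0 (coef z g).
  have [z0|z0] := eqVneq z 0; first by rewrite c0 ?z0//; do 2 case: ifP => _; rewrite ?addr0 ?c0 ?addr0.
  case: (leP `|z.2| `|z.1|) => [h|/ltW h].
    have -> : z.1 != 0.
      apply: contraNneq z0 => z10; move: h; rewrite z10 normr0 normr_le0 => /eqP z20.
      by case: z z10 z20 {cz} => a b /= -> ->.
    by rewrite /= lerDl; case: ifP.
  have -> : z.2 != 0.
    apply: contraNneq z0 => z20; move: h; rewrite z20 normr0 normr_le0 => /eqP z10.
    by case: z z10 z20 {cz} => a b /= -> ->.
  by rewrite h /= lerDr; case: ifP.
by lra.
Qed.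

Lemma torus_gap (N : int) (g : plane -> R) : 3 <= N ->
  (forall x y, g (x + 1, y) = g (x, y)) -> (forall x y, g (x, y + 1) = g (x, y)) ->
  g \in L2 ->
  sqnrm mu (fun p => g p - \int[mu]_q g q) <= 32 *
    (sqnrm mu (fun p => g (p.1 + N%:~R * p.2, p.2) - g p) +
     sqnrm mu (fun p => g (p.1, p.2 + N%:~R * p.1) - g p)).
Proof.
move=> N3 g1 g2 lg; set c := \int[mu]_q g q.
have lgc : (fun p : plane => g p - c) \in L2 by apply: L2B => //; exact: cst_L2.
have l1 : (fun=> 1 : R) \in L2 := cst_L2 mu 1.
have := @torus_gap_mean0 N (fun p => g p - c) N3 _ _ lgc.
have cancel_c (S : plane -> plane) :
    sqnrm mu (fun p => g (S p) - c - (g p - c)) =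
    sqnrm mu (fun p => g (S p) - g p).
  by apply: eq_ip => p; ring.
rewrite (cancel_c (fun p => (p.1 + N%:~R * p.2, p.2))).
rewrite (cancel_c (fun p => (p.1, p.2 + N%:~R * p.1))).
apply.
- by move=> x y; rewrite g1.
- by move=> x y; rewrite g2.
have ip1 f : \int[mu]_p f p = inner f (fun=> 1) by apply: eq_Rintegral => p _; rewrite mulr1.
rewrite ip1 ipBl//; last exact: cst_L2.
by rewrite -!ip1 Rintegral_sq_cst subrr.
Qed.

End TorusGap.

(** * Weak limits along a strip *)

Section WeakStrip.
Variable R : realType.
Local Notation plane := (measurableTypeR R * measurableTypeR R)%type.
Local Notation mu := (@square_measure R).
Local Notation L2 := (Lfun mu 2%:E).
Local Notation inner := (ip mu).
Implicit Types (z w : int * int) (p : plane).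

Definition translate_x (k : R) (p : R * R) : R * R := (p.1 + k, p.2).

Lemma measurable_translate_x (k : R) : measurable_fun setT (translate_x k : plane -> plane).
Proof. exact: (@measurable_shear _ (cst k)). Qed.

Lemma measurable_stretch (c : R) : measurable_fun setT ((fun p => (c * p.1, p.2)) : plane -> plane).
Proof. by apply/measurable_fun_pair => //=; exact: measurable_funM. Qed.

Lemma ge0_Rintegral_stretch (N : nat) (V : plane -> R) : (0 < N)%N ->
  measurable_fun setT V -> (forall p, 0 <= V p) ->
  (forall k : nat, mu.-integrable setT (EFin \o V \o translate_x k%:R)) ->
  mu.-integrable setT (fun p => (V (N%:R * p.1, p.2))%:E) /\
  N%:R * \int[mu]_p V (N%:R * p.1, p.2) = \sum_(k < N) \int[mu]_p V (translate_x k%:R p).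
Proof.
move=> N0 mV V0 iV; have mEV : measurable_fun setT (EFin \o V) by exact/measurable_EFinP.
have N0R : 0 < N%:R :> R by rewrite ltr0n.
have EV0 p : (0 <= (EFin \o V) p)%E by rewrite lee_fin.
have := ge0_integral_square_stretch N0 mEV EV0.
have -> : (\sum_(k < N) \int[mu]_p (EFin \o V) ((p.1 + k%:R)%R, p.2) =
    (\sum_(k < N) \int[mu]_p V (translate_x k%:R p))%:E)%E.
  rewrite -sumEFin; apply: eq_bigr => k _; rewrite /Rintegral fineK//.
  exact: (integrable_fin_num _ (iV k)).
set I := (\int[mu]_p _)%E => H.
have I0 : (0 <= I)%E by apply: integral_ge0 => p _; exact: EV0.
have Ifin : I \is a fin_num.
  rewrite ge0_fin_numE// ltey; apply/eqP => Ioo; move: H.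
  by rewrite Ioo gt0_muley// lte_fin.
split; last by rewrite /Rintegral -[I]fineK// in H *; case: H.
apply/integrableP; split.
  exact: (measurableT_comp mEV (measurable_stretch N%:R)).
under eq_integral do rewrite gee0_abs ?EV0//.
by rewrite -ge0_fin_numE.
Qed.

Definition rescale (N : nat) (G : plane -> R) (p : plane) : R := G (N%:R * p.1, p.2).

Lemma measurable_rescale N G : measurable_fun setT G -> measurable_fun setT (rescale N G).
Proof. by move=> mG; exact: (measurableT_comp mG (measurable_stretch N%:R)). Qed.

Lemma rescale_L2 N (G : plane -> R) : (0 < N)%N -> measurable_fun setT G ->
  (forall k : nat, (G \o translate_x k%:R) \in L2) -> rescale N G \in L2.
Proof.
move=> N0 mG lG; apply: integrable_sqr_L2; first exact: measurable_rescale.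
have mG2 : measurable_fun setT (fun p => G p ^+ 2) by exact: measurable_funX.
have [] // := ge0_Rintegral_stretch N0 mG2 (fun p => sqr_ge0 (G p)).
by move=> k; exact: (Lfun2_integrable_sqr (lG k)).
Qed.

(** Polarization, as the stretching formula is available for nonnegative functions. *)
Lemma ip_rescale N (G W : plane -> R) : (0 < N)%N ->
  measurable_fun setT G -> measurable_fun setT W ->
  (forall k : nat, (G \o translate_x k%:R) \in L2) -> (forall k : nat, (W \o translate_x k%:R) \in L2) ->
  N%:R * inner (rescale N G) (rescale N W) =
  \sum_(k < N) inner (G \o translate_x k%:R) (W \o translate_x k%:R).
Proof.
move=> N0 mG mW lG lW.
have sqr (F : plane -> R) : measurable_fun setT F -> (forall k : nat, (F \o translate_x k%:R) \in L2) ->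
    N%:R * sqnrm mu (rescale N F) = \sum_(k < N) sqnrm mu (F \o translate_x k%:R).
  move=> mF lF; apply: (ge0_Rintegral_stretch (V := fun p => F p * F p) N0 _ _ _).2 => [|p|k].
  - exact: measurable_funM.
  - by rewrite -expr2 sqr_ge0.
  - exact: (L2_mul_integrable (lF k) (lF k)).
have := sqr (fun p => G p + W p) (measurable_funD mG mW) (fun k => L2D (lG k) (lW k)).
have -> : rescale N (fun p => G p + W p) = fun p => rescale N G p + rescale N W p by [].
rewrite (ip_sqrD (rescale_L2 N0 mG lG) (rescale_L2 N0 mW lW)).
rewrite (eq_bigr _ (fun (k : 'I_N) _ => ip_sqrD (lG k) (lW k))).
rewrite !big_split /= -mulr_sumr !mulrDr (sqr G mG lG) (sqr W mW lW).
move: (\sum_(k < N) sqnrm mu (G \o _)) (\sum_(k < N) sqnrm mu (W \o _)) => a b H.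
by apply: (mulfI (lt0r_neq0 (ltr0n R 2))); lra.
Qed.

(* For [z.1 != 0] the orbit of [z] under the dual shear is infinite, already for [N = 1]. *)
Lemma coef_invariant_small z (d C : R) : z.1 != 0 -> 0 < d -> 0 <= C ->
  exists2 e, 0 < e & forall F : plane -> R, F \in L2 ->
    (forall x y, F (x + 1, y) = F (x, y)) -> inner F F <= C ->
    sqnrm mu (fun p => F (p.1 + p.2, p.2) - F p) <= e ->
    coef z F ^+ 2 <= d.
Proof.
move=> z0 d0 C0; have [K /andP[K0 Kd]] : exists K : nat, (0 < K)%N && (4 * C <= d * K%:R).
  exists (Num.truncn (4 * C / d)).+1; rewrite /= mulrC [_ * _.+1%:R]mulrC -ler_pdivrMr//.
  by rewrite ltW// [C * 4]mulrC truncnS_gt.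
have K0R : 0 < K%:R :> R by rewrite ltr0n.
(* Each of the two terms of [spread_coef] is then at most [d / 2]. *)
exists (d / (4 * K%:R)); first by rewrite divr_gt0// mulr_gt0.
move=> F lF F1 FC Fe.
have := @spread_coef R 1 [:: z] K F (fun x y _ => F1 x y) lF.
rewrite big_seq1 => H.
have {H} := H _ K0.
have -> : sqnrm mu (fun p => F (shear 1%:~R p) - F p) =
    sqnrm mu (fun p => F (p.1 + p.2, p.2) - F p).
  by apply: eq_ip => p; rewrite /shear mul1r.
set E := inner _ _ in Fe *; move=> H.
have u : uniq [seq shear_dual 1 z0 j | z0 <- [:: z], j <- iota 0 K].
  rewrite /= cats0 map_inj_uniq ?iota_uniq// => j k [/addrI/oppr_inj].
  by rewrite !mulr1 => /(mulIf z0) [->].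
apply: le_trans (H u) _.
have h1 : 2 / K%:R * inner F F <= d / 2.
  rewrite mulrAC ler_pdivrMr// (le_trans (ler_wpM2l _ FC))//; lra.
have h2 : 2 * K%:R * E <= d / 2.
  rewrite ler_pdivlMr ?mulr_gt0// in Fe; lra.
by lra.
Qed.

Lemma coefs_invariant_small (s : seq (int * int)) (d C : R) : 0 < d -> 0 <= C ->
  exists2 e, 0 < e & forall F : plane -> R, F \in L2 ->
    (forall x y, F (x + 1, y) = F (x, y)) -> inner F F <= C ->
    sqnrm mu (fun p => F (p.1 + p.2, p.2) - F p) <= e ->
    forall z, z \in s -> z.1 != 0 -> coef z F ^+ 2 <= d.
Proof.
move=> d0 C0; elim: s => [|z s [e e0 He]]; first by exists 1.
have [z0|z0] := eqVneq z.1 0.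
  exists e => // F lF F1 FC Fe w; rewrite inE => /orP[/eqP ->|]; first by rewrite z0 eqxx.
  exact: He.
have [e' e'0 He'] := coef_invariant_small z0 d0 C0.
exists (Num.min e e'); first by rewrite lt_min e0.
move=> F lF F1 FC; rewrite le_min => /andP[Fe Fe'] w; rewrite inE => /orP[/eqP -> _|].
  exact: He'.
exact: He.
Qed.

(** A shear-invariant function has only frequencies with [z.1 = 0], and [W] has none of them. Up to
    a small error in norm, [W] has finitely many frequencies, for which a common [e] exists. *)
Lemma ip_invariant_small (W : plane -> R) (d C : R) : W \in L2 ->
  (forall l, coef (0, l) W = 0) -> 0 < d -> 0 <= C ->
  exists2 e, 0 < e & forall F : plane -> R, F \in L2 ->
    (forall x y, F (x + 1, y) = F (x, y)) -> inner F F <= C ->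
    sqnrm mu (fun p => F (p.1 + p.2, p.2) - F p) <= e ->
    `|inner F W| <= d.
Proof.
move=> lW W0 d0 C0.
have C10 : 0 < C + 1 by rewrite ltr_wpDl.
have e10 : 0 < (d / 2) ^+ 2 / (C + 1) by rewrite divr_gt0// exprn_gt0// divr_gt0.
have [s [us _ Ws]] := trig_sum_dense lW e10.
pose B := \sum_(z <- s) `|coef z W| + 1.
have B0 : 0 < B by rewrite ltr_wpDl// sumr_ge0.
have dB : 0 < (d / 2 / B) ^+ 2 by rewrite exprn_gt0// !divr_gt0.
have [e e0 He] := coefs_invariant_small s dB C0.
exists e => // F lF F1 FC Fe.
pose P := trig_sum s (fun z => coef z W); have lP : P \in L2 := trig_sum_L2 _ _.
have lWP : (fun p => W p - P p) \in L2 by exact: L2B.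
have -> : inner F W = inner F (fun p => W p - P p) + inner F P.
  by rewrite (ipC _ F (fun p => W p - P p)) ipBl// (ipC _ W) (ipC _ P) subrK.
rewrite (le_trans (ler_normD _ _))// [d in leRHS]splitr lerD//.
  rewrite -(@ler_pXn2r _ 2) ?nnegrE ?divr_ge0 ?(ltW d0)//.
  rewrite real_normK ?num_real// (le_trans (cauchy_schwarz lF lWP))//.
  apply: le_trans (ler_pM _ _ FC (ltW Ws)) _; rewrite ?ip_ge0//.
  rewrite mulrA ler_pdivrMr// mulrC ler_wpM2l ?sqr_ge0// lerDl//.
rewrite ipC ip_trig_sum// (le_trans (ler_norm_sum _ _ _))//.
have Hz z : z \in s -> `|coef z W * coef z F| <= `|coef z W| * (d / 2 / B).
  move=> zs; rewrite normrM; have [z0|z0] := eqVneq z.1 0.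
    by case: z z0 zs => a b /= -> _; rewrite W0 normr0 !mul0r.
  rewrite ler_wpM2l// -(@ler_pXn2r _ 2) ?nnegrE ?divr_ge0 ?(ltW d0) ?(ltW B0)//.
  by rewrite real_normK ?num_real// He.
rewrite big_seq (le_trans (ler_sum _ Hz))// -big_seq -mulr_suml.
rewrite mulrA ler_pdivrMr// mulrC ler_wpM2l ?divr_ge0 ?(ltW d0)//.
by rewrite lerDl.
Qed.

(* Rescaling [x] by [N] turns the strip of [N] squares into one square and the shear
   by [N] into the shear by 1. *)
Lemma weak_strip (N : nat) (w : plane -> R) (d C : R) : (0 < N)%N ->
  measurable_fun setT w -> (exists c, forall p, `|w p| <= c) ->
  (forall l, \sum_(k < N) inner (w \o translate_x k%:R) (character (0, l)) = 0) ->
  0 < d -> 0 <= C ->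
  exists2 e, 0 < e & forall G : plane -> R, measurable_fun setT G ->
    (forall k : nat, (G \o translate_x k%:R) \in L2) ->
    (forall k : nat, (fun p => G (p.1 + k%:R + N%:R * p.2, p.2)) \in L2) ->
    (forall x y, G (x + N%:R, y) = G (x, y)) ->
    \sum_(k < N) sqnrm mu (G \o translate_x k%:R) <= C ->
    \sum_(k < N) sqnrm mu (fun p => G (p.1 + k%:R + N%:R * p.2, p.2) - G (p.1 + k%:R, p.2)) <= e ->
    `|\sum_(k < N) inner (G \o translate_x k%:R) (w \o translate_x k%:R)| <= d.
Proof.
move=> N0 mw [c wc] w0 d0 C0; have N0R : 0 < N%:R :> R by rewrite ltr0n.
have lw (k : nat) : (w \o translate_x k%:R) \in L2.
  apply: (@bounded_L2 _ _ _ _ _ c) => [|p]; last exact: wc.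
  exact: measurableT_comp (measurable_translate_x k%:R).
have lW := rescale_L2 N0 mw lw.
(* A character [(0, l)] depends on [y] only, so rescaling and translations fix it, and the
   hypothesis on the sum over the strip becomes orthogonality to the rescaled [w]. *)
have W0 l : coef (0, l) (rescale N w) = 0.
  apply: (mulfI (lt0r_neq0 N0R)); rewrite mulr0 /coef.
  rewrite -[X in inner _ X]/(character (0, l)).
  have -> : inner (rescale N w) (character (0, l)) = inner (rescale N w) (rescale N (character (0, l))).
    by apply: eq_ip => // p; rewrite /rescale /character /phase /= !mul0r.
  have ctx k : character (0, l) \o translate_x k = character (0, l) :> (plane -> R).
    by apply/funext => p; rewrite /character /phase /= !mul0r.
  rewrite ip_rescale//; first by under eq_bigr do rewrite ctx; exact: w0.
  - exact: measurable_character.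
  - by move=> k; rewrite ctx; exact: character_L2.
have [e e0 He] := ip_invariant_small lW W0 (divr_gt0 d0 N0R) (divr_ge0 C0 (ltW N0R)).
exists (N%:R * e); first by rewrite mulr_gt0.
move=> G mG lG lG' GN GC Ge.
rewrite -ip_rescale// normrM (gtr0_norm N0R) mulrC -ler_pdivlMr//.
have lF := rescale_L2 N0 mG lG.
apply: He => //.
- by move=> x y; rewrite /rescale /= mulrDr mulr1 GN.
- by rewrite ler_pdivlMr// mulrC ip_rescale.
pose H p := G (p.1 + N%:R * p.2, p.2) - G p.
have mH : measurable_fun setT H.
  by apply: measurable_funB => //; exact: (measurableT_comp mG (measurable_shear_lin N%:R)).
have lH (k : nat) : H \o translate_x k%:R \in L2 by exact: (L2B (lG' k) (lG k)).
rewrite (@eq_ip _ _ _ _ _ (rescale N H) _ (rescale N H)).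
- by rewrite -(ler_pM2l N0R) ip_rescale.
- by move=> p; rewrite /rescale /H /= mulrDr.
- by move=> p; rewrite /rescale /H /= mulrDr.
Qed.

End WeakStrip.

(** * Developing map and multitwists *)

Lemma continuous_pair (X Y Z : topologicalType) (f : X -> Y) (g : X -> Z) :
  continuous f -> continuous g -> continuous (fun x => (f x, g x)).
Proof. by move=> fc gc x; exact: (cvg_pair (fc x) (gc x)). Qed.

Lemma continuous_fst (X Y : topologicalType) : continuous (fst : X * Y -> X).
Proof. by move=> p; exact: cvg_fst. Qed.

Lemma continuous_snd (X Y : topologicalType) : continuous (snd : X * Y -> Y).
Proof. by move=> p; exact: cvg_snd. Qed.

Lemma continuous_comp_fun (X Y Z : topologicalType) (f : X -> Y) (g : Y -> Z) :
  continuous f -> continuous g -> continuous (fun x => g (f x)).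
Proof. by move=> fc gc x; exact: (continuous_comp (fc x) (gc (f x))). Qed.

Section Developing.
Variables (R : realType) (O : origami_datum).
Local Notation m := (nsquares O).
Local Notation sigma := (origami_sigma O).
Local Notation tau := (origami_tau O).
Local Notation surf := (surface R O).
Local Notation plane := (measurableTypeR R * measurableTypeR R)%type.
Implicit Types (i : 'I_m) (p : R * R) (k : int).

Definition clamp (t : R) : R := Num.max 0 (Num.min t 1).

Lemma clamp_itv t : 0 <= clamp t <= 1.
Proof. by rewrite /clamp le_max lexx ge_max ler01 ge_min lexx orbT. Qed.

Lemma clamp_id t : 0 <= t <= 1 -> clamp t = t.
Proof. by move=> /andP[t0 t1]; rewrite /clamp (min_idPl t1) (max_idPr t0). Qed.

Lemma clamp_continuous : continuous clamp.
Proof.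
have -> : clamp = fun t : R => (`|t| - `|t - 1| + 1) / 2.
  apply/funext => t; rewrite /clamp /Order.max /Order.min.
  case: (ltrP t 1) => t1; case: ltrP => t0.
  - by rewrite gtr0_norm//; lra.
  - by rewrite ler0_norm//; lra.
  - by rewrite ger0_norm ?(le_trans _ t1)//; lra.
  - by lra.
move=> t; apply: (@cvgM R); last exact: cvg_cst.
apply: (@cvgD _ R^o); last exact: cvg_cst.
apply: (@cvgB _ R^o); apply: (@cvg_norm _ R^o); first exact: cvg_id.
by apply: (@cvgB _ R^o); [exact: cvg_id|exact: cvg_cst].
Qed.

Lemma clamp_in_square p : (clamp p.1, clamp p.2) \in unit_square R.
Proof. by rewrite inE; split; rewrite /= in_itv /= clamp_itv. Qed.

Definition square_point p : unit_square R :=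
  exist _ (clamp p.1, clamp p.2) (clamp_in_square p).

Definition in_square p := (0 <= p.1 <= 1) && (0 <= p.2 <= 1).

Lemma in_squareP (u : unit_square R) : in_square (set_val u).
Proof. by have [/= + +] := set_valP u; rewrite !in_itv /= /in_square => -> ->. Qed.

Lemma square_pointK (u : unit_square R) : square_point (set_val u) = u.
Proof.
apply/val_inj; have /andP[h1 h2] := in_squareP u.
by rewrite /= (clamp_id h1) (clamp_id h2) -surjective_pairing.
Qed.

Lemma val_square_point p : in_square p -> set_val (square_point p) = p.
Proof.
move=> /andP[p1 p2]; rewrite [LHS](_ : _ = (clamp p.1, clamp p.2))//.
by rewrite (clamp_id p1) (clamp_id p2) -surjective_pairing.
Qed.

Lemma square_point_continuous : continuous (square_point : R * R -> unit_square R).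
Proof.
apply: continuous_comp_initial.
apply: (@continuous_pair (R * R)%type R R).
- by apply: (@continuous_comp_fun (R * R)%type R R fst clamp); [exact: continuous_fst|exact: clamp_continuous].
- by apply: (@continuous_comp_fun (R * R)%type R R snd clamp); [exact: continuous_snd|exact: clamp_continuous].
Qed.

(* The chart, extended to the plane by clamping the coordinates. *)
Definition psi i p : surf := chart i (square_point p).

Lemma psi_continuous i : continuous (psi i).
Proof.
move=> p; apply: (@continuous_comp _ _ _ (square_point : R * R -> unit_square R) (chart i)).
  exact: square_point_continuous.
exact: chart_continuous.
Qed.

Lemma psi_clamp i x y : psi i (clamp x, clamp y) = psi i (x, y).
Proof.
rewrite /psi; congr chart; apply/val_inj => /=.
by rewrite (clamp_id (clamp_itv x)) (clamp_id (clamp_itv y)).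
Qed.

Lemma chartE i (u : unit_square R) : chart i u = psi i (set_val u).
Proof. by rewrite /psi square_pointK. Qed.

Lemma surface_psi (x : surf) : exists i p, in_square p /\ x = psi i p.
Proof.
rewrite -[x](@generic_quotient.reprK _ surf); case: (generic_quotient.repr x) => i u; exists i, (set_val u).
by rewrite -chartE; split => //; exact: in_squareP.
Qed.

Lemma pi_glue (u v : squares R O) : Defs.glue u v -> (\pi_surf u)%qT = (\pi_surf v)%qT.
Proof. by move=> uv; apply/eqquotP/asboolP; exact: rst_step. Qed.

Lemma psi_glue_h i y : psi i (0, y) = psi (sigma i) (1, y).
Proof.
apply: pi_glue; left; split => //=.
- by rewrite /Defs.coord /= clamp_id// lexx ler01.
- by rewrite /Defs.coord /= clamp_id// lexx ler01.
Qed.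

Lemma psi_glue_v i x : psi i (x, 1) = psi (tau i) (x, 0).
Proof.
apply: pi_glue; right; split => //=.
- by rewrite /Defs.coord /= clamp_id// lexx ler01.
- by rewrite /Defs.coord /= clamp_id// lexx ler01.
Qed.

(* [sigma^-1] since the square to the right of [P_i] is the one glued along its right
   side, namely [P_(sigma^-1 i)]. *)
Definition sigma_pow k : {perm 'I_m} :=
  match k with Posz n => (sigma^-1 ^+ n)%g | Negz n => (sigma ^+ n.+1)%g end.

Lemma sigma_pow0 : sigma_pow 0 = 1%g. Proof. by []. Qed.

Lemma sigma_pow_succ k : sigma_pow (k + 1) = (sigma_pow k * sigma^-1)%g.
Proof.
case: k => [n|[|n]].
- by rewrite -PoszD addn1 /= expgSr.
- by rewrite /= expg1 mulgV.
- rewrite (_ : Negz n.+1 + 1 = Negz n); last by rewrite !NegzE; lia.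
  by rewrite /= [X in (X * _)%g]expgSr mulgK.
Qed.

Lemma sigma_pow_pred k : sigma_pow (k - 1) = (sigma_pow k * sigma)%g.
Proof. by rewrite -{2}[k](subrK 1) sigma_pow_succ mulgKV. Qed.

Lemma sigma_pow_addn k (n : nat) : sigma_pow (k + n%:Z) = (sigma_pow k * sigma_pow n)%g.
Proof.
elim: n => [|n IH]; first by rewrite addr0 mulg1.
by rewrite -addn1 PoszD addrA sigma_pow_succ IH -mulgA sigma_pow_succ.
Qed.

Lemma sigma_pow_subn k (n : nat) : sigma_pow (k - n%:Z) = (sigma_pow k * sigma_pow (- n%:Z))%g.
Proof.
elim: n => [|n IH]; first by rewrite subr0 mulg1.
by rewrite -addn1 PoszD opprD addrA sigma_pow_pred IH -mulgA sigma_pow_pred.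
Qed.

Lemma sigma_pow_add k l : sigma_pow (k + l) = (sigma_pow k * sigma_pow l)%g.
Proof. by case: l => n; [exact: sigma_pow_addn|rewrite NegzE sigma_pow_subn]. Qed.

(* Continues the chart of [P_i] along the horizontal cylinder that contains it. *)
Definition develop i p : surf :=
  psi (sigma_pow (Num.floor p.1) i) (p.1 - (Num.floor p.1)%:~R, p.2).

(** The closed strip is allowed: on its right edge the floor is already [k + 1], and the gluing of
    the two squares makes the values agree. *)
Lemma develop_strip i p k : k%:~R <= p.1 <= k%:~R + 1 ->
  develop i p = psi (sigma_pow k i) (p.1 - k%:~R, p.2).
Proof.
move=> /andP[kp pk]; have [pk1|pk1] := ltP p.1 (k%:~R + 1).
  have /floor_def fk : k%:~R <= p.1 < (k + 1)%:~R by rewrite kp intrD.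
  by rewrite /develop fk.
have p1E : p.1 = (k + 1)%:~R by apply/eqP; rewrite eq_le intrD pk pk1.
rewrite /develop p1E intrKfloor subrr sigma_pow_succ permM psi_glue_h permKV.
by rewrite intrD addrAC subrr add0r.
Qed.

Lemma develop_psi i p : 0 <= p.1 <= 1 -> develop i p = psi i p.
Proof.
move=> p01; rewrite (@develop_strip _ _ 0) ?add0r// subr0 sigma_pow0 perm1.
by case: p p01.
Qed.

Lemma develop_shift i x y k : develop i (x + k%:~R, y) = develop (sigma_pow k i) (x, y).
Proof.
rewrite /develop /= floorDrz ?intr_int// intrKfloor addrC sigma_pow_add permM.
by congr (psi _ (_, _)); rewrite intrD; ring.
Qed.

(** Away from the vertical lines over the integers a single chart is used. On the line [p.1 = k] the
    charts of the squares [k - 1] and [k] serve the two sides and agree on the common edge. *)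
Lemma develop_continuous i : continuous (develop i).
Proof.
move=> p; pose k := Num.floor p.1.
have /andP[kp pk] : k%:~R <= p.1 < k%:~R + 1 by have := floor_itv p.1; rewrite intrD.
pose f (l : int) (q : R * R) := psi (sigma_pow l i) (q.1 - l%:~R, q.2).
have fc l : continuous (f l).
  move=> q; apply: (@continuous_comp _ _ _ (fun q : R * R => (q.1 - l%:~R, q.2)) (psi (sigma_pow l i))).
    apply: (@continuous_pair (R * R)%type R R (fun q => q.1 - l%:~R) snd); last exact: continuous_snd.
    by move=> t; apply: (@cvgB _ R^o); [exact: continuous_fst|exact: cvg_cst].
  exact: psi_continuous.
move=> U nU; suff : \forall q \near p, U (develop i q) by [].
have fk : nbhs p (f k @^-1` U).
  by apply: fc; rewrite /f -develop_strip// kp ltW.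
have p1c (V : set R) : nbhs p.1 V -> \forall q \near p, V q.1 by move=> nV; exact: (@continuous_fst R R p V nV).
have lt1 : \forall q \near p, q.1 < k%:~R + 1.
  by apply: (p1c (fun x => x < k%:~R + 1)); exact: lt_nbhsl.
have [kp'|pk'] := ltP k%:~R p.1.
  have gt0 : \forall q \near p, k%:~R < q.1.
    by apply: (p1c (fun x => k%:~R < x)); exact: lt_nbhsr.
  near=> q; rewrite (@develop_strip _ _ k); first by near: q.
  by apply/andP; split; apply: ltW; near: q.
have pkE : p.1 = k%:~R by apply/eqP; rewrite eq_le pk' kp.
have gt0 : \forall q \near p, (k - 1)%:~R < q.1.
  by apply: (p1c (fun x => (k - 1)%:~R < x)); apply: lt_nbhsr; rewrite pkE ltr_int; lia.
have fk1 : nbhs p (f (k - 1) @^-1` U).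
  by apply: fc; rewrite /f -develop_strip// pkE intrB subrK lexx gerBl ler01.
near=> q; have [kq|qk] := leP k%:~R q.1.
  rewrite (@develop_strip _ _ k); first by near: q.
  by rewrite kq ltW//; near: q.
rewrite (@develop_strip _ _ (k - 1)); first by near: q.
by rewrite intrB subrK (ltW qk) andbT -intrB ltW//; near: q.
Unshelve. all: by end_near. Qed.

Lemma sigma_pow_order k : (sigma ^+ `|k|)%g = 1%g -> sigma_pow k = 1%g.
Proof.
case: k => n /=; last by [].
by rewrite /= expgVn => ->; rewrite invg1.
Qed.

Variable N : nat.
Hypothesis sigmaN : (sigma ^+ N)%g = 1%g.

Lemma sigma_powN k : sigma_pow (k * N%:Z) = 1%g.
Proof. by apply: sigma_pow_order; rewrite abszM absz_nat mulnC expgM sigmaN expg1n. Qed.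

(* The shear is compatible with the vertical gluings because [sigma ^+ N = 1]. *)
Definition twist_square (c : int) (u : squares R O) : surf :=
  develop (projT1 u) (shear (c * N%:Z)%:~R (Defs.coord u)).

Lemma twist_glue c (u v : squares R O) : Defs.glue u v -> twist_square c u = twist_square c v.
Proof.
case: u v => [i u] [j v]; rewrite /Defs.glue /twist_square /Defs.coord /shear /=.
case=> [[-> u1 v1 uv]|[-> u1 v1 uv]].
  rewrite u1 v1 uv [in RHS]addrC (develop_shift _ _ _ 1) add0r (sigma_pow_succ 0).
  by rewrite sigma_pow0 mul1g permK.
have /andP[x01 _] := in_squareP u.
rewrite u1 v1 uv mulr1 mulr0 addr0 develop_shift sigma_powN perm1.
by rewrite !develop_psi// psi_glue_v.
Qed.

Lemma twist_glue_equiv c (u v : squares R O) : glue_equiv u v ->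
  twist_square c u = twist_square c v.
Proof.
move=> /asboolP; elim=> {u v} [u v|u|u v _ ->|u v w _ -> _ ->]//.
exact: twist_glue.
Qed.

(** The integer [c] is an exponent, so that the inverse of a multitwist has the same form. *)
Definition twist (c : int) (x : surf) : surf := twist_square c (generic_quotient.repr x).

Lemma twist_pi c (u : squares R O) : twist c (\pi_surf u)%qT = twist_square c u.
Proof.
apply: twist_glue_equiv; have /eqquotP := @generic_quotient.reprK _ surf (\pi_surf u)%qT.
by [].
Qed.

Lemma twist_psi c i p : in_square p ->
  twist c (psi i p) = develop i (shear (c * N%:Z)%:~R p).
Proof.
by move=> pQ; rewrite /psi /chart twist_pi /twist_square /Defs.coord [projT1 _]/= val_square_point.
Qed.

Lemma frac_itv (x : R) : 0 <= x - (Num.floor x)%:~R <= 1.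
Proof.
by have /andP[h1 h2] := floor_itv x; rewrite subr_ge0 h1 /= lerBlDl -[1]/(1%:~R) -intrD ltW.
Qed.

(** The shear commutes with horizontal translations, and by such a translation the chart at the
    point differs from [develop i]. *)
Lemma twist_develop c i p : 0 <= p.2 <= 1 ->
  twist c (develop i p) = develop i (shear (c * N%:Z)%:~R p).
Proof.
move=> p2; rewrite {1}/develop twist_psi; last by rewrite /in_square p2 frac_itv.
by rewrite /shear /= addrAC -[X in develop _ (X, _)]/(_ - _) -intrN develop_shift -permM -sigma_pow_add subrr perm1.
Qed.

Lemma twistD c d x : twist c (twist d x) = twist (c + d) x.
Proof.
have [i [p [pQ ->]]] := surface_psi x; have /andP[p1 p2] := pQ.
rewrite (twist_psi d)// twist_develop// (twist_psi (c + d))//.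
by rewrite /shear /= mulrDl intrD mulrDl addrAC -addrA.
Qed.

Lemma twist0 x : twist 0 x = x.
Proof.
have [i [p [pQ ->]]] := surface_psi x; have /andP[p1 p2] := pQ.
rewrite twist_psi// /shear (_ : (0 * N%:Z)%:~R = 0 :> R); last by rewrite mul0r.
rewrite mul0r addr0 -surjective_pairing.
exact: develop_psi.
Qed.

Lemma twistK c : cancel (twist c) (twist (- c)).
Proof. by move=> x; rewrite twistD addNr twist0. Qed.

Lemma shear_continuous (t : R) : continuous (shear t : R * R -> R * R).
Proof.
apply: (@continuous_pair (R * R)%type R R (fun q => q.1 + t * q.2) snd); last exact: continuous_snd.
move=> q; apply: (@cvgD _ R^o); first exact: continuous_fst.
by apply: (@cvgM R); [exact: cvg_cst|exact: continuous_snd].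
Qed.

Lemma surface_continuous (Z : topologicalType) (f : surf -> Z) :
  (forall i, continuous (fun u : unit_square R => f (chart i u))) -> continuous f.
Proof.
move=> fc; apply/(@quotient_continuous (squares R O) {eq_quot glue_equivRel R O}%qT).
apply/continuousP => A oA; apply/sigT_openP => i.
by have /continuousP/(_ _ oA) := fc i.
Qed.

Lemma set_val_continuous : continuous (set_val : unit_square R -> R * R).
Proof. exact: initial_continuous. Qed.

Lemma twist_continuous c : continuous (twist c).
Proof.
apply: surface_continuous => i.
have -> : (fun u : unit_square R => twist c (chart i u)) =
    (fun u => develop i (shear (c * N%:Z)%:~R (set_val u))).
  by apply/funext => u; rewrite chartE twist_psi//; exact: in_squareP.
apply: (@continuous_comp_fun _ (R * R)%type _ (fun u : unit_square R => shear (c * N%:Z)%:~R (set_val u)) (develop i)).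
  apply: (@continuous_comp_fun _ (R * R)%type (R * R)%type); first exact: set_val_continuous.
  exact: shear_continuous.
exact: develop_continuous.
Qed.

End Developing.

(** * Lipschitz constants of multitwists *)

Section Length.
Variables (R : realType) (O : origami_datum).
Local Notation m := (nsquares O).
Local Notation surf := (surface R O).
Local Notation path_len := (@path_of_length R O).
Implicit Types (i : 'I_m) (p q v : R * R).

Definition line p v (t : R) : R * R := (p.1 + t * v.1, p.2 + t * v.2).
Definition vnorm v : R := Num.sqrt (v.1 ^+ 2 + v.2 ^+ 2).

Lemma vnorm_ge0 v : 0 <= vnorm v. Proof. exact: sqrtr_ge0. Qed.

Lemma euclidean_distE p q : euclidean_dist p q = vnorm (q.1 - p.1, q.2 - p.2).
Proof. by rewrite /euclidean_dist /vnorm /=; congr Num.sqrt; ring. Qed.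

Lemma euclidean_dist_line p v s t : euclidean_dist (line p v s) (line p v t) = `|t - s| * vnorm v.
Proof.
rewrite euclidean_distE /vnorm /= -(sqrtr_sqr (t - s)) -sqrtrM ?sqr_ge0//.
by congr Num.sqrt; ring.
Qed.

Lemma line0 p v : line p v 0 = p.
Proof. by rewrite /line !mul0r !addr0 -surjective_pairing. Qed.

Lemma line1 p q : line p (q.1 - p.1, q.2 - p.2) 1 = q.
Proof. by rewrite /line /= !mul1r !(addrC p.1) !(addrC p.2) !subrK -surjective_pairing. Qed.

Lemma convex_itv (a b t : R) : 0 <= a <= 1 -> 0 <= b <= 1 -> 0 <= t <= 1 ->
  0 <= a + t * (b - a) <= 1.
Proof. by move=> /andP[? ?] /andP[? ?] /andP[? ?]; apply/andP; split; nra. Qed.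

Lemma in_square_line p q t : in_square p -> in_square q -> 0 <= t <= 1 ->
  in_square (line p (q.1 - p.1, q.2 - p.2) t).
Proof.
by move=> /andP[p1 p2] /andP[q1 q2] t01; rewrite /in_square /= !convex_itv.
Qed.

Lemma path_le_last (a : R) s : path <%R a s -> a <= last a s.
Proof. by elim: s a => //= b s IH a /andP[ab /IH]; exact/le_trans/ltW. Qed.

Lemma zip_sum_line p v (g : R -> R * R) (a : R) s : path <%R a s ->
  (forall t, a <= t <= last a s -> g t = line p v t) ->
  \sum_(t <- zip (a :: s) s) euclidean_dist (g t.1) (g t.2) =
  (last a s - a) * vnorm v.
Proof.
elim: s a => [|b s IH] a /=; first by rewrite big_nil subrr mul0r.
move=> /andP[ab bs] gE; have bl := path_le_last bs.
rewrite big_cons /= (IH b bs); last first.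
  by move=> t /andP[bt tl]; apply: gE; rewrite tl (le_trans (ltW ab)).
rewrite !gE ?lexx ?(ltW ab) ?(le_trans (ltW ab))// euclidean_dist_line.
by rewrite gtr0_norm ?subr_gt0// -mulrDl [b - a + _]addrC addrA subrK.
Qed.

Lemma curve_length_line p q (g : R -> R * R) :
  (forall t, 0 <= t <= 1 -> g t = line p (q.1 - p.1, q.2 - p.2) t) ->
  curve_length g = (euclidean_dist p q)%:E.
Proof.
move=> gE; have sumE s : itv_partition 0 1 s ->
    \sum_(t <- zip (0 :: s) s) euclidean_dist (g t.1) (g t.2) = euclidean_dist p q.
  move=> [s1 /eqP s2]; rewrite (@zip_sum_line p (q.1 - p.1, q.2 - p.2))//.
    by rewrite s2 subr0 mul1r euclidean_distE.
  by rewrite s2.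
rewrite /curve_length (_ : [set _ | s in _] = [set (euclidean_dist p q)%:E]) ?ereal_sup1//.
apply/seteqP; split => [_ [s sp <-]|_ ->] /=; first by rewrite sumE.
exists [:: 1]; first by split => //=; rewrite ltr01.
by rewrite sumE//; split => //=; rewrite ltr01.
Qed.

Lemma curve_length_ge (g : R -> R * R) : ((euclidean_dist (g 0) (g 1))%:E <= curve_length g)%E.
Proof.
apply: ereal_sup_ubound; exists [:: 1]; first by split => //=; rewrite ltr01.
by rewrite /= big_cons big_nil addr0.
Qed.

Lemma euclidean_dist_ge0 p q : 0 <= euclidean_dist p q.
Proof. by rewrite euclidean_distE vnorm_ge0. Qed.

Lemma path_len_ge0 x y l : path_len x y l -> (0 <= l)%E.
Proof.
elim=> {x y l} [x|i g y l _ _ l0]; first by [].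
by rewrite adde_ge0// (le_trans _ (curve_length_ge _))// lee_fin euclidean_dist_ge0.
Qed.

Lemma path_len_cat x y z l l' : path_len x y l -> path_len y z l' -> path_len x z (l + l')%E.
Proof.
elim=> {x y l} [x|i g y l gc _ IH] yz; first by rewrite add0e.
by rewrite -addeA; apply: path_cons => //; exact: IH.
Qed.

(** An actual path of bounded length rather than a bound on the infimum [length_dist], so that
    estimates are concatenated without approximations. *)
Definition joined (x y : surf) (r : R) := exists2 l, path_len x y l & (l <= r%:E)%E.

Lemma joined_trans x y z r r' : joined x y r -> joined y z r' -> joined x z (r + r').
Proof.
move=> [l xy lr] [l' yz lr']; exists (l + l')%E; first exact: path_len_cat xy yz.
by rewrite EFinD leeD.
Qed.

Lemma joined_le x y r r' : r <= r' -> joined x y r -> joined x y r'.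
Proof. by move=> rr' [l xy lr]; exists l => //; rewrite (le_trans lr)// lee_fin. Qed.

Lemma joined_psi i p q : in_square p -> in_square q ->
  joined (psi i p) (psi i q) (euclidean_dist p q).
Proof.
move=> pQ qQ; pose v := (q.1 - p.1, q.2 - p.2).
pose g (t : R) := square_point (line p v t).
have H := @path_cons R O i g (psi i q) 0%E.
exists (euclidean_dist p q)%:E => //.
have gE t : 0 <= t <= 1 -> (set_val \o g) t = line p v t.
  by move=> t01; rewrite /= val_square_point// in_square_line.
have -> : psi i p = chart i (g 0) by rewrite /psi /g line0.
rewrite -[X in path_len _ _ X]adde0 -(curve_length_line gE); apply: H.
  apply: continuous_subspaceT.
  apply: (@continuous_comp_fun R (R * R)%type _ (line p v)); last exact: square_point_continuous.
  by apply: (@continuous_pair R R R) => t; apply: (@cvgD _ R^o); [exact: cvg_cst| |exact: cvg_cst|];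
    apply: (@cvgM R); [exact: cvg_id|exact: cvg_cst|exact: cvg_id|exact: cvg_cst].
by rewrite /g line1; exact: path_nil.
Qed.

Lemma joined_strip i p q k : k%:~R <= p.1 <= k%:~R + 1 -> k%:~R <= q.1 <= k%:~R + 1 ->
  0 <= p.2 <= 1 -> 0 <= q.2 <= 1 ->
  joined (develop i p) (develop i q) (euclidean_dist p q).
Proof.
move=> pk qk p2 q2; rewrite !(develop_strip _ _ (k := k))//.
have -> : euclidean_dist p q = euclidean_dist (p.1 - k%:~R, p.2) (q.1 - k%:~R, q.2).
  by rewrite !euclidean_distE /=; congr vnorm; congr (_, _); ring.
by apply: joined_psi; rewrite /in_square /= ?p2 ?q2 ?andbT; apply/andP; split; lra.
Qed.

(** Induction on a bound for the number of squares crossed: the segment is cut at the first vertical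
    edge to the right of [p]. Both directions are carried along, as [path_of_length] builds its
    paths from the starting point only. *)
Lemma joined_develop_le i (n : nat) p q : p.1 <= q.1 -> Num.floor q.1 <= Num.floor p.1 + n%:Z ->
  0 <= p.2 <= 1 -> 0 <= q.2 <= 1 ->
  joined (develop i p) (develop i q) (euclidean_dist p q) /\
  joined (develop i q) (develop i p) (euclidean_dist p q).
Proof.
elim: n p => [|n IH] p pq; set k := Num.floor p.1 => fq p2 q2.
all: have /andP[kp pk] : k%:~R <= p.1 < k%:~R + 1 by have := floor_itv p.1; rewrite intrD.
all: have [qk|kq] := leP q.1 (k%:~R + 1).
1,3: have dC : euclidean_dist p q = euclidean_dist q p by
       rewrite !euclidean_distE /vnorm /=; congr Num.sqrt; ring.
1,2: by split; [|rewrite dC]; apply: (@joined_strip _ _ _ k) => //; apply/andP; split; lra.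
  have /andP[_ qf] := floor_itv q.1.
  have : (Num.floor q.1 + 1)%:~R <= (k + 1)%:~R :> R by rewrite ler_int lerD2r -[k]addr0.
  by rewrite [X in _ <= X]intrD => fk; exfalso; lra.
have pq' : p.1 < q.1 by exact: le_lt_trans (ltW pk) kq.
(* The parameter at which the segment meets the edge [x = k + 1]. *)
pose t := (k%:~R + 1 - p.1) / (q.1 - p.1).
have t0 : 0 <= t by rewrite divr_ge0; lra.
have t1 : t <= 1 by rewrite ler_pdivrMr; lra.
pose v := (q.1 - p.1, q.2 - p.2).
pose w := line p v t.
have w1 : w.1 = (k + 1)%:~R.
  by rewrite intrD /w /line /= /t mulfVK; [lra|apply: lt0r_neq0; lra].
have w2 : 0 <= w.2 <= 1 by apply: convex_itv => //; rewrite t0.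
have pw : euclidean_dist p w = t * vnorm v.
  by rewrite -{1}(line0 p v) euclidean_dist_line subr0 ger0_norm.
have wq : euclidean_dist w q = (1 - t) * vnorm v.
  by rewrite -{1}(line1 p q) euclidean_dist_line ger0_norm// subr_ge0.
have pqE : euclidean_dist p q = euclidean_dist p w + euclidean_dist w q.
  by rewrite pw wq -mulrDl addrC subrK mul1r euclidean_distE.
have [wq1 wq2] : joined (develop i w) (develop i q) (euclidean_dist w q) /\
    joined (develop i q) (develop i w) (euclidean_dist w q).
  apply: IH => //; first by rewrite w1 intrD ltW.
  by rewrite w1 intrKfloor (le_trans fq)// -addrA -PoszD add1n.
have dC : euclidean_dist p w = euclidean_dist w p.
  by rewrite !euclidean_distE /vnorm /=; congr Num.sqrt; ring.
have pkk : k%:~R <= p.1 <= k%:~R + 1 by rewrite kp ltW.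
have wkk : k%:~R <= w.1 <= k%:~R + 1 by rewrite w1 intrD lexx lerDl ler01.
have pw1 := joined_strip i pkk wkk p2 w2.
have pw2 := joined_strip i wkk pkk w2 p2.
rewrite pqE; split; first exact: joined_trans pw1 wq1.
by rewrite addrC dC; exact: joined_trans wq2 pw2.
Qed.

Lemma joined_develop i p q : 0 <= p.2 <= 1 -> 0 <= q.2 <= 1 ->
  joined (develop i p) (develop i q) (euclidean_dist p q).
Proof.
move=> p2 q2; have [pq|/ltW qp] := leP p.1 q.1.
  by have [] := @joined_develop_le i `|Num.floor q.1 - Num.floor p.1|%N p q pq _ p2 q2; first by lia.
have dC : euclidean_dist p q = euclidean_dist q p.
  by rewrite !euclidean_distE /vnorm /=; congr Num.sqrt; ring.
rewrite dC.
by have [] := @joined_develop_le i `|Num.floor p.1 - Num.floor q.1|%N q p qp _ q2 p2; first by lia.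
Qed.

(** By [(a + t b)^2 <= 2 a^2 + 2 t^2 b^2] the squared distance grows at most by the factor [L]. As
    [1 <= L], the same constant serves for the distance itself, without a root. *)
Lemma euclidean_dist_shear (t : R) p q :
  euclidean_dist (shear t p) (shear t q) <= (2 + 2 * t ^+ 2) * euclidean_dist p q.
Proof.
set L := 2 + _; have L1 : 1 <= L by rewrite /L; have := sqr_ge0 t; lra.
rewrite -(ger0_norm (le_trans ler01 L1)) -sqrtr_sqr /euclidean_dist -sqrtrM ?sqr_ge0//.
rewrite ler_wsqrtr//=; set a := p.1 - q.1; set b := p.2 - q.2.
have -> : p.1 + t * p.2 - (q.1 + t * q.2) = a + t * b by rewrite /a /b; ring.
have a0 := sqr_ge0 a; have b0 := sqr_ge0 b.
apply: (@le_trans _ _ (L * (a ^+ 2 + b ^+ 2))).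
  have : 0 <= (a - t * b) ^+ 2 by exact: sqr_ge0.
  have tb0 : 0 <= t ^+ 2 * a ^+ 2 by rewrite mulr_ge0 ?sqr_ge0.
  by rewrite /L; clearbody a b; rewrite sqrrB sqrrD exprMn; lra.
by rewrite ler_wpM2r ?addr_ge0// expr2 ler_peMl// (le_trans ler01).
Qed.

Variable N : nat.
Hypothesis sigmaN : (origami_sigma O ^+ N)%g = 1%g.

Lemma joined_twist c i p q : in_square p -> in_square q ->
  joined (twist N c (psi i p)) (twist N c (psi i q))
    ((2 + 2 * (c * N%:Z)%:~R ^+ 2) * euclidean_dist p q).
Proof.
move=> pQ qQ; rewrite !twist_psi//; apply: joined_le (euclidean_dist_shear _ _ _) _.
by apply: joined_develop; [have /andP[] := pQ|have /andP[] := qQ].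
Qed.

(** A piece of the path is not mapped but replaced: the images of its end points are joined by a
    developed segment, which is no longer than [L] times the distance of the end points, hence [L]
    times the length of the piece. *)
Lemma path_len_twist c x y l : path_len x y l ->
  exists2 l', path_len (twist N c x) (twist N c y) l' &
    (l' <= (2 + 2 * (c * N%:Z)%:~R ^+ 2)%:E * l)%E.
Proof.
set L := 2 + _; have L0 : 0 <= L by rewrite addr_ge0// mulr_ge0// sqr_ge0.
elim=> {x y l} [x|i g y l gc yl [l' yl' l'L]].
  by exists 0%E; [exact: path_nil|rewrite mule0].
have [l1 gl1 l1L] := joined_twist c i (in_squareP (g 0)) (in_squareP (g 1)).
rewrite -!chartE in gl1; exists (l1 + l')%E; first exact: path_len_cat gl1 yl'.
rewrite ge0_muleDr ?(path_len_ge0 yl)//; last first.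
  by rewrite (le_trans _ (curve_length_ge _))// lee_fin euclidean_dist_ge0.
rewrite leeD// (le_trans l1L)// EFinM lee_wpmul2l ?lee_fin//.
exact: (curve_length_ge (set_val \o g)).
Qed.

Lemma twist_lipschitz c : exists2 L : R, 0 < L &
  forall x y : surf, (length_dist (twist N c x) (twist N c y) <= L%:E * length_dist x y)%E.
Proof.
have L0 : 0 < 2 + 2 * (c * N%:Z)%:~R ^+ 2 :> R by rewrite ltr_wpDr// mulr_ge0// sqr_ge0.
exists (2 + 2 * (c * N%:Z)%:~R ^+ 2) => // x y.
rewrite -lee_pdivrMl//; apply: le_ereal_inf_tmp => l /= xyl.
rewrite lee_pdivrMl//; have [l' xyl' l'L] := path_len_twist c xyl.
by apply: le_trans l'L; exact: ereal_inf_lbound.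
Qed.

End Length.

(** * Integration over the surface *)

Lemma ge0_integral_comp d1 d2 (X : measurableType d1) (Y : measurableType d2) (R : realType)
    (mu : {measure set X -> \bar R}) (nu : {measure set Y -> \bar R}) (phi : X -> Y)
    (F : Y -> \bar R) :
  measurable_fun setT phi -> (forall A, measurable A -> nu A = mu (phi @^-1` A)) ->
  measurable_fun setT F -> (forall y, 0 <= F y)%E ->
  (\int[nu]_y F y = \int[mu]_x F (phi x))%E.
Proof.
move=> mphi nuE mF F0.
rewrite -[RHS](@ge0_integral_pushforward _ _ _ _ R _ mphi mu setT F)//.
by apply: eq_measure_integral => A mA _; exact: nuE.
Qed.

Lemma measure_preserving_integral d (X : measurableType d) (R : realType)
    (mu : {measure set X -> \bar R}) (phi : X -> X) : measurable_fun setT phi ->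
  (forall F, measurable_fun setT F -> (forall x, 0 <= F x)%E ->
    (\int[mu]_x F (phi x) = \int[mu]_x F x)%E) -> measure_preserving mu phi.
Proof.
move=> mphi H; split => // A mA.
have mpA : measurable (phi @^-1` A) by rewrite -[X in measurable X]setTI; exact: mphi.
rewrite -[A in RHS]setIT -[X in mu X]setIT -!integral_indic//.
apply: (H (EFin \o \1_A)) => [|x]; first exact/measurable_EFinP.
by rewrite lee_fin.
Qed.

Section SurfaceIntegral.
Variables (R : realType) (O : origami_datum).
Local Notation m := (nsquares O).
Local Notation surf := (surface R O).
Local Notation plane := (measurableTypeR R * measurableTypeR R)%type.
Local Notation mu := (@square_measure R).
Local Notation nu := (surface_measure R O).
Implicit Types (i : 'I_m).

Lemma measurable_to_surface d (X : measurableType d) (f : X -> surf) :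
  (forall V, open V -> measurable (f @^-1` V)) -> measurable_fun setT f.
Proof.
move=> fV _ Y mY; rewrite setTI; move: Y mY.
suff H : <<s @open surf >> `<=` [set A | measurable (f @^-1` A)] by exact: H.
apply: smallest_sub => [|A oA]; [split|exact: fV].
- by rewrite /= preimage_set0.
- by move=> A /= mA; rewrite setTD preimage_setC; exact: measurableC.
- by move=> F /= mF; rewrite preimage_bigcup; exact: bigcup_measurable.
Qed.

Lemma continuous_surface_measurable (f : R * R -> surf) :
  continuous f -> measurable_fun setT (f : plane -> surf).
Proof.
move=> fc; apply: measurable_to_surface => V oV; apply: open_plane_measurable.
by move/continuousP: fc; exact.
Qed.

Lemma measurable_psi i : measurable_fun setT (psi i : plane -> surf).
Proof. by apply: continuous_surface_measurable; exact: psi_continuous. Qed.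

Lemma measurable_develop i : measurable_fun setT (develop i : plane -> surf).
Proof. by apply: continuous_surface_measurable; exact: develop_continuous. Qed.

Lemma continuous_surfaces_measurable (O' : origami_datum) (f : surface R O' -> surf) :
  continuous f -> measurable_fun setT f.
Proof.
move=> fc; apply: measurable_to_surface => V oV; apply: sub_sigma_algebra.
by move/continuousP: fc; exact.
Qed.

Lemma square_areaE i (A : set surf) : square_area i A = mu (psi i @^-1` A).
Proof.
rewrite /square_area /square_measure /mrestr; congr (_ _).
apply/seteqP; split => [_ [u Au <-]|p [/= Ap [p1 p2]]].
  by split; [rewrite /= -chartE|exact: set_valP].
have pQ : in_square p by move: p1 p2; rewrite /= !in_itv /in_square /= => -> ->.
by exists (square_point p) => //; exact: val_square_point.
Qed.

Lemma ge0_integral_square_area i (F : surf -> \bar R) :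
  measurable_fun setT F -> (forall x, 0 <= F x)%E ->
  (\int[square_area i]_x F x = \int[mu]_p F (psi i p))%E.
Proof.
move=> mF F0; apply: (ge0_integral_comp (measurable_psi i)) => // A _.
exact: square_areaE.
Qed.

Lemma ge0_integral_surface (F : surf -> \bar R) :
  measurable_fun setT F -> (forall x, 0 <= F x)%E ->
  (\int[nu]_x F x = (m%:R^-1)%:E * \sum_i \int[mu]_p F (psi i p))%E.
Proof.
move=> mF F0; rewrite /surface_measure ge0_integral_mscale//; congr (_ * _)%E.
(* [msum] expects a sequence of measures indexed by all integers; the default [i0] only fills the
   indices from [m] on, which do not enter the sum. *)
pose i0 : 'I_m := Ordinal (nsquares_gt0 O).
pose nu_ k : {measure set surf -> \bar R} := @square_area R O (insubd i0 k).
rewrite (eq_measure_integral (msum nu_ m)) => [|A mA _]; last first.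
  by rewrite /= /msum /area; apply: eq_bigr => i _; rewrite /nu_ valKd.
rewrite ge0_integral_measure_sum//; apply: eq_bigr => i _.
by rewrite /nu_ valKd ge0_integral_square_area.
Qed.

Lemma eq_integral_square (f g : plane -> \bar R) :
  measurable_fun setT f -> measurable_fun setT g -> (forall p, 0 <= f p)%E ->
  (forall p, 0 <= g p)%E -> (forall p, in_square p -> f p = g p) ->
  (\int[mu]_p f p = \int[mu]_p g p)%E.
Proof.
move=> mf mg f0 g0 fg; rewrite !ge0_integral_mrestr//; apply: eq_integral => p /set_mem [p1 p2].
by apply: fg; move: p1 p2; rewrite /= !in_itv /in_square /= => -> ->.
Qed.

(** A translation by 1 only permutes the squares. *)
Lemma sum_develop_periodic (F : surf -> \bar R) x y :
  (\sum_i F (develop i (x + 1, y)%R) = \sum_i F (develop i (x, y)))%E.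
Proof.
under eq_bigr do rewrite -[1%R]/(1%:~R) develop_shift.
by rewrite [RHS](reindex_inj (@perm_inj _ (sigma_pow O 1))).
Qed.

Variable N : nat.
Hypothesis sigmaN : (origami_sigma O ^+ N)%g = 1%g.

Lemma measurable_twist c : measurable_fun setT (twist N c : surf -> surf).
Proof. by apply: continuous_surfaces_measurable; exact: twist_continuous. Qed.

(** Summing [F] over all squares gives a function [W] on the plane with period 1 in [x], and its
    integral over the square is that of [F] up to the factor [m]. On [W] the multitwist acts as a
    shear. *)
Lemma ge0_integral_twist c (F : surf -> \bar R) :
  measurable_fun setT F -> (forall x, 0 <= F x)%E ->
  (\int[nu]_x F (twist N c x) = \int[nu]_x F x)%E.
Proof.
move=> mF F0; pose t : R := (c * N%:Z)%:~R.
have mFt := measurableT_comp mF (measurable_twist c).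
rewrite [LHS](ge0_integral_surface mFt (fun x => F0 _)) [RHS](ge0_integral_surface mF F0); congr (_ * _)%E.
pose W (p : plane) := (\sum_i F (develop i p))%E.
have mFD i : measurable_fun setT (fun p : plane => F (develop i p)).
  exact: measurableT_comp mF (measurable_develop i).
have mW : measurable_fun setT W by exact: emeasurable_sum.
have W0 p : (0 <= W p)%E by exact: sume_ge0.
have -> : (\sum_i \int[mu]_p F (psi i p) = \int[mu]_p W p)%E.
  rewrite ge0_integral_sum//; apply: eq_bigr => i _; apply: eq_integral_square => //.
    exact: measurableT_comp mF (measurable_psi i).
  by move=> p /andP[p1 _]; rewrite develop_psi.
have mt : measurable_fun setT (fun y : R => t * y) by exact: measurable_funM.
rewrite -(@ge0_integral_shear R (fun y => t * y) W)//; last first.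
  by move=> x y _; exact: sum_develop_periodic.
rewrite ge0_integral_sum//; last first.
  move=> i; exact: (measurableT_comp (mFD i) (measurable_shear_lin t)).
apply: eq_bigr => i _; apply: eq_integral_square => //.
- exact: measurableT_comp mFt (measurable_psi i).
- exact: (measurableT_comp (mFD i) (measurable_shear_lin t)).
- by move=> p; exact: F0.
- by move=> p pQ; rewrite /= twist_psi.
Qed.

End SurfaceIntegral.

(** * Exchange of the coordinates *)

Section SwapDatum.
Variable O : origami_datum.
Local Notation m := (nsquares O).
Local Notation sigma := (origami_sigma O).
Local Notation tau := (origami_tau O).

Lemma swap_transitive :
  [transitive <<[set tau^-1; sigma^-1]%SET>>%g, on [set: 'I_m]%SET | 'P].
Proof.
suff -> : <<[set tau^-1; sigma^-1]%SET>>%g = <<[set sigma; tau]%SET>>%g.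
  exact: origami_transitive.
apply/eqP; rewrite finset.eqEsubset !gen_subG; apply/andP; split; apply/fintype.subsetP => x;
  rewrite !inE => /orP[] /eqP ->.
- by rewrite groupV mem_gen// !inE eqxx orbT.
- by rewrite groupV mem_gen// !inE eqxx.
- by rewrite -groupV mem_gen// !inE eqxx orbT.
- by rewrite -groupV mem_gen// !inE eqxx.
Qed.

(* The top side of a square is glued as the left side of its mirror image, which
   replaces [tau] by its inverse. *)
Definition swap_datum : origami_datum :=
  @OrigamiDatum m (nsquares_gt0 O) tau^-1 sigma^-1 swap_transitive.

End SwapDatum.

Section Swap.
Variables (R : realType) (O : origami_datum).
Local Notation m := (nsquares O).
Local Notation sigma := (origami_sigma O).
Local Notation tau := (origami_tau O).
Local Notation flip := (@flip R).

Local Notation surf := (surface R O).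
Local Notation surf' := (surface R (swap_datum O)).
Local Notation psi' := (@psi R (swap_datum O)).

Lemma glue_equiv_lift (O1 : origami_datum) (Z : Type) (h : squares R O1 -> Z) :
  (forall u v, Defs.glue u v -> h u = h v) ->
  forall u v, glue_equiv u v -> h u = h v.
Proof.
move=> hglue u v /asboolP; elim=> {u v} [u v|u|u v _ ->|u v w _ -> _ ->]//.
exact: hglue.
Qed.

Lemma glue_lift (O1 : origami_datum) (Z : Type) (h : squares R O1 -> Z) :
  (forall u v, Defs.glue u v -> h u = h v) ->
  forall u, h (generic_quotient.repr (\pi_(surface R O1) u)%qT) = h u.
Proof.
move=> hglue u; apply: (glue_equiv_lift hglue); apply/eqquotP.
exact: generic_quotient.reprK.
Qed.

Definition swap_square (u : squares R (swap_datum O)) : surf := psi (projT1 u : 'I_m) (flip (Defs.coord u)).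
Definition unswap_square (u : squares R O) : surf' := psi' (projT1 u) (flip (Defs.coord u)).

Definition swap (x : surf') : surf := swap_square (generic_quotient.repr x).
Definition unswap (x : surf) : surf' := unswap_square (generic_quotient.repr x).

Lemma psi_flip_square_point (O1 : origami_datum) (i : 'I_(nsquares O1)) p :
  psi i (flip (set_val (square_point p))) = psi i (flip p) :> surface R O1.
Proof. by rewrite /flip /= psi_clamp. Qed.

Lemma swap_psi (i : 'I_m) p : swap (psi' i p) = psi i (flip p).
Proof.
rewrite /swap [X in generic_quotient.repr X]/psi /chart glue_lift.
  exact: psi_flip_square_point.
case=> [j u] [k v]; rewrite /Defs.glue /swap_square /Defs.coord /flip /=.
case=> [[-> u1 v1 uv]|[-> u1 v1 uv]].
  by rewrite u1 v1 uv psi_glue_v permKV.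
by rewrite u1 v1 uv psi_glue_h permKV.
Qed.

Lemma unswap_psi (i : 'I_m) p : unswap (psi i p) = psi' i (flip p).
Proof.
rewrite /unswap [X in generic_quotient.repr X]/psi /chart glue_lift.
  exact: psi_flip_square_point.
case=> [j u] [k v]; rewrite /Defs.glue /unswap_square /Defs.coord /flip /=.
case=> [[-> u1 v1 uv]|[-> u1 v1 uv]].
  by rewrite u1 v1 uv (@psi_glue_v R (swap_datum O)) /= permK.
by rewrite u1 v1 uv (@psi_glue_h R (swap_datum O)) /= permK.
Qed.

Lemma flipK : involutive flip. Proof. by case. Qed.

Lemma swapK : cancel swap unswap.
Proof. by move=> x; have [i [p [_ ->]]] := surface_psi x; rewrite swap_psi unswap_psi flipK. Qed.

Lemma unswapK : cancel unswap swap.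
Proof. by move=> x; have [i [p [_ ->]]] := surface_psi x; rewrite unswap_psi swap_psi flipK. Qed.

Lemma flip_continuous : continuous flip.
Proof. by apply: (@continuous_pair (R * R)%type R R); [exact: continuous_snd|exact: continuous_fst]. Qed.

Lemma psi_flip_continuous (O1 : origami_datum) (i : 'I_(nsquares O1)) :
  continuous (fun u : unit_square R => psi i (flip (set_val u)) : surface R O1).
Proof.
apply: (@continuous_comp_fun _ (R * R)%type _ (fun u : unit_square R => flip (set_val u)) (psi i)).
  by apply: (@continuous_comp_fun _ (R * R)%type (R * R)%type); [exact: set_val_continuous|exact: flip_continuous].
exact: psi_continuous.
Qed.

Lemma swap_continuous : continuous swap.
Proof.
apply: surface_continuous => i.
under eq_fun do rewrite chartE swap_psi.
exact: (@psi_flip_continuous O).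
Qed.

Lemma unswap_continuous : continuous unswap.
Proof.
apply: surface_continuous => i.
under eq_fun do rewrite chartE unswap_psi.
exact: (@psi_flip_continuous (swap_datum O)).
Qed.

Lemma curve_length_flip (g h : R -> R * R) : (forall t, h t = flip (g t)) ->
  curve_length h = curve_length g.
Proof.
move=> hg; rewrite /curve_length; congr (ereal_sup _).
have E s : \sum_(t <- zip (0 :: s) s) euclidean_dist (h t.1) (h t.2) =
    \sum_(t <- zip (0 :: s) s) euclidean_dist (g t.1) (g t.2).
  by apply: eq_bigr => t _; rewrite !hg /euclidean_dist /= addrC.
by apply/seteqP; split => _ [s sp <-]; exists s => //; rewrite E.
Qed.

(** Stated for two data, so that it covers both [swap] and [unswap]. *)
Lemma path_len_flip (O1 O2 : origami_datum) (f : surface R O1 -> surface R O2)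
    (e : 'I_(nsquares O1) -> 'I_(nsquares O2)) :
  (forall i p, f (psi i p) = psi (e i) (flip p)) ->
  forall x y l, @path_of_length R O1 x y l -> @path_of_length R O2 (f x) (f y) l.
Proof.
move=> fE x y l; elim=> {x y l} [x|i g y l gc _ IH]; first exact: path_nil.
pose h (t : R) := square_point (flip (set_val (g t))).
have hE t : set_val (h t) = flip (set_val (g t)).
  by apply: val_square_point; have := in_squareP (g t); rewrite /in_square andbC.
rewrite -(@curve_length_flip (set_val \o g) (set_val \o h))//.
have fh t : f (chart i (g t)) = chart (e i) (h t) by rewrite chartE fE.
rewrite fh; apply: path_cons; last by rewrite -fh.
have hc : continuous (fun u : unit_square R => square_point (flip (set_val u))).
  apply: (@continuous_comp_fun _ (R * R)%type _ (fun u : unit_square R => flip (set_val u))).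
    by apply: (@continuous_comp_fun _ (R * R)%type (R * R)%type); [exact: set_val_continuous|exact: flip_continuous].
  exact: square_point_continuous.
by move=> t; exact: (cvg_comp _ _ (gc t) (hc (g t))).
Qed.

Lemma length_dist_flip (O1 O2 : origami_datum) (f : surface R O1 -> surface R O2)
    (e : 'I_(nsquares O1) -> 'I_(nsquares O2)) :
  (forall i p, f (psi i p) = psi (e i) (flip p)) ->
  forall x y, (length_dist (f x) (f y) <= length_dist x y)%E.
Proof.
move=> fE x y; apply: le_ereal_inf_tmp => l /= xyl; apply: ereal_inf_lbound.
exact: (path_len_flip fE xyl).
Qed.

Lemma measurable_swap_surface : measurable_fun setT swap.
Proof. by apply: continuous_surfaces_measurable; exact: swap_continuous. Qed.

Lemma ge0_integral_swap (F : surf -> \bar R) :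
  measurable_fun setT F -> (forall x, 0 <= F x)%E ->
  (\int[surface_measure R (swap_datum O)]_x F (swap x) = \int[surface_measure R O]_x F x)%E.
Proof.
move=> mF F0; have mFs := measurableT_comp mF measurable_swap_surface.
rewrite [LHS](ge0_integral_surface mFs (fun x => F0 _)) [RHS](ge0_integral_surface mF F0).
congr (_ * _)%E; apply: eq_bigr => i _.
have mFp := measurableT_comp mF (@measurable_psi R O i).
rewrite -[RHS](ge0_integral_flip mFp (fun p => F0 _)).
by apply: eq_integral => p _; rewrite /= swap_psi.
Qed.

End Swap.

Section VerticalTwist.
Variables (R : realType) (O : origami_datum) (N : nat).
Local Notation surf := (surface R O).
Local Notation sigma := (origami_sigma O).
Local Notation tau := (origami_tau O).
Hypothesis tauN : (tau ^+ N)%g = 1%g.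

Definition vtwist (c : int) (x : surf) : surf := swap (twist N c (unswap x)).

Lemma swap_sigmaN : (origami_sigma (swap_datum O) ^+ N)%g = 1%g.
Proof. by rewrite /= expgVn tauN invg1. Qed.

Lemma vtwist_swap c x : vtwist c (swap x) = swap (twist N c x).
Proof. by rewrite /vtwist swapK. Qed.

Lemma vtwistK c : cancel (vtwist c) (vtwist (- c)).
Proof. by move=> x; rewrite /vtwist swapK (twistK swap_sigmaN) unswapK. Qed.

Lemma vtwist_continuous c : continuous (vtwist c).
Proof.
apply: (@continuous_comp_fun _ (surface R (swap_datum O)) _ (fun x => twist N c (unswap x)) (@swap R O)).
  apply: (@continuous_comp_fun _ (surface R (swap_datum O)) _ (@unswap R O)).
    exact: unswap_continuous.
  exact: (twist_continuous swap_sigmaN).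
exact: swap_continuous.
Qed.

Lemma vtwist_lipschitz c : exists2 L : R, 0 < L &
  forall x y : surf, (length_dist (vtwist c x) (vtwist c y) <= L%:E * length_dist x y)%E.
Proof.
have [L L0 HL] := @twist_lipschitz R (swap_datum O) N swap_sigmaN c.
exists L => // x y.
have H1 := @length_dist_flip R (swap_datum O) O (@swap R O) id (@swap_psi R O) (twist N c (unswap x)) (twist N c (unswap y)).
apply: (le_trans H1).
apply: le_trans (HL _ _) _; apply: lee_wpmul2l; first by rewrite lee_fin ltW.
exact: (@length_dist_flip R O (swap_datum O) (@unswap R O) id (@unswap_psi R O)).
Qed.

Lemma measurable_vtwist c : measurable_fun setT (vtwist c).
Proof. by apply: continuous_surfaces_measurable; exact: vtwist_continuous. Qed.

Lemma ge0_integral_vtwist c (F : surf -> \bar R) :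
  measurable_fun setT F -> (forall x, 0 <= F x)%E ->
  (\int[surface_measure R O]_x F (vtwist c x) = \int[surface_measure R O]_x F x)%E.
Proof.
move=> mF F0; have mFv := measurableT_comp mF (measurable_vtwist c).
rewrite -[LHS](ge0_integral_swap mFv (fun x => F0 _)) -[RHS](ge0_integral_swap mF F0).
have mFs := measurableT_comp mF (@measurable_swap_surface R O).
rewrite -[RHS](ge0_integral_twist swap_sigmaN c mFs (fun x => F0 _)).
by apply: eq_integral => x _; rewrite /= vtwist_swap.
Qed.

End VerticalTwist.

(** * Functions that agree on the half-open square *)

Section SquareAgree.
Variable R : realType.
Local Notation plane := (measurableTypeR R * measurableTypeR R)%type.
Local Notation mu := (@square_measure R).
Local Notation L2 := (Lfun mu 2%:E).

Lemma negligible_half_open :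
  mu.-negligible [set p : plane | ~ (0 <= p.1 < 1 /\ 0 <= p.2 < 1)].
Proof.
have H1 : mu.-negligible [set p : plane | p.2 = 1].
  have [A [mA A0 sA]] := @negligible_line R 1.
  exists ((@flip R) @^-1` A); split.
  - by rewrite -[X in measurable X]setTI; exact: (@measurable_flip R).
  - transitivity (\int[mu]_p (\1_A (flip p))%:E)%E.
      rewrite integral_indic ?setIT//.
      by rewrite -[X in measurable X]setTI; exact: (@measurable_flip R).
    rewrite (ge0_integral_flip (f := fun p => (\1_A p)%:E)) ?integral_indic ?setIT//.
    by apply/measurable_EFinP; exact: measurable_indic.
  - by move=> p /= p1; apply: sA.
have := negligibleU (@negligible_outside R) (negligibleU (@negligible_line R 1) H1).
apply: negligibleS => p /= H; apply: contrapT => /not_orP[/contrapT[/= + +] /not_orP[p1 p2]].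
rewrite !in_itv /= => /andP[a b] /andP[a' b']; apply: H.
by rewrite a a' !lt_neqAle b b' !andbT; split; apply/eqP.
Qed.

(** Formulas with floors hold on the half-open square, which has full measure, and not on the right
    and top sides. It suffices to compare squares, which is all that a norm sees. *)
Lemma square_agree_L2 (f g : plane -> R) : f \in L2 -> measurable_fun setT g ->
  (forall p, 0 <= p.1 < 1 -> 0 <= p.2 < 1 -> f p ^+ 2 = g p ^+ 2) ->
  g \in L2 /\ ip mu f f = ip mu g g.
Proof.
move=> lf mg fg; have mf := L2_measurable lf.
have E : (\int[mu]_p (f p ^+ 2)%:E = \int[mu]_p (g p ^+ 2)%:E)%E.
  apply: ge0_ae_eq_integral => //.
  - by apply/measurable_EFinP; exact: measurable_funX.
  - by apply/measurable_EFinP; exact: measurable_funX.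
  - by move=> p _; rewrite lee_fin sqr_ge0.
  - by move=> p _; rewrite lee_fin sqr_ge0.
  apply: negligibleS negligible_half_open => p /= H [p1 p2]; apply: H => _.
  by rewrite fg.
have lg : g \in L2.
  apply: integrable_sqr_L2 => //; have /integrableP[_] := Lfun2_integrable_sqr lf.
  move=> h; apply/integrableP; split; first by apply/measurable_EFinP; exact: measurable_funX.
  move: h; under eq_integral do rewrite /= ger0_norm ?sqr_ge0//.
  by under [X in _ -> (X < _)%E]eq_integral do rewrite /= ger0_norm ?sqr_ge0//; rewrite E.
by split => //; apply: EFin_inj; rewrite !ip_EFin.
Qed.

(** Outside the square nothing bounds [f]. The truncation [h] is dominated by [g] everywhere and has
    the same square as [f] on the half-open square. *)
Lemma square_ip_le (f g : plane -> R) : measurable_fun setT f -> g \in L2 ->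
  (forall p, 0 <= p.1 < 1 -> 0 <= p.2 < 1 -> f p ^+ 2 <= g p ^+ 2) -> ip mu f f <= ip mu g g.
Proof.
move=> mf lg fg; have mg := L2_measurable lg.
pose h (p : plane) := Num.min `|f p| `|g p|.
have hg p : `|h p| <= `|g p|.
  by rewrite ger0_norm ?ge_min ?lexx ?orbT// le_min !normr_ge0.
have mh : measurable_fun setT h by apply: measurable_minr; exact: measurableT_comp.
have lh : h \in L2 by exact: (le_L2 mh lg hg).
have hf p : 0 <= p.1 < 1 -> 0 <= p.2 < 1 -> h p ^+ 2 = f p ^+ 2.
  move=> p1 p2; rewrite /h min_l ?(real_normK (num_real _))//.
  by rewrite -ler_sqr ?nnegrE// !(real_normK (num_real _)) fg.
by have [_ <-] := square_agree_L2 lh mf hf; exact: ip_le.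
Qed.

Lemma square_agree_ip (f f' g : plane -> R) :
  f \in L2 -> f' \in L2 -> g \in L2 ->
  (forall p, 0 <= p.1 < 1 -> 0 <= p.2 < 1 -> f p = f' p) -> ip mu f g = ip mu f' g.
Proof.
move=> lf lf' lg ff'; have lB := L2B lf lf'.
have l0 : (fun=> 0 : R) \in L2 := cst_L2 mu 0.
have [|_ H] := square_agree_L2 l0 (L2_measurable lB).
  by move=> p p1 p2; rewrite ff'// subrr.
have := cauchy_schwarz lB lg; rewrite -H ip0l mul0r => {}H.
have : ip mu (fun x => f x - f' x) g == 0 by rewrite -sqrf_eq0 eq_le H sqr_ge0.
by rewrite ipBl// subr_eq0 => /eqP.
Qed.

Lemma measurable_floor : measurable_fun setT (fun x : measurableTypeR R => (Num.floor x)%:~R : R).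
Proof.
by apply: nondecreasing_measurable => // x y xy; rewrite ler_int; exact: le_floor.
Qed.

End SquareAgree.

Section SurfacePullback.
Variables (R : realType) (O : origami_datum).
Local Notation m := (nsquares O).
Local Notation plane := (measurableTypeR R * measurableTypeR R)%type.
Local Notation mu := (@square_measure R).
Local Notation surf := (surface R O).
Local Notation nu := (surface_measure R O).
Local Notation sigma := (origami_sigma O).
Implicit Types f g : surf -> R.
Local Notation L2 := (Lfun nu 2%:E).

Lemma nsquares_gt0R : 0 < m%:R :> R.
Proof. by rewrite ltr0n nsquares_gt0. Qed.

Lemma integral_develop (F : surf -> \bar R) : measurable_fun setT F -> (forall x, 0 <= F x)%E ->
  (\int[nu]_x F x = (m%:R^-1)%:E * \sum_i \int[mu]_p F (develop i p))%E.
Proof.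
move=> mF F0; rewrite ge0_integral_surface//; congr (_ * _)%E; apply: eq_bigr => i _.
apply: eq_integral_square => //.
- exact: (measurableT_comp mF (@measurable_psi R O i)).
- exact: (measurableT_comp mF (@measurable_develop R O i)).
- by move=> p /andP[p1 _]; rewrite develop_psi.
Qed.

Let mV0 : 0 < (m%:R^-1 : R). Proof. by rewrite invr_gt0 nsquares_gt0R. Qed.

Lemma develop_L2 i f : f \in L2 -> (fun p => f (develop i p)) \in Lfun mu 2%:E.
Proof.
exact: (@pullback_L2 _ _ plane surf R mu nu m (@develop R O) _ mV0 (@measurable_develop R O) integral_develop i).
Qed.

Lemma ip_develop f g : f \in L2 -> g \in L2 ->
  ip nu f g = m%:R^-1 * \sum_i ip mu (fun p => f (develop i p)) (fun p => g (develop i p)).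
Proof.
exact: (@ip_pullback _ _ plane surf R mu nu m (@develop R O) _ mV0 (@measurable_develop R O) integral_develop).
Qed.

Lemma ip_develop_le i f : f \in L2 ->
  sqnrm mu (fun p => f (develop i p)) <= m%:R * ip nu f f.
Proof.
move=> lf; rewrite ip_develop// mulrA mulfV ?gt_eqF ?nsquares_gt0R// mul1r.
by rewrite (bigD1 i)//= lerDl; apply: sumr_ge0 => j _; exact: ip_ge0.
Qed.

Lemma twist_L2 N c f : (sigma ^+ N = 1)%g -> f \in L2 ->
  (fun x => f (twist N c x)) \in L2.
Proof.
move=> sN; exact: (@comp_L2 _ _ surf surf R nu nu _ (measurable_twist sN c) (ge0_integral_twist sN c)).
Qed.

Local Notation surf' := (surface R (swap_datum O)).
Local Notation nu' := (surface_measure R (swap_datum O)).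

Lemma swap_L2 f : f \in L2 -> (fun x => f (swap x)) \in Lfun nu' 2%:E.
Proof.
exact: (@comp_L2 _ _ surf' surf R nu' nu _ (@measurable_swap_surface R O) (@ge0_integral_swap R O)).
Qed.

Lemma ip_swap f g : f \in L2 -> g \in L2 ->
  ip nu' (fun x => f (swap x)) (fun x => g (swap x)) = ip nu f g.
Proof.
exact: (@ip_comp _ _ surf' surf R nu' nu _ (@measurable_swap_surface R O) (@ge0_integral_swap R O)).
Qed.

Lemma vtwist_L2 N c f : (origami_tau O ^+ N = 1)%g -> f \in L2 ->
  (fun x => f (vtwist N c x)) \in L2.
Proof.
move=> tN; exact: (@comp_L2 _ _ surf surf R nu nu _ (measurable_vtwist tN c) (ge0_integral_vtwist tN c)).
Qed.

End SurfacePullback.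

Definition fnorm (R : realType) (n : nat) (v : 'I_n -> R) : R := Num.sqrt (\sum_i v i ^+ 2).

Lemma sqr_fnorm (R : realType) (n : nat) (v : 'I_n -> R) : fnorm v ^+ 2 = \sum_i v i ^+ 2.
Proof. by rewrite sqr_sqrtr// sumr_ge0// => i _; exact: sqr_ge0. Qed.

(** The reverse triangle inequality, by which the fibre norm of an almost invariant function is
    almost invariant. *)
Lemma fnorm_dist (R : realType) (n : nat) (v w : 'I_n -> R) :
  (fnorm v - fnorm w) ^+ 2 <= \sum_i (v i - w i) ^+ 2.
Proof.
have H : \sum_i v i * w i <= fnorm v * fnorm w.
  rewrite (le_trans (ler_norm _))// -ler_sqr ?nnegrE ?mulr_ge0 ?sqrtr_ge0//.
  by rewrite exprMn !sqr_fnorm real_normK ?num_real// sum_cauchy_schwarz.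
rewrite (eq_bigr (fun i => v i ^+ 2 + w i ^+ 2 + (- 2) * (v i * w i))); last by move=> i _; ring.
rewrite !big_split /= -mulr_sumr -!sqr_fnorm; nra.
Qed.

Lemma measurable_sqrt (R : realType) : measurable_fun setT (@Num.sqrt R).
Proof. by apply: nondecreasing_measurable => // x y xy; exact: ler_wsqrtr. Qed.

Lemma fnorm_L2 d (T : measurableType d) (R : realType) (mu : probability T R) (n : nat)
    (u : 'I_n -> T -> R) : (forall i, u i \in Lfun mu 2%:E) ->
  (fun p => fnorm (fun i => u i p)) \in Lfun mu 2%:E /\
  sqnrm mu (fun p => fnorm (fun i => u i p)) =
    \sum_i sqnrm mu (u i).
Proof.
move=> lu; have mv : measurable_fun setT (fun p => fnorm (fun i => u i p)).
  apply: measurableT_comp; first exact: (@measurable_sqrt R).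
  by apply: measurable_sum => i; apply: measurable_funX; exact: L2_measurable.
have E p : fnorm (fun i => u i p) ^+ 2 = \sum_i u i p ^+ 2 by rewrite sqr_fnorm.
have lv : (fun p => fnorm (fun i => u i p)) \in Lfun mu 2%:E.
  apply: integrable_sqr_L2 => //.
  rewrite (_ : _ \o _ = fun p => (\sum_i (u i p ^+ 2)%:E)%E).
    by apply: integrable_sum => // i _; exact: Lfun2_integrable_sqr.
  by apply/funext => p; rewrite /= E sumEFin.
split => //; apply: EFin_inj; rewrite ip_EFin// -sumEFin.
transitivity (\int[mu]_p (\sum_i (u i p * u i p)%:E)%E)%E.
  by apply: eq_integral => p _; rewrite -expr2 E sumEFin; congr EFin; apply: eq_bigr => i _; rewrite expr2.
rewrite ge0_integral_sum//.
- by apply: eq_bigr => i _; rewrite ip_EFin.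
- by move=> i; apply/measurable_EFinP; have := L2_measurable (lu i) => mi; exact: measurable_funM.
- by move=> i p _; rewrite lee_fin -expr2 sqr_ge0.
Qed.

(** * Fibre norms *)

Section Fibre.
Variables (R : realType) (O : origami_datum).
Local Notation m := (nsquares O).
Local Notation plane := (measurableTypeR R * measurableTypeR R)%type.
Local Notation mu := (@square_measure R).
Local Notation surf := (surface R O).
Local Notation nu := (surface_measure R O).
Local Notation sigma := (origami_sigma O).
Local Notation tau := (origami_tau O).
Implicit Types f g : surf -> R.
Local Notation L2 := (Lfun nu 2%:E).

(* A function on the torus, as the sum runs over all squares. *)
Definition fibre_norm f (p : plane) : R :=
  fnorm (fun i => f (develop i (p.1, p.2 - (Num.floor p.2)%:~R))).

Lemma fibre_norm_sqr f p : 0 <= p.2 < 1 ->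
  fibre_norm f p ^+ 2 = \sum_i f (develop i p) ^+ 2.
Proof.
move=> p2; rewrite sqr_fnorm; apply: eq_bigr => i _.
have /floor_def -> : 0%:~R <= p.2 < (0 + 1)%:~R by [].
by rewrite subr0 -surjective_pairing.
Qed.

Lemma fibre_norm_x f x y : fibre_norm f (x + 1, y) = fibre_norm f (x, y).
Proof.
congr Num.sqrt; rewrite /= [RHS](reindex_inj (@perm_inj _ (sigma_pow O 1))) /=.
by apply: eq_bigr => i _; rewrite -[1%R in LHS]/(1%:~R) develop_shift.
Qed.

Lemma fibre_norm_y f x y : fibre_norm f (x, y + 1) = fibre_norm f (x, y).
Proof.
rewrite /fibre_norm /= (_ : y + 1 - _ = y - (Num.floor y)%:~R)//.
by rewrite floorDrz ?rpred1// floor1 intrD; ring.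
Qed.

Lemma measurable_fibre_norm f : measurable_fun setT f -> measurable_fun setT (fibre_norm f).
Proof.
move=> mf; apply: measurableT_comp; first exact: (@measurable_sqrt R).
apply: measurable_sum => i; apply: measurable_funX.
apply: (measurableT_comp mf); apply: (measurableT_comp (@measurable_develop R O i)).
apply/measurable_fun_pair => //=; apply: measurable_funB => //.
exact: (measurableT_comp (@measurable_floor R)).
Qed.

Lemma fibre_norm_L2 f : f \in L2 ->
  fibre_norm f \in Lfun mu 2%:E /\ sqnrm mu (fibre_norm f) = m%:R * ip nu f f.
Proof.
move=> lf; have [lv vE] := fnorm_L2 (fun i => develop_L2 i lf).
have [|lF <-] := square_agree_L2 lv (measurable_fibre_norm (L2_measurable lf)).
  by move=> p p1 p2; rewrite fibre_norm_sqr// sqr_fnorm.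
split => //; rewrite vE ip_develop// mulrA mulfV ?mul1r// gt_eqF//; exact: nsquares_gt0R.
Qed.

Lemma fibre_norm_move f (S : plane -> plane) (T : surf -> surf) :
  measurable_fun setT S -> f \in L2 -> (fun x => f (T x)) \in L2 ->
  (forall p, 0 <= p.1 < 1 -> 0 <= p.2 < 1 ->
    fibre_norm f (S p) = fnorm (fun i => f (T (develop i p)))) ->
  sqnrm mu (fun p => fibre_norm f (S p) - fibre_norm f p) <=
  m%:R * sqnrm nu (fun x => f (T x) - f x).
Proof.
move=> mS lf lfT fS; have lB := L2B lfT lf.
have [lF <-] := fibre_norm_L2 lB.
apply: square_ip_le => //.
  have mF := measurable_fibre_norm (L2_measurable lf).
  by apply: measurable_funB => //; exact: measurableT_comp.
move=> p p1 p2; rewrite (fibre_norm_sqr _ p2) fS//.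
have -> : fibre_norm f p = fnorm (fun i => f (develop i p)).
  rewrite -[LHS]ger0_norm ?sqrtr_ge0// -sqrtr_sqr fibre_norm_sqr//.
exact: fnorm_dist.
Qed.

Variable N : nat.
Hypotheses (sigmaN : (sigma ^+ N)%g = 1%g) (tauN : (tau ^+ N)%g = 1%g) (N3 : (3 <= N)%N).

Lemma fibre_norm_twist f p : 0 <= p.1 < 1 -> 0 <= p.2 < 1 ->
  fibre_norm f (p.1 + N%:~R * p.2, p.2) = fnorm (fun i => f (twist N 1 (develop i p))).
Proof.
move=> _ /andP[p0 p1]; rewrite -[LHS]ger0_norm ?sqrtr_ge0// -sqrtr_sqr fibre_norm_sqr ?p0//.
congr Num.sqrt; apply: eq_bigr => i _; rewrite twist_develop ?p0 ?ltW// /shear mul1r.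
by [].
Qed.

Lemma swap_develop i x y : 0 <= x <= 1 ->
  swap (develop (O := swap_datum O) i (y, x)) =
  develop (sigma_pow (swap_datum O) (Num.floor y) i : 'I_m) (x, y - (Num.floor y)%:~R) :> surf.
Proof. by move=> x01; rewrite swap_psi develop_psi. Qed.

(** The vertical shear moves the point up across whole squares; the integer part of the new height
    acts as a permutation of the squares, which the sum over the fibre ignores. *)
Lemma fibre_norm_vtwist f p : 0 <= p.1 < 1 -> 0 <= p.2 < 1 ->
  fibre_norm f (p.1, p.2 + N%:~R * p.1) = fnorm (fun i => f (vtwist N 1 (develop i p))).
Proof.
move=> /andP[x0 x1] /andP[y0 y1].
have E (i : 'I_m) : vtwist N 1 (develop i p : surf) = swap (develop (O := swap_datum O) i (p.2 + N%:~R * p.1, p.1)).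
  rewrite develop_psi ?x0 ?ltW// (_ : psi i p = swap (psi (O := swap_datum O) i (p.2, p.1))).
    rewrite vtwist_swap (twist_psi (swap_sigmaN tauN)); last by rewrite /in_square /= x0 y0 !ltW.
    by rewrite /shear mul1r.
  by rewrite swap_psi; case: p {x0 x1 y0 y1}.
congr Num.sqrt; under [RHS]eq_bigr do rewrite E swap_develop ?x0 ?ltW//.
by rewrite [LHS](reindex_inj (@perm_inj _ (sigma_pow (swap_datum O) (Num.floor (p.2 + N%:~R * p.1))))).
Qed.

Lemma fibre_norm_gap f : f \in L2 ->
  sqnrm mu (fun p => fibre_norm f p - \int[mu]_q fibre_norm f q) <=
  32 * m%:R * (sqnrm nu (fun x => f (twist N 1 x) - f x) +
               sqnrm nu (fun x => f (vtwist N 1 x) - f x)).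
Proof.
move=> lf; have [lF _] := fibre_norm_L2 lf.
apply: le_trans (@torus_gap R N%:Z _ _ (fibre_norm_x f) (fibre_norm_y f) lF) _ => //.
rewrite -mulrA ler_wpM2l// mulrDr; apply: lerD.
  apply: (fibre_norm_move (S := fun p => (p.1 + N%:~R * p.2, p.2))) => //.
  - exact: (@measurable_shear_lin R N%:~R).
  - exact: twist_L2.
  - exact: fibre_norm_twist.
apply: (fibre_norm_move (S := fun p => (p.1, p.2 + N%:~R * p.1))) => //.
- by apply/measurable_fun_pair => //=; apply: measurable_funD => //; exact: measurable_funM.
- exact: vtwist_L2.
- exact: fibre_norm_vtwist.
Qed.

End Fibre.

(** * Fourier coefficients along a cylinder *)

Section StripWeak.
Variables (R : realType) (O : origami_datum) (N : nat).
Local Notation m := (nsquares O).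
Local Notation plane := (measurableTypeR R * measurableTypeR R)%type.
Local Notation mu := (@square_measure R).
Local Notation surf := (surface R O).
Local Notation nu := (surface_measure R O).
Local Notation sigma := (origami_sigma O).
Hypotheses (sigmaN : (sigma ^+ N)%g = 1%g) (N0 : (0 < N)%N).

(** The test function [w] is [c k] times the character [z] on the [k]-th square of the strip. It has
    to be orthogonal to the functions of [y] alone: this is automatic for [z.1 != 0], and otherwise
    it is the condition on the sum of the weights. *)
Lemma strip_weak (c : nat -> R) (z : int * int) i d :
  z.1 != 0 \/ \sum_(k < N) c k = 0 -> 0 < d ->
  exists2 e, 0 < e & forall f : surf -> R, f \in Lfun nu 2%:E -> ip nu f f <= 1 ->
    sqnrm nu (fun x => f (twist N 1 x) - f x) <= e ->
    `|\sum_(k < N) c k * coef z (fun p => f (develop (sigma_pow O k i) p))| <= d.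
Proof.
move=> zc d0.
pose I (k : nat) : set (measurableTypeR R) := `[k%:R, k%:R + 1[%classic.
pose w (p : plane) := \sum_(k < N) \1_(I k) p.1 * (c k * character z (p.1 - k%:R, p.2)).
have mw : measurable_fun setT w.
  apply: measurable_sum => k; apply: measurable_funM.
    have mI : measurable_fun setT (\1_(I k) : measurableTypeR R -> R).
      by apply: measurable_indic; exact: measurable_itv.
    exact: (measurableT_comp mI measurable_fst).
  apply: measurable_funM => //.
  apply: (measurableT_comp (@measurable_character R z)).
  exact: (@measurable_translate_x R (- k%:R)).
have wb p : `|w p| <= \sum_(k < N) `|c k| * 2.
  rewrite (le_trans (ler_norm_sum _ _ _))//; apply: ler_sum => k _.
  rewrite normrM indicE; case: (_ \in _); rewrite ?normr1 ?mul1r ?normr0 ?mul0r ?mulr_ge0//.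
  by rewrite normrM ler_wpM2l// character_bounded.
have wE (k : 'I_N) (p : plane) : 0 <= p.1 < 1 -> w (translate_x k%:R p) = c k * character z p.
  move=> /andP[p0 p1]; rewrite /w (bigD1 k)//= big1 ?addr0 => [|j jk].
    rewrite indicE mem_set ?mul1r; first by rewrite addrK -surjective_pairing.
    by rewrite /I /= in_itv /= lerDr p0 addrC ltrD2l.
  rewrite indicE memNset ?mul0r// /I /= in_itv /= => /andP[h1 h2].
  have : (j : nat) = k; last by move/val_inj/eqP; apply/negP.
  apply/eqP; rewrite eqn_leq; apply/andP; split; rewrite -ltnS -(ltr_nat R) -natr1; lra.
have lw k : (w \o translate_x k) \in Lfun mu 2%:E.
  apply: (@bounded_L2 _ _ _ _ _ (\sum_(k < N) `|c k| * 2)) => [|p]; last exact: wb.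
  exact: measurableT_comp mw (@measurable_translate_x R k).
have lc k : (fun p => c k * character z p) \in Lfun mu 2%:E.
  by apply: L2Z; exact: character_L2.
have w0 l : \sum_(k < N) ip mu (w \o translate_x k%:R) (character (0, l)) = 0.
  have -> : \sum_(k < N) ip mu (w \o translate_x k%:R) (character (0, l)) =
      \sum_(k < N) c k * (z == (0, l))%:R.
    apply: eq_bigr => k _; rewrite (square_agree_ip (lw _) (lc k) (@character_L2 R _)).
      by rewrite ipZl ?character_L2// character_orthonormal.
    by move=> p p1 p2; exact: wE.
  rewrite -mulr_suml; case: zc => [z1|->]; last by rewrite mul0r.
  by case: eqP => [zE|]; [rewrite zE eqxx in z1|rewrite mulr0].
have m0 := @nsquares_gt0R R O; have N0R : 0 < N%:R :> R by rewrite ltr0n.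
have [|e e0 He] := @weak_strip R N w d (N%:R * m%:R) N0 mw (ex_intro _ _ wb) w0 d0.
  by rewrite mulr_ge0// ltW.
(* Each of the [N] squares of the strip sees at most [m] times the displacement on the surface. *)
exists (e / (N%:R * m%:R)); first by rewrite divr_gt0// mulr_gt0.
move=> f lf f1 fe; have mf := L2_measurable lf.
pose G (p : plane) := f (develop i p).
have mG : measurable_fun setT G by exact: (measurableT_comp mf (@measurable_develop R O i)).
have GE (k : nat) : G \o translate_x k%:R = (fun p => f (develop (sigma_pow O k i) p)).
  apply/funext => -[x y]; rewrite /G /translate_x /=.
  by rewrite -[k%:R]/((k%:Z)%:~R) develop_shift.
pose Gt (k : nat) := fun p : plane => G (p.1 + k%:R + N%:R * p.2, p.2).
have mGt k : measurable_fun setT (Gt k).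
  apply: (measurableT_comp mG).
  apply/measurable_fun_pair => //=; apply: measurable_funD; last exact: measurable_funM.
  exact: measurable_funD.
have GtE (k : nat) (p : plane) : 0 <= p.1 < 1 -> 0 <= p.2 < 1 ->
    f (twist N 1 (develop (sigma_pow O k i) p)) = Gt k p.
  case: p => x y /= p1 /andP[y0 y1]; rewrite twist_develop ?y0 ?ltW//.
  rewrite /Gt /G /= addrAC -[k%:R]/((k%:Z)%:~R) (develop_shift i _ y k).
  by rewrite /shear mul1r.
have ltw := twist_L2 1 sigmaN lf.
have lGt (k : nat) : Gt k \in Lfun mu 2%:E.
  have lt := develop_L2 (sigma_pow O k i) ltw.
  have [|//] := square_agree_L2 lt (mGt k).
  by move=> p p1 p2; rewrite GtE.
have := He G mG; rewrite -/Gt.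
have -> : \sum_(k < N) c k * coef z (fun p => f (develop (sigma_pow O k i) p)) =
    \sum_(k < N) ip mu (G \o translate_x k%:R) (w \o translate_x k%:R).
  apply: eq_bigr => k _; rewrite GE [RHS]ipC.
  have lk := develop_L2 (sigma_pow O k i) lf.
  have hw (p : plane) : 0 <= p.1 < 1 -> 0 <= p.2 < 1 ->
      (w \o translate_x k%:R) p = c k * character z p by move=> p1 _; exact: wE.
  rewrite (square_agree_ip (lw _) (lc k) lk hw) (ipZl _ (@character_L2 R z) lk).
  by rewrite [X in _ = _ * X]ipC.
apply => //.
- by move=> k; rewrite GE; exact: develop_L2.
- move=> x y; rewrite /G -[N%:R]/((N%:Z)%:~R) develop_shift.
  by rewrite (sigma_pow_order (k := N)) ?perm1.
- apply: (@le_trans _ _ (\sum_(k < N) m%:R)); last by rewrite sumr_const card_ord mulr_natl.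
  apply: ler_sum => k _; rewrite GE (le_trans (ip_develop_le _ lf))//.
  by rewrite ler_piMr// ltW.
apply: (@le_trans _ _ (\sum_(k < N) m%:R * (e / (N%:R * m%:R)))); last first.
  rewrite sumr_const card_ord -mulr_natl le_eqVlt; apply/orP; left; apply/eqP.
  by field; rewrite !gt_eqF.
apply: ler_sum => k _.
have lD := L2B ltw lf.
have lk := develop_L2 (sigma_pow O k i) lD.
have GE1 (p : plane) : G (p.1 + k%:R, p.2) = f (develop (sigma_pow O k i) p).
  by have := congr1 (fun h => h p) (GE k).
have mD : measurable_fun setT (fun p : plane => Gt k p - G (p.1 + k%:R, p.2)).
  apply: measurable_funB => //; under eq_fun do rewrite GE1.
  by apply: L2_measurable; exact: develop_L2.
have [|_ <-] := square_agree_L2 lk mD.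
  by move=> p p1 p2; rewrite GtE// GE1.
by rewrite (le_trans (ip_develop_le _ lD))// ler_wpM2l// ltW.
Qed.

End StripWeak.

(** * Weak limits of almost invariant functions *)

Section WeakLimit.
Variables (R : realType) (O : origami_datum) (N : nat).
Local Notation m := (nsquares O).
Local Notation plane := (measurableTypeR R * measurableTypeR R)%type.
Local Notation mu := (@square_measure R).
Local Notation surf := (surface R O).
Local Notation nu := (surface_measure R O).
Local Notation sigma := (origami_sigma O).
Local Notation tau := (origami_tau O).
Hypotheses (sigmaN : (sigma ^+ N)%g = 1%g) (tauN : (tau ^+ N)%g = 1%g) (N2 : (1 < N)%N).
Implicit Types f : surf -> R.
Local Notation L2 := (Lfun nu 2%:E).

Definition drift (M : nat) f : R :=
  sqnrm nu (fun x => f (twist M 1 x) - f x) +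
  sqnrm nu (fun x => f (vtwist M 1 x) - f x).

Definition almost_invariant (M : nat) (e : R) f : Prop :=
  [/\ f \in L2, ip nu f f <= 1, ip nu f (fun=> 1) = 0 & drift M f <= e].

(** Takes the place of statements on weak limits of sequences of increasingly invariant functions;
    no subsequence or compactness is involved. *)
Definition eventually_holds (P : (surf -> R) -> Prop) : Prop :=
  exists2 e : R, 0 < e & forall f, almost_invariant N e f -> P f.

Local Notation ev := eventually_holds.
Local Notation fcoef z i f := (coef z (fun p => f (develop i p))).

Lemma almost_invariant_le e e' f : e <= e' -> almost_invariant N e f -> almost_invariant N e' f.
Proof. by move=> ee' [lf f1 f0 fe]; split => //; exact: le_trans ee'. Qed.

Lemma ev_mono (P Q : (surf -> R) -> Prop) :
  (forall f, f \in L2 -> ip nu f f <= 1 -> ip nu f (fun=> 1) = 0 -> P f -> Q f) ->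
  ev P -> ev Q.
Proof.
move=> PQ [e e0 He]; exists e => // f fe; have [lf f1 f0 _] := fe.
exact: PQ (He _ fe).
Qed.

Lemma ev_and (P Q : (surf -> R) -> Prop) : ev P -> ev Q -> ev (fun f => P f /\ Q f).
Proof.
move=> [e e0 He] [e' e0' He']; exists (Num.min e e'); first by rewrite lt_min e0.
move=> f fe; split.
  by apply/He/(almost_invariant_le _ fe); rewrite ge_min lexx.
by apply/He'/(almost_invariant_le _ fe); rewrite ge_min lexx orbT.
Qed.

Lemma ev_all (I : eqType) (s : seq I) (P : I -> (surf -> R) -> Prop) :
  (forall i, i \in s -> ev (P i)) -> ev (fun f => forall i, i \in s -> P i f).
Proof.
elim: s => [|i s IH] H; first by exists 1.
have H1 : ev (P i) by apply: H; rewrite mem_head.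
have H2 : ev (fun f => forall j, j \in s -> P j f).
  by apply: IH => j js; apply: H; rewrite inE js orbT.
apply: ev_mono (ev_and H1 H2) => f _ _ _ [Pi Ps] j.
by rewrite inE => /orP[/eqP ->|/Ps].
Qed.

Lemma coef_swap (i : 'I_m) z f : f \in L2 ->
  coef z (fun p => f (swap (develop (O := swap_datum O) i p))) = fcoef (z.2, z.1) i f.
Proof.
move=> lf; have ld := develop_L2 i lf.
rewrite -(coef_flip z (L2_measurable ld)).
have ls := develop_L2 (i : 'I_(nsquares (swap_datum O))) (swap_L2 lf).
rewrite /coef; apply: (square_agree_ip ls (flip_L2 ld) (@character_L2 R z)) => p /andP[x0 x1] /andP[y0 y1] /=.
by rewrite develop_psi ?x0 ?ltW// swap_psi develop_psi// y0 ltW.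
Qed.

Lemma ev_strip (c : nat -> R) z (i : 'I_m) d : z.1 != 0 \/ \sum_(k < N) c k = 0 -> 0 < d ->
  ev (fun f => `|\sum_(k < N) c k * fcoef z (sigma_pow O k i) f| <= d).
Proof.
move=> zc d0; have [e e0 He] := strip_weak sigmaN (ltnW N2) i zc d0.
exists e => // f [lf f1 _ fe]; apply: He => //; apply: le_trans fe.
by rewrite lerDl ip_ge0.
Qed.

Lemma ev_vstrip (c : nat -> R) z (i : 'I_m) d : z.2 != 0 \/ \sum_(k < N) c k = 0 -> 0 < d ->
  ev (fun f => `|\sum_(k < N) c k * fcoef z (sigma_pow (swap_datum O) k i : 'I_m) f| <= d).
Proof.
move=> zc d0.
have [e e0 He] := @strip_weak R (swap_datum O) N (swap_sigmaN tauN) (ltnW N2) c (z.2, z.1) i d zc d0.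
exists e => // f [lf f1 _ fe].
have := He (fun x => f (swap x)) (swap_L2 lf).
rewrite (ip_swap lf lf) => /(_ f1).
have -> : (fun x => f (swap (twist N 1 x)) - f (swap x)) =
    (fun x => (fun y : surf => f (vtwist N 1 y) - f y) (swap x)).
  by apply/funext => x; rewrite vtwist_swap.
have lB := L2B (vtwist_L2 1 tauN lf) lf.
rewrite (ip_swap lB lB) => H.
have -> : \sum_(k < N) c k * fcoef z (sigma_pow (swap_datum O) k i : 'I_m) f =
  \sum_(k < N) c k * coef (z.2, z.1) (fun p => f (swap (develop (sigma_pow (swap_datum O) k i) p))).
  apply: eq_bigr => k _; congr (_ * _); rewrite (coef_swap _ _ lf) -surjective_pairing.
  by [].
apply: H; apply: le_trans fe; rewrite lerDr; exact: ip_ge0.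
Qed.

(** The weights single out the first square of a strip. Frequencies with [z.1 != 0] are controlled
    by the horizontal multitwist, the remaining ones with [z.2 != 0] by the vertical one. *)
Lemma ev_coef z (i : 'I_m) d : z != 0 -> 0 < d -> ev (fun f => `|fcoef z i f| <= d).
Proof.
pose c (k : nat) : R := (k == 0%N)%:R.
have E (h : nat -> R) : \sum_(k < N) c k * h k = h 0%N.
  rewrite (bigD1 (Ordinal (ltnW N2)))//= big1 ?addr0 /c ?eqxx ?mul1r// => k k0.
  by rewrite (_ : (k : nat) == 0%N = false) ?mul0r//; apply/negbTE.
move=> z0 d0; have [z1|z1] := eqVneq z.1 0.
  have z2 : z.2 != 0.
    by apply: contraNneq z0 => z2; apply/eqP; case: z z1 z2 => /= a b -> ->.
  apply: ev_mono (ev_vstrip (c := c) i (or_introl z2) d0) => f _ _ _.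
  by rewrite (E (fun k => fcoef z (sigma_pow (swap_datum O) k i : 'I_m) f)) sigma_pow0 perm1.
apply: ev_mono (ev_strip (c := c) i (or_introl z1) d0) => f _ _ _.
by rewrite (E (fun k => fcoef z (sigma_pow O k i) f)) sigma_pow0 perm1.
Qed.

Local Notation mean i f := (fcoef 0 i f).
Let close (i j : 'I_m) := forall d, 0 < d -> ev (fun f => `|mean i f - mean j f| <= d).

Let close_sym i j : close i j -> close j i.
Proof. by move=> H d d0; apply: ev_mono (H d d0) => f _ _ _; rewrite distrC. Qed.

Let close_trans i j k : close i j -> close j k -> close i k.
Proof.
move=> H1 H2 d d0; have d2 : 0 < d / 2 by rewrite divr_gt0.
apply: ev_mono (ev_and (H1 _ d2) (H2 _ d2)) => f _ _ _ [h1 h2].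
by rewrite -(subrKA (mean j f)) (le_trans (ler_normD _ _))//; lra.
Qed.

(** The weights 1, -1, 0, ... have sum zero, so [strip_weak] admits the frequency 0 and compares the
    means on the first two squares of a strip. *)
Let c2 (k : nat) : R := (k == 0%N)%:R - (k == 1%N)%:R.

Let sum_c2 (h : nat -> R) : \sum_(k < N) c2 k * h k = h 0%N - h 1%N.
Proof.
rewrite (bigD1 (Ordinal (ltnW N2)))//= (bigD1 (Ordinal N2))//= big1 ?addr0 => [|k /andP[k0 k1]].
  by rewrite /c2 /= subr0 sub0r mul1r mulN1r.
rewrite /c2 (_ : (k : nat) == 0%N = false); last exact/negbTE.
by rewrite (_ : (k : nat) == 1%N = false) ?subrr ?mul0r//; apply/negbTE.
Qed.

Let sum_c20 : \sum_(k < N) c2 k = 0.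
Proof. by have := sum_c2 (fun=> 1); rewrite subrr; under eq_bigr do rewrite mulr1. Qed.

Let close_sigma i : close i (sigma i).
Proof.
apply: close_sym => d d0.
(* The strip starts at [sigma i], whose right neighbour is [i]. *)
apply: ev_mono (ev_strip (c := c2) (z := 0) (sigma i) (or_intror sum_c20) d0) => f _ _ _.
rewrite (sum_c2 (fun k => mean (sigma_pow O k (sigma i)) f)) sigma_pow0 perm1.
by rewrite /= expg1 permK.
Qed.

Let close_tau i : close i (tau i).
Proof.
move=> d d0.
apply: ev_mono (ev_vstrip (c := c2) (z := 0) i (or_intror sum_c20) d0) => f _ _ _.
rewrite (sum_c2 (fun k => mean (sigma_pow (swap_datum O) k i : 'I_m) f)) sigma_pow0 perm1.
by rewrite /= expg1 invgK.
Qed.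

(** The permutations that move every square to a close one form a group; it contains [sigma] and
    [tau], which generate a transitive group. *)
Let close_all i j : close i j.
Proof.
pose A := [set g : {perm 'I_m} | `[< forall k, close k (g k) >]]%SET.
have gA : group_set A.
  apply/group_setP; split.
    by rewrite inE; apply/asboolP => k d d0; rewrite perm1; exists 1 => // f _; rewrite subrr normr0 ltW.
  move=> g h; rewrite !inE => /asboolP gc /asboolP hc; apply/asboolP => k.
  by rewrite permM; exact: close_trans (gc k) (hc (g k)).
have sA : (<<[set sigma; tau]%SET>> \subset (Group gA))%g.
  rewrite gen_subG; apply/fintype.subsetP => x; rewrite !inE => /orP[] /eqP ->; apply/asboolP => k.
    exact: close_sigma.
  exact: close_tau.
have /atransP2/(_ i j) [||g gG ->] := origami_transitive O; rewrite ?inE//.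
by have := fintype.subsetP sA _ gG; rewrite inE => /asboolP/(_ i).
Qed.

(** The means add up to zero, so that each is the average of its differences to all of them. *)
Lemma ev_mean (i : 'I_m) d : 0 < d -> ev (fun f => `|mean i f| <= d).
Proof.
move=> d0; have H := ev_all (s := index_enum 'I_m) (fun j _ => close_all i j d0).
apply: ev_mono H => f lf f1 f0 H.
have m0 := @nsquares_gt0R R O.
have char0 : (character 0 : plane -> R) = (fun=> 1).
  by apply/funext => p; rewrite /character /phase /= !mul0r addr0 mulr0 cos0 sin0 addr0.
have S0 : \sum_j mean j f = 0.
  have l1 : (fun=> 1 : R) \in L2 := cst_L2 nu 1.
  move: f0; rewrite (ip_develop lf l1) => /eqP; rewrite mulf_eq0 invr_eq0 gt_eqF//= => /eqP f0.
  by rewrite -[RHS]f0; apply: eq_bigr => j _; rewrite /coef char0.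
have E : m%:R * mean i f = \sum_(j < m) (mean i f - mean j f).
  by rewrite sumrB S0 subr0 sumr_const card_ord mulr_natl.
rewrite -(ler_pM2l m0) -{1}(gtr0_norm m0) -normrM E (le_trans (ler_norm_sum _ _ _))//.
apply: (@le_trans _ _ (\sum_(j < m) d)); last by rewrite sumr_const card_ord mulr_natl.
by apply: ler_sum => j _; apply: H; rewrite mem_index_enum.
Qed.

(** On each square [W] is approximated by a combination of finitely many characters, against each of
    which [f] is eventually small; the error is controlled by [ip nu f f <= 1], which bounds the
    norm on the square. *)
Lemma ev_ip (W : surf -> R) d : W \in L2 -> 0 < d ->
  ev (fun f => `|ip nu f W| <= d).
Proof.
move=> lW d0; have m0 := @nsquares_gt0R R O.
suff H i : ev (fun f => `|ip mu (fun p => f (develop i p)) (fun p => W (develop i p))| <= d).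
  have := ev_all (s := index_enum 'I_m) (fun j _ => H j).
  apply: ev_mono => f lf f1 f0 {}H; rewrite (ip_develop lf lW).
  rewrite normrM gtr0_norm ?invr_gt0// ler_pdivrMl// (le_trans (ler_norm_sum _ _ _))//.
  apply: (@le_trans _ _ (\sum_(j < m) d)); last by rewrite sumr_const card_ord mulr_natl.
  by apply: ler_sum => j _; apply: H; rewrite mem_index_enum.
have lWi := develop_L2 i lW.
pose e := (d / 2) ^+ 2 / m%:R.
have e0 : 0 < e by rewrite divr_gt0// exprn_gt0// divr_gt0.
have [s [us _ sW]] := trig_sum_dense lWi e0.
set a := fun z => coef z (fun p => W (develop i p)) in sW.
pose q := d / 2 / (\sum_(z <- s) `|a z| + 1).
have sa0 : 0 < \sum_(z <- s) `|a z| + 1 by rewrite ltr_wpDl// sumr_ge0.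
have q0 : 0 < q by rewrite !divr_gt0.
have Hc z : ev (fun f => `|fcoef z i f| <= q).
  have [->|z0] := eqVneq z 0; [exact: ev_mean|exact: ev_coef].
apply: ev_mono (ev_all (s := s) (fun z _ => Hc z)) => f lf f1 f0 H.
have lfi := develop_L2 i lf; have lT := trig_sum_L2 s a.
have lB := L2B lWi lT.
rewrite ipC -[X in ip mu X](_ : (fun p => (W (develop i p) - trig_sum s a p) + trig_sum s a p) = _); last first.
  by apply/funext => p; rewrite subrK.
rewrite (ipDl lB lT lfi) (le_trans (ler_normD _ _))//.
have -> : d = d / 2 + d / 2 by lra.
apply: lerD.
  have d2 : 0 <= d / 2 by rewrite divr_ge0// ltW.
  rewrite -ler_sqr ?nnegrE ?normr_ge0// real_normK ?num_real//.
  apply: (le_trans (cauchy_schwarz lB lfi)).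
  have -> : (d / 2) ^+ 2 = e * m%:R by rewrite /e divfK// gt_eqF.
  apply: ler_pM; rewrite ?ip_ge0 ?(ltW sW)//.
  by rewrite (le_trans (ip_develop_le i lf))// ler_piMr// ltW.
rewrite (ip_trig_sum s a lfi) (le_trans (ler_norm_sum _ _ _))//.
have Q : \sum_(z <- s) `|a z * fcoef z i f| <= \sum_(z <- s) `|a z| * q.
  rewrite !big_seq; apply: ler_sum => z zs; rewrite normrM ler_wpM2l//; exact: H.
apply: (le_trans Q); rewrite -mulr_suml /q mulrA ler_pdivrMr// [X in _ <= X]mulrC ler_wpM2r ?divr_ge0 ?ltW//.
by rewrite ltrDl.
Qed.

End WeakLimit.

(** * Spectral gap on the surface *)

(* [(tr A)^2 <= n tr (A^2)] for the [n x n] matrix [A = V^T V], which has the same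
   traces as the Gram matrix [V V^T]; hence [n + 1] vectors of an [n]-dimensional space
   cannot be almost orthonormal. *)
Lemma gram_trace (R : realType) (K n : nat) (V : 'I_K -> 'I_n -> R) :
  (\sum_i \sum_k V i k ^+ 2) ^+ 2 <= n%:R * \sum_i \sum_j (\sum_k V i k * V j k) ^+ 2.
Proof.
pose M k l := \sum_i V i k * V i l.
have E1 : \sum_i \sum_k V i k ^+ 2 = \sum_k M k k * 1.
  by rewrite exchange_big; apply: eq_bigr => k _; rewrite mulr1; apply: eq_bigr => i _; rewrite expr2.
have E2 : \sum_i \sum_j (\sum_k V i k * V j k) ^+ 2 = \sum_k \sum_l M k l ^+ 2.
  transitivity (\sum_i \sum_j \sum_k \sum_l V i k * V j k * (V i l * V j l)).
    apply: eq_bigr => i _; apply: eq_bigr => j _; rewrite expr2 mulr_suml.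
    by apply: eq_bigr => k _; rewrite mulr_sumr.
  under eq_bigr do rewrite exchange_big.
  rewrite exchange_big; apply: eq_bigr => k _ /=.
  under eq_bigr do rewrite exchange_big.
  rewrite exchange_big; apply: eq_bigr => l _ /=.
  rewrite expr2 mulr_suml; apply: eq_bigr => i _; rewrite mulr_sumr.
  by apply: eq_bigr => j _; ring.
rewrite E1 E2; apply: (le_trans (sum_cauchy_schwarz _ _)).
rewrite [X in _ * X](_ : _ = n%:R); last by rewrite expr1n sumr_const card_ord.
rewrite mulrC ler_wpM2l//; apply: ler_sum => k _; rewrite (bigD1 k)//= lerDl.
by apply: sumr_ge0 => l _; exact: sqr_ge0.
Qed.

Section Probability.
Context d (T : measurableType d) (R : realType) (mu : probability T R).

Lemma ip_cst (c : R) : sqnrm mu (fun=> c) = c ^+ 2.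
Proof.
rewrite /ip Rintegral_cst//= -expr2.
by rewrite [fine _](_ : _ = 1) ?mulr1//; have -> := @probability_setT _ _ _ mu.
Qed.

(** A function of integral at most [eta] cannot exceed [2 * eta] everywhere. All [h i] become small
    at a common point. *)
Lemma exists_small_point (n : nat) (h : 'I_n -> T -> R) (eta : R) :
  (forall i, h i \in Lfun mu 2%:E) -> 0 < eta -> \sum_i sqnrm mu (h i) <= eta ->
  exists p, \sum_i h i p ^+ 2 <= 2 * eta.
Proof.
move=> lh eta0 heta; apply: contrapT => /forallNP H.
have [lv vE] := fnorm_L2 lh.
have : sqnrm mu (fun=> Num.sqrt (2 * eta)) <= eta.
  apply: le_trans heta; rewrite -vE; apply: ip_le => // [|p]; first exact: cst_L2.
  rewrite !ger0_norm ?sqrtr_ge0// ler_wsqrtr// ltW// ltNge; exact/negP.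
rewrite ip_cst sqr_sqrtr; last by rewrite mulr_ge0// ltW.
by lra.
Qed.

Lemma ip_variance (g : T -> R) : g \in Lfun mu 2%:E ->
  sqnrm mu (fun p => g p - \int[mu]_q g q) =
  ip mu g g - (\int[mu]_q g q) ^+ 2.
Proof.
move=> lg; set c := \int[mu]_q g q.
have l1 : (fun=> 1 : R) \in Lfun mu 2%:E := cst_L2 mu 1.
have lc : (fun=> c : R) \in Lfun mu 2%:E := cst_L2 mu c.
rewrite (ip_sqrB lg lc) ip_cst.
have -> : ip mu g (fun=> c) = c * c.
  rewrite ipC (@eq_ip _ _ _ _ (fun=> c) (fun=> c * 1) g g) => [|x|x]//; last by rewrite mulr1.
  rewrite (ipZl c l1 lg) ipC /ip -/c; congr (_ * _).
  by apply: eq_Rintegral => x _; rewrite mulr1.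
by ring.
Qed.

Lemma ip_sqrD_le (f g : T -> R) : f \in Lfun mu 2%:E -> g \in Lfun mu 2%:E ->
  sqnrm mu (fun x => f x + g x) <= 2 * ip mu f f + 2 * ip mu g g.
Proof.
move=> lf lg; have := ip_ge0 mu (fun x => f x - g x).
rewrite (ip_sqrB lf lg) (ip_sqrD lf lg); lra.
Qed.

End Probability.

(** Here [G] is the value at a point of a function with mean [C], variance [W] and mean square [I].
    The main error is [2 C (G - C)], at most [4 t M = 1/64]; the others are of the order of
    [t ^+ 2]. *)
Lemma sqr_near (R : realFieldType) (G C W I M t : R) :
  `|C| <= 2 * M -> `|G - C| <= t -> 0 <= W -> W <= t ^+ 2 / 2 -> W = I - C ^+ 2 ->
  t * M = 256^-1 -> 0 <= t <= 256^-1 -> `|G ^+ 2 - I| <= 32^-1.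
Proof.
move=> C2 GC W0 Weta WE tM /andP[t0 t1].
have -> : G ^+ 2 - I = (G - C) ^+ 2 + 2 * C * (G - C) - W by rewrite WE; ring.
have h1 : (G - C) ^+ 2 <= t ^+ 2.
  by rewrite -[X in X <= _](real_normK (num_real _)) ler_sqr ?nnegrE.
have h2 : `|2 * C * (G - C)| <= 4 * (t * M).
  rewrite normrM (normrM 2) normr_nat.
  have : `|C| * `|G - C| <= 2 * M * t by apply: ler_pM.
  by lra.
have h3 : t ^+ 2 <= 256^-1 * 256^-1 by rewrite expr2; apply: ler_pM.
rewrite tM in h2; have h4 := sqr_ge0 (G - C).
by move: h2; rewrite !ler_norml => /andP[h2 h2']; apply/andP; split; lra.
Qed.

(** Polarization of a Gram matrix with off-diagonal entry [a] and diagonal entries [b], [b']. The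
    last two hypotheses put [b] and [b'] within [r / 4] of [M], which leaves [3 r / 4] for [a]. *)
Lemma polar_near (R : realFieldType) (a b b' I M r : R) :
  `|b + b' + 2 * a - M * (2 + 2 * I)| <= r -> `|b + b + 2 * b - M * (2 + 2 * 1)| <= r ->
  `|b' + b' + 2 * b' - M * (2 + 2 * 1)| <= r -> `|a - M * I| <= r.
Proof.
by rewrite !ler_norml => /andP[h1 h2] /andP[h3 h4] /andP[h5 h6]; apply/andP; split; lra.
Qed.

(** The cubic terms cancel, and [M ^+ 2] has the coefficient [1/4 + 1/256] on the left against 1 on
    the right. So an absolute error of [1/16] in the entries is harmless for every number of
    squares. *)
Lemma gram_numeric (R : realFieldType) (M : R) : 1 <= M ->
  M * ((M + 16^-1) ^+ 2 + M * 16^-1 ^+ 2) < (M + 1) * (M - 16^-1) ^+ 2.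
Proof. by move=> M1; nra. Qed.

Section Gap.
Variables (R : realType) (O : origami_datum) (N : nat).
Local Notation m := (nsquares O).
Local Notation mu := (@square_measure R).
Local Notation surf := (surface R O).
Local Notation nu := (surface_measure R O).
Local Notation sigma := (origami_sigma O).
Local Notation tau := (origami_tau O).
Hypotheses (sigmaN : (sigma ^+ N)%g = 1%g) (tauN : (tau ^+ N)%g = 1%g) (N3 : (3 <= N)%N).
Implicit Types f g : surf -> R.
Local Notation L2 := (Lfun nu 2%:E).

Lemma drift_ge0 f : 0 <= drift N f.
Proof. by rewrite addr_ge0// ip_ge0. Qed.

Lemma driftD f g : f \in L2 -> g \in L2 ->
  drift N (fun x => f x + g x) <= 2 * drift N f + 2 * drift N g.
Proof.
move=> lf lg; rewrite /drift.
have H (T : surf -> surf) : (fun x => f (T x)) \in L2 -> (fun x => g (T x)) \in L2 ->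
    sqnrm nu (fun x => f (T x) + g (T x) - (f x + g x)) <=
    2 * sqnrm nu (fun x => f (T x) - f x) +
    2 * sqnrm nu (fun x => g (T x) - g x).
  move=> lfT lgT; have := ip_sqrD_le (L2B lfT lf) (L2B lgT lg).
  have -> // : (fun x => f (T x) - f x + (g (T x) - g x)) = (fun x => f (T x) + g (T x) - (f x + g x)).
  by apply/funext => x; ring.
have A := H _ (twist_L2 1 sigmaN lf) (twist_L2 1 sigmaN lg).
have B := H _ (vtwist_L2 1 tauN lf) (vtwist_L2 1 tauN lg).
by rewrite !mulrDr [X in _ <= X]addrACA; exact: lerD A B.
Qed.

Lemma driftZ c f : f \in L2 -> drift N (fun x => c * f x) = c ^+ 2 * drift N f.
Proof.
move=> lf; rewrite /drift mulrDr.
have H (T : surf -> surf) : (fun x => f (T x)) \in L2 ->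
    sqnrm nu (fun x => c * f (T x) - c * f x) =
    c ^+ 2 * sqnrm nu (fun x => f (T x) - f x).
  move=> lfT; rewrite -(ip_sqrZ c (L2B lfT lf)).
  by apply: eq_ip => x; rewrite mulrBr.
by rewrite (H _ (twist_L2 1 sigmaN lf)) (H _ (vtwist_L2 1 tauN lf)).
Qed.

(** Induction on [K]: with the earlier functions fixed, a sufficiently invariant new one is almost
    orthogonal to each of them by [ev_ip]. *)
Lemma almost_orthogonal_family (e0 delta : R) : 0 < e0 -> 0 < delta ->
  (forall e, 0 < e -> exists2 u : surf -> R, almost_invariant N e u & ip nu u u = 1) ->
  forall K, exists u : nat -> surf -> R,
    (forall i, (i < K)%N -> almost_invariant N e0 (u i) /\ sqnrm nu (u i) = 1) /\
    (forall i j, (i < K)%N -> (j < K)%N -> i != j -> `|ip nu (u i) (u j)| <= delta).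
Proof.
move=> e00 d0 H; elim=> [|K [u [u1 u2]]]; first by exists (fun _ _ => 0); split.
have [] : eventually_holds N (fun f => forall i, i \in iota 0 K -> `|ip nu f (u i)| <= delta).
  apply: ev_all => i; rewrite mem_iota add0n => /andP[_ iK].
  by have [[lu _ _ _] _] := u1 _ iK; exact: (ev_ip sigmaN tauN (ltnW N3) lu d0).
move=> e e1 He; have [|v vI v1] := H (Num.min e e0); first by rewrite lt_min e1.
have vI0 : almost_invariant N e0 v by apply: almost_invariant_le vI; rewrite ge_min lexx orbT.
have vd i : (i < K)%N -> `|ip nu v (u i)| <= delta.
  move=> iK; apply: (He v); last by rewrite mem_iota.
  by apply: almost_invariant_le vI; rewrite ge_min lexx.
exists (fun i => if i == K then v else u i); split.
  by move=> i; rewrite ltnS leq_eqVlt; case: eqP => //= _ iK; exact: u1.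
have cs i : (i < K.+1)%N -> i = K \/ ((i == K) = false /\ (i < K)%N).
  by rewrite ltnS leq_eqVlt; case: eqP => [->|_] /= h; [left|right].
move=> i j /cs[->|[-> iK]] /cs[->|[-> jK]]; rewrite ?eqxx//.
- by move=> _; exact: vd.
- by move=> _; rewrite ipC; exact: vd.
- exact: u2.
Qed.

(** At a suitable point [p] the [m + 1] vectors [v i] of values over [p] have a Gram matrix within
    [1/16] of [m] times the identity, entry by entry, against [gram_trace]. *)
Lemma no_almost_invariant : exists2 e : R, 0 < e &
  forall u : surf -> R, almost_invariant N e u -> ip nu u u <> 1.
Proof.
apply: contrapT => nogap.
have H e : 0 < e -> exists2 u : surf -> R, almost_invariant N e u & ip nu u u = 1.
  move=> e0; apply: contrapT => nu'; apply: nogap; exists e => // u uI u1.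
  by apply: nu'; exists u.
pose M : R := m%:R; have M1 : 1 <= M by rewrite ler1n nsquares_gt0.
have M0 : 0 < M by lra.
(* The allowed deviation of the fibre norms from their means at [p]. The means can be as large as
   [2 M], so [t] is inversely proportional to [M]. *)
pose t : R := (256 * M)^-1; have t0 : 0 < t by rewrite invr_gt0; lra.
have tM : t * M = 256^-1 by rewrite /t; field; rewrite gt_eqF.
have t1 : t <= 256^-1 by rewrite -tM ler_peMr// ltW.
(* The 2 is the loss in [exists_small_point]. *)
pose eta := t ^+ 2 / 2; have eta0 : 0 < eta by rewrite divr_gt0// exprn_gt0.
pose K := m.+1.
(* A sum [F i j] has drift at most [4 * e], so by [fibre_norm_gap] its fibre norm has variance at
   most [128 * M * e]. The [K * K] variances then add up to at most [eta]. *)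
pose e := eta / (128 * M * (K%:R * K%:R)).
have K0 : 0 < K%:R :> R by rewrite ltr0n.
have e0 : 0 < e by rewrite divr_gt0// !mulr_gt0.
(* Makes [M * delta = 1/32], half of the error allowed off the diagonal; polarization takes the
   other half. *)
pose delta := (32 * M)^-1; have d0 : 0 < delta by rewrite invr_gt0; lra.
have [u [u1 u2]] := almost_orthogonal_family e0 d0 H K.
have lu (i : 'I_K) : u i \in L2 by have [[]] := u1 i (ltn_ord i).
have uu (i : 'I_K) : sqnrm nu (u i) = 1 by have [] := u1 i (ltn_ord i).
have ud (i : 'I_K) : drift N (u i) <= e by have [[]] := u1 i (ltn_ord i).
(* The pairs with [i = j] are included, since they yield the diagonal of the Gram matrix. *)
pose F (i j : 'I_K) x := u i x + u j x.
have lF i j : F i j \in L2 by exact: L2D.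
have FF i j : sqnrm nu (F i j) = 2 + 2 * ip nu (u i) (u j).
  by rewrite /F ip_sqrD// !uu; ring.
have FF4 i j : sqnrm nu (F i j) <= 4.
  by have := ip_sqrD_le (lu i) (lu j); rewrite !uu /F; lra.
pose g i j := fibre_norm (F i j).
have lg i j : g i j \in Lfun mu 2%:E := (fibre_norm_L2 (lF i j)).1.
have gg i j : sqnrm mu (g i j) = M * sqnrm nu (F i j) := (fibre_norm_L2 (lF i j)).2.
pose c i j := \int[mu]_q g i j q.
pose V i j := sqnrm mu (fun p => g i j p - c i j).
have VE i j : V i j = sqnrm mu (g i j) - c i j ^+ 2 := ip_variance (lg i j).
have Ve i j : V i j <= eta / (K%:R * K%:R).
  apply: (le_trans (fibre_norm_gap sigmaN tauN N3 (lF i j))).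
  rewrite -/(drift N (F i j)).
  have D : drift N (F i j) <= 4 * e.
    by have := driftD (lu i) (lu j); have := ud i; have := ud j; rewrite /F; lra.
  apply: (@le_trans _ _ (32 * M * (4 * e))); first by rewrite ler_wpM2l// mulr_ge0// ltW.
  rewrite /e le_eqVlt; apply/orP; left; apply/eqP; field.
  by rewrite !gt_eqF.
have V0 i j : 0 <= V i j by exact: ip_ge0.
have Veta i j : V i j <= eta.
  apply: (le_trans (Ve i j)); rewrite ler_pdivrMr ?mulr_gt0// ler_peMr ?(ltW eta0)//.
  have K1 : 1 <= K%:R :> R by rewrite ler1n.
  exact: mulr_ege1.
have c2M i j : `|c i j| <= 2 * M.
  rewrite -ler_sqr ?nnegrE ?mulr_ge0 ?(ltW M0)// real_normK ?num_real//.
  have := V0 i j; rewrite VE gg subr_ge0 => /le_trans; apply.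
  rewrite [X in _ <= X](_ : _ = M * (4 * M)); last by ring.
  rewrite ler_wpM2l ?(ltW M0)// (le_trans (FF4 i j))// ler_peMr//.
pose h (a : 'I_(#|{: 'I_K * 'I_K}|)) p := g (enum_val a).1 (enum_val a).2 p - c (enum_val a).1 (enum_val a).2.
have [||p Hp] := exists_small_point (h := h) (mu := mu) _ eta0.
- by move=> a; apply: L2B => //; exact: cst_L2.
- apply: (@le_trans _ _ (\sum_(a < #|{: 'I_K * 'I_K}|) eta / (K%:R * K%:R))).
    by apply: ler_sum => a _; exact: Ve.
  rewrite sumr_const card_ord card_prod card_ord -[X in X <= _]mulr_natr natrM.
  by rewrite divfK// gt_eqF// mulr_gt0.
have gc i j : `|g i j p - c i j| <= t.
  rewrite -ler_sqr ?nnegrE ?(ltW t0)// real_normK ?num_real//.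
  have -> : t ^+ 2 = 2 * eta by rewrite /eta; lra.
  apply: le_trans Hp; rewrite (bigD1 (enum_rank (i, j)))//= /h enum_rankK lerDl.
  by apply: sumr_ge0 => a _; exact: sqr_ge0.
pose rho : R := 32^-1.
have gF i j : `|g i j p ^+ 2 - M * sqnrm nu (F i j)| <= rho.
  rewrite -gg; apply: (sqr_near (c2M i j) (gc i j) (V0 i j) (Veta i j) (VE i j) tM).
  by rewrite t1 ltW.
pose v (i : 'I_K) (k : 'I_m) := u i (develop k (p.1, p.2 - (Num.floor p.2)%:~R)).
have gv i j : g i j p ^+ 2 = \sum_k v i k ^+ 2 + \sum_k v j k ^+ 2 + 2 * \sum_k v i k * v j k.
  rewrite /g /fibre_norm sqr_fnorm mulr_sumr -!big_split /=; apply: eq_bigr => k _.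
  by rewrite /F /v; ring.
pose q i j := \sum_k v i k * v j k.
have qii i : q i i = \sum_k v i k ^+ 2 by apply: eq_bigr => k _; rewrite expr2.
have qM i j : `|q i j - M * ip nu (u i) (u j)| <= rho.
  apply: (@polar_near _ _ (q i i) (q j j)).
  - by have := gF i j; rewrite gv FF -!qii.
  - by have := gF i i; rewrite gv FF -!qii uu.
  - by have := gF j j; rewrite gv FF -!qii uu.
pose th : R := 16^-1.
have qdiag i : M - th <= q i i <= M + th.
  have := qM i i; rewrite uu mulr1 ler_norml /rho /th => /andP[h1 h2]; apply/andP; split; lra.
have qoff i j : j != i -> q i j ^+ 2 <= th ^+ 2.
  move=> ij; have := qM i j; have := u2 i j (ltn_ord i) (ltn_ord j); rewrite eq_sym => /(_ ij) I1 h1.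
  rewrite -[X in X <= _](real_normK (num_real _)) ler_sqr ?nnegrE /th//.
  have dM : M * delta = 32^-1 by rewrite /delta; field; rewrite gt_eqF.
  have h2 : `|M * ip nu (u i) (u j)| <= 32^-1 by rewrite normrM gtr0_norm// -dM ler_wpM2l// ltW.
  by rewrite -[q i j](subrK (M * ip nu (u i) (u j))) (le_trans (ler_normD _ _))// (le_trans (lerD h1 h2))// /rho; lra.
have := gram_trace v; rewrite -/M.
have S1 : K%:R * (M - th) <= \sum_i \sum_k v i k ^+ 2.
  rewrite mulr_natl -[X in _ *+ X]card_ord -sumr_const; apply: ler_sum => i _; rewrite -qii.
  by have /andP[] := qdiag i.
have S2 : \sum_i \sum_j (\sum_k v i k * v j k) ^+ 2 <= K%:R * ((M + th) ^+ 2 + M * th ^+ 2).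
  rewrite mulr_natl -[X in _ *+ X]card_ord -sumr_const; apply: ler_sum => i _.
  rewrite (bigD1 i)//=; apply: lerD.
    rewrite -/(q i i); have /andP[h1 h2] := qdiag i.
    by rewrite ler_sqr ?nnegrE//; rewrite /th in h1 h2 *; lra.
  apply: (@le_trans _ _ (\sum_(j < K | j != i) th ^+ 2)).
    by apply: ler_sum => j ji; exact: qoff.
  rewrite sumr_const mulr_natl (_ : #|_| = m)//.
  by have := cardC1 i; rewrite card_ord.
have KM : K%:R = M + 1 by rewrite /K -natr1.
move=> S; have Kth : 0 <= K%:R * (M - th) by rewrite mulr_ge0 ?(ltW K0)// /th; lra.
have S3 : (K%:R * (M - th)) ^+ 2 <= M * (K%:R * ((M + th) ^+ 2 + M * th ^+ 2)).
  apply: le_trans (le_trans S _); last by rewrite ler_wpM2l// ltW.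
  by rewrite ler_sqr ?nnegrE// (le_trans Kth).
have {}S3 : K%:R * (M - th) ^+ 2 <= M * ((M + th) ^+ 2 + M * th ^+ 2).
  by rewrite -(ler_pM2l K0); move: S3; rewrite exprMn expr2 -mulrA [X in _ <= X]mulrCA.
by rewrite KM leNgt gram_numeric in S3.
Qed.

Lemma gap : exists2 kappa : R, 0 < kappa &
  forall f, f \in L2 -> ip nu f (fun=> 1) = 0 -> kappa * ip nu f f <= drift N f.
Proof.
have [e e0 He] := no_almost_invariant; exists e => // f lf f0.
have [->|ff] := eqVneq (ip nu f f) 0; first by rewrite mulr0 drift_ge0.
have {}ff : 0 < ip nu f f by rewrite lt_def ff ip_ge0.
rewrite leNgt; apply/negP => fe.
pose c := (Num.sqrt (ip nu f f))^-1.
have c2 : c ^+ 2 * ip nu f f = 1 by rewrite exprVn sqr_sqrtr ?ltW// mulVf// gt_eqF.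
have c0 : 0 < c ^+ 2 by rewrite exprn_gt0// invr_gt0 sqrtr_gt0.
have u1 : sqnrm nu (fun x => c * f x) = 1 by rewrite ip_sqrZ.
apply: (He (fun x => c * f x) _ u1); split.
- exact: L2Z.
- by rewrite u1.
- by rewrite ipZl ?f0 ?mulr0//; exact: cst_L2.
- by rewrite driftZ// -[e]mulr1 -c2 mulrCA ler_wpM2l ?ltW.
Qed.

End Gap.

(** * From one generating pair to all generating sets *)

Section GapExpansion.
Context (R : realType) (G : groupType) (disp : measure_display) (X : measurableType disp).
Variables (mu : probability X R) (act : G -> X -> X).
Hypothesis actG : group_action act.
Hypothesis mact : forall g, measurable_fun setT (act g).
Hypothesis integral_act : forall g (F : X -> \bar R), measurable_fun setT F ->
  (forall x, 0 <= F x)%E -> (\int[mu]_x F (act g x) = \int[mu]_x F x)%E.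
Implicit Types (f : X -> R) (g h : G).
Local Notation L2 := (Lfun mu 2%:E).

Let displacement f g := nrm mu (fun x => f (act g x) - f x).
Local Notation D := displacement.

Lemma actK g : cancel (act g) (act g^-1%g).
Proof. by move=> x; rewrite -actG.2 mulVg actG.1. Qed.

Lemma actVK g : cancel (act g^-1%g) (act g).
Proof. by move=> x; rewrite -actG.2 mulgV actG.1. Qed.

Let act_L2 g f : f \in L2 -> (fun x => f (act g x)) \in L2.
Proof. exact: (comp_L2 (mact g) (integral_act g)). Qed.

Let nrm_act g f : f \in L2 -> nrm mu (fun x => f (act g x)) = nrm mu f.
Proof.
by move=> lf; rewrite /nrm (ip_comp (mact g) (integral_act g) lf lf).
Qed.

Lemma displacementM f g h : f \in L2 -> D f (g * h)%g <= D f g + D f h.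
Proof.
move=> lf; have lB := L2B (act_L2 g lf) lf.
rewrite /D -(nrm_act h lB).
have -> : (fun x => f (act (g * h)%g x) - f x) =
    (fun x => (f (act g (act h x)) - f (act h x)) + (f (act h x) - f x)).
  by apply/funext => x; rewrite subrKA actG.2.
apply: nrm_triangle; first exact: (act_L2 h lB).
by apply: L2B => //; exact: act_L2.
Qed.

Lemma displacement1 f : D f 1%g = 0.
Proof.
rewrite /D (_ : (fun x => _) = (fun=> 0)); last first.
  by apply/funext => x; rewrite actG.1 subrr.
by rewrite /nrm ip0l sqrtr0.
Qed.

(** [translate] acts through the inverse; composing with [act g] preserves the norm and turns the
    displacement by [g^-1] into that by [g]. *)
Lemma displacement_translate f g : f \in L2 ->
  nrm mu (fun x => translate act g f x - f x) = D f g.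
Proof.
move=> lf; rewrite -(nrm_act g); last by apply: L2B => //; exact: act_L2.
by rewrite /translate nrm_subC; congr nrm; apply/funext => x; rewrite actK.
Qed.

Lemma displacement_prod f (S : {fset G}) (w : seq G) : f \in L2 ->
  {subset w <= S} -> D f (\prod_(x <- w) x)%g <= (size w)%:R * \sum_(s <- S) D f s.
Proof.
move=> lf; elim: w => [|x w IH] wS; first by rewrite big_nil displacement1 mul0r.
rewrite big_cons (le_trans (displacementM _ _ lf))// -nat1r mulrDl mul1r lerD//; last first.
  by apply: IH => y yw; apply: wS; rewrite inE yw orbT.
rewrite (big_fsetD1 x) /=; last by apply: wS; rewrite mem_head.
by rewrite lerDl sumr_ge0// => s _; exact: nrm_ge0.
Qed.

Variables (a b : G) (kappa : R).
Hypothesis kappa0 : 0 < kappa.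
Hypothesis gapab : forall f, f \in L2 -> ip mu f (fun=> 1) = 0 ->
  kappa * ip mu f f <= D f a ^+ 2 + D f b ^+ 2.
Variable S : {fset G}.
Hypothesis genS : symmetric_generating_set S.

Lemma gap_generating : exists2 k : R, 0 < k &
  forall f, f \in L2 -> ip mu f (fun=> 1) = 0 ->
    k * nrm mu f <= \sum_(s <- S) nrm mu (fun x => translate act s f x - f x).
Proof.
have [_ _ H] := genS; have [wa waS aE] := H a; have [wb wbS bE] := H b.
(* The summand 1 keeps [n] positive even if both words are empty. *)
pose n : R := (size wa)%:R + (size wb)%:R + 1.
have n0 : 0 < n by rewrite ltr_wpDl// addr_ge0.
exists (Num.sqrt kappa / n); first by rewrite divr_gt0// sqrtr_gt0.
move=> f lf f0; under eq_bigr do rewrite (displacement_translate _ lf).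
set T := \sum_(s <- S) D f s.
have T0 : 0 <= T by apply: sumr_ge0 => s _; exact: nrm_ge0.
have Da : D f a <= (size wa)%:R * T by rewrite aE displacement_prod.
have Db : D f b <= (size wb)%:R * T by rewrite bE displacement_prod.
have Dn : D f a ^+ 2 + D f b ^+ 2 <= (n * T) ^+ 2.
  apply: (@le_trans _ _ ((D f a + D f b) ^+ 2)).
    rewrite sqrrD -addrA lerD2l lerDr mulrn_wge0// mulr_ge0 ?nrm_ge0//.
  rewrite ler_sqr ?nnegrE ?addr_ge0 ?nrm_ge0 ?mulr_ge0 ?(ltW n0)//.
  rewrite (le_trans (lerD Da Db))// -mulrDl ler_wpM2r// /n lerDl//.
rewrite mulrAC ler_pdivrMr// mulrC [X in _ <= X]mulrC.
rewrite -ler_sqr ?nnegrE ?mulr_ge0 ?sqrtr_ge0 ?nrm_ge0 ?(ltW n0)//.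
rewrite (le_trans _ Dn)// exprMn sqr_nrm sqr_sqrtr ?(ltW kappa0)// mulrC.
exact: gapab.
Qed.

Lemma gap_spectral : spectral_gap S mu act.
Proof.
have [k k0 Hk] := gap_generating; exists k => // f lf f0.
have f1 : ip mu f (fun=> 1) = 0.
  rewrite /ip /Rintegral (_ : (\int[mu]_x _ = 0)%E)//.
  by rewrite -f0; apply: eq_integral => x _; rewrite mulr1.
rewrite Lnorm_nrm// -EFinM.
rewrite (eq_bigr (fun s => (nrm mu (fun x => translate act s f x - f x))%:E)) => [|s _].
  by rewrite sumEFin lee_fin Hk.
by rewrite -Lnorm_nrm//; apply: L2B => //; exact: act_L2.
Qed.

Lemma ip_indic (A B : set X) : measurable A -> measurable B ->
  ip mu \1_A \1_B = fine (mu (A `&` B)).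
Proof.
move=> mA mB; rewrite /ip /Rintegral; congr fine.
under eq_integral do rewrite -[_ * _]/((\1_A \* \1_B) _) -indicI.
by rewrite integral_indic ?setIT//; exact: measurableI.
Qed.

(** For [f] the centred indicator of [U], the squared displacement by [s] is the measure of the
    symmetric difference of [U] and its image. Both lie in the union [V], as [S] contains 1, and
    have the measure [u], so this is at most [2 * (v - u)]. On the other hand
    [ip mu f f = u - u ^+ 2] is at least [u / 2]. *)
Lemma gap_expanding : expanding_in_measure S mu act.
Proof.
have [k k0 Hk] := gap_generating; have [S1 _ _] := genS.
pose n : R := #|` S|%:R.
have n0 : 0 < n by rewrite ltr0n cardfs_gt0; apply/fset0Pn; exists 1%g.
(* Comes from [k^2 u / 2 <= n^2 * 2 (v - u)], where [n] is the number of elements of [S]. *)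
exists (k ^+ 2 / (4 * n ^+ 2)); first by rewrite divr_gt0 ?exprn_gt0// mulr_gt0 ?exprn_gt0.
move=> U mU U0 U2.
have imE s : act s @` U = act s^-1%g @^-1` U.
  apply/seteqP; split => [_ [x Ux <-]|x Ux]; first by rewrite /= actK.
  by exists (act s^-1%g x) => //; rewrite actVK.
have mim s : measurable (act s @` U).
  by rewrite imE -[X in measurable X]setTI; exact: mact.
pose V := \bigcup_(s in [set` S]) (act s @` U).
have mV : measurable V by apply: fin_bigcup_measurable => // s _; exact: mim.
have UV : U `<=` V by move=> x Ux; exists 1%g => //; exists x => //; rewrite actG.1.
have finmu A : measurable A -> mu A = (fine (mu A))%:E.
  by move=> mA; rewrite fineK// fin_num_measure.
pose u := fine (mu U); pose v := fine (mu V).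
have u0 : 0 < u by rewrite -lte_fin -finmu.
have u2 : u <= 2^-1.
  rewrite -lee_fin -finmu//; apply: (le_trans U2).
  by rewrite -[X in (_ * X)%E]/(mu setT) probability_setT mule1.
have lI A : measurable A -> (\1_A : X -> R) \in L2.
  move=> mA; apply: (@bounded_L2 _ _ _ _ _ 1) => [|x]; first exact: measurable_indic.
  by rewrite indicE; case: (_ \in _); rewrite ?normr1 ?normr0.
have l1 : (fun=> 1 : R) \in L2 := cst_L2 mu 1.
have lc : (fun=> u : R) \in L2 := cst_L2 mu u.
have IU1 : ip mu \1_U (fun=> 1) = u.
  rewrite (@eq_ip _ _ _ mu _ \1_U _ (\1_[set: X])) ?ip_indic ?setIT// => x.
  by rewrite indicT.
have ipc f : f \in L2 -> ip mu f (fun=> u) = u * ip mu f (fun=> 1).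
  move=> lf; rewrite ipC [in RHS]ipC -ipZl//.
  by apply: eq_ip => // x; rewrite mulr1.
pose f x := \1_U x - u.
have lf : f \in L2 by apply: L2B => //; exact: lI.
have f0 : ip mu f (fun=> 1) = 0.
  rewrite /f (ipBl (lI _ mU) lc l1) IU1 [X in _ - X]ipC ipc// ip_cst; ring.
have ff : ip mu f f = u - u ^+ 2.
  by rewrite /f (ip_sqrB (lI _ mU) lc) ipc ?lI// IU1 ip_cst ip_indic// setIid -/u; ring.
have T2 s : s \in S -> nrm mu (fun x => translate act s f x - f x) ^+ 2 <= 2 * (v - u).
  move=> sS; rewrite sqr_nrm.
  have -> : sqnrm mu (fun x => translate act s f x - f x) =
      sqnrm mu (fun x => \1_(act s @` U) x - \1_U x).
    have tE x : translate act s f x - f x = \1_(act s @` U) x - \1_U x.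
      rewrite /translate /f opprB addrA subrK; congr (_ - _).
      by rewrite imE !indicE.
    exact: eq_ip.
  rewrite (ip_sqrB (lI _ (mim s)) (lI _ mU)) !ip_indic// !setIid.
  have sU : fine (mu (act s @` U)) = u.
    rewrite imE; congr fine.
    have mE : measurable_fun setT (fun x => (\1_U x)%:E : \bar R).
      by apply/measurable_EFinP; exact: measurable_indic.
    have h : (\int[mu]_x (\1_U (act s^-1%g x))%:E = \int[mu]_x (\1_U x)%:E)%E.
      by apply: (integral_act _ mE) => x; rewrite lee_fin indicE ler0n.
    have e1 : (\int[mu]_x (\1_U x)%:E = mu U)%E by rewrite integral_indic ?setIT.
    have mP : measurable (act s^-1%g @^-1` U) by rewrite -imE.
    have e2 : (\int[mu]_x (\1_(act s^-1%g @^-1` U) x)%:E = mu (act s^-1%g @^-1` U))%E.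
      by rewrite integral_indic ?setIT.
    rewrite -e1 -e2 -h; apply: eq_integral => x _; by rewrite !indicE.
  have sUV : act s @` U `<=` V by move=> x sx; exists s.
  have H : u <= fine (mu (act s @` U `&` U)) + (v - u).
    have mDV : measurable (V `\` U) by exact: measurableD.
    have mDs : measurable (act s @` U `\` U) by exact: measurableD.
    have E1 : u = fine (mu (act s @` U `\` U)) + fine (mu (act s @` U `&` U)).
      apply: EFin_inj; rewrite -[LHS]/(u%:E) -sU EFinD -!finmu//; last exact: measurableI.
      exact: measureDI.
    have E2 : v = fine (mu (V `\` U)) + u.
      apply: EFin_inj; rewrite EFinD -!finmu//.
      by rewrite (measureDI mu mV mU) setIC setIidl.
    have E3 : fine (mu (act s @` U `\` U)) <= fine (mu (V `\` U)).
      rewrite -lee_fin -!finmu//; apply: le_measure; rewrite ?inE//.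
      exact: setSD.
    by rewrite [X in X <= _]E1; lra.
  by rewrite -/u sU; lra.
have nf : k * nrm mu f <= n * Num.sqrt (2 * (v - u)).
  apply: (le_trans (Hk _ lf f0)).
  apply: (@le_trans _ _ (\sum_(s <- S) Num.sqrt (2 * (v - u)))).
    rewrite big_seq [X in _ <= X]big_seq; apply: ler_sum => s sS.
    by rewrite -[X in X <= _]ger0_norm ?nrm_ge0// -sqrtr_sqr ler_wsqrtr// T2.
  by rewrite big_const_seq count_predT iter_addr_0 -[X in X <= _]mulr_natl.
have uv : 0 <= v - u.
  by have := le_trans (sqr_ge0 _) (T2 _ S1); rewrite pmulr_rge0.
have {}nf : k ^+ 2 * (u - u ^+ 2) <= n ^+ 2 * (2 * (v - u)).
  rewrite -ff -sqr_nrm -[X in _ <= _ * X]sqr_sqrtr ?mulr_ge0// -!exprMn.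
  by rewrite ler_sqr ?nnegrE ?mulr_ge0 ?sqrtr_ge0 ?nrm_ge0 ?(ltW k0) ?(ltW n0).
suff : (1 + k ^+ 2 / (4 * n ^+ 2)) * u <= v.
  by rewrite -lee_fin EFinM -!finmu.
rewrite mulrDl mul1r -lerBrDl mulrAC ler_pdivrMr ?mulr_gt0 ?exprn_gt0//.
have h : k ^+ 2 * (u / 2) <= k ^+ 2 * (u - u ^+ 2).
  by rewrite ler_wpM2l ?sqr_ge0//; nra.
by lra.
Qed.

End GapExpansion.

(** * The action of the free group *)

Section FreeAction.
Variables (R : realType) (O : origami_datum) (N : nat).
Local Notation surf := (surface R O).
Local Notation nu := (surface_measure R O).
Hypotheses (sigmaN : (origami_sigma O ^+ N)%g = 1%g) (tauN : (origami_tau O ^+ N)%g = 1%g).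
Local Notation letter2 := (letter 'I_2).

Definition letter_act (l : letter2) (x : surf) : surf :=
  let c : int := if l.2 then 1 else - 1 in
  if l.1 == ord0 then twist N c x else vtwist N c x.

Definition word_act (w : seq letter2) (x : surf) : surf := foldr letter_act x w.
Definition twist_act (g : free_group 'I_2) (x : surf) : surf := word_act (val g) x.

Lemma letter_actK l x : letter_act l (letter_act (letter_inv l) x) = x.
Proof.
have twK c y : twist N c (twist N (- c) y : surf) = y by rewrite (twistD sigmaN) addrN (twist0 sigmaN).
have vK c y : vtwist N c (vtwist N (- c) y : surf) = y.
  by rewrite -{1}[c]opprK (vtwistK tauN).
case: l => i b; rewrite /letter_act /letter_inv /=.
have twN y : twist N (- 1) (twist N 1 y : surf) = y by rewrite -{2}[1]opprK twK.
have vN y : vtwist N (- 1) (vtwist N 1 y : surf) = y by rewrite -{2}[1]opprK vK.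
by case: (i == ord0); case: b => /=; [exact: twK|exact: twN|exact: vK|exact: vN].
Qed.

Lemma word_act_push l w x : word_act (word_push l w) x = letter_act l (word_act w x).
Proof.
case: w => [|l' w] //=; case: eqP => [->|_] //=.
by rewrite letter_actK.
Qed.

Lemma word_act_mul u v x : word_act (word_mul u v) x = word_act u (word_act v x).
Proof. by elim: u => //= l u IH; rewrite word_act_push IH. Qed.

Lemma twist_act_group : group_action twist_act.
Proof. by split => [x|g h x] //; rewrite /twist_act -word_act_mul. Qed.

Lemma word_act_ind (P : (surf -> surf) -> Prop) : P id ->
  (forall f g : surf -> surf, P f -> P g -> P (fun x => f (g x))) ->
  (forall c, P (twist N c)) -> (forall c, P (vtwist N c)) -> forall w, P (word_act w).
Proof.
move=> P1 PM Pt Pv; elim=> [|l w IH]; first exact: P1.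
apply: (PM (letter_act l)) => //; rewrite /letter_act.
by case: (l.1 == ord0).
Qed.

Lemma twist_act_continuous g : continuous (twist_act g).
Proof.
apply: (@word_act_ind (fun f => continuous f)) => [x|f h fc hc|c|c].
- exact: cvg_id.
- exact: continuous_comp_fun hc fc.
- exact: twist_continuous.
- exact: vtwist_continuous.
Qed.

Lemma twist_act_lipschitz g : lipschitz_map length_dist (twist_act g).
Proof.
suff [L _ HL] : exists2 L : R, 0 < L &
    forall x y, (length_dist (twist_act g x) (twist_act g y) <= L%:E * length_dist x y)%E by exists L.
apply: (@word_act_ind (fun f => exists2 L : R, 0 < L &
    forall x y, (length_dist (f x) (f y) <= L%:E * length_dist x y)%E)) => [|f h|c|c].
- by exists 1 => // x y; rewrite mul1e.
- move=> [L L0 fL] [M M0 hM]; exists (L * M); first exact: mulr_gt0.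
  move=> x y; rewrite (le_trans (fL _ _))// EFinM -muleA lee_wpmul2l ?lee_fin ?(ltW L0)//.
- exact: twist_lipschitz.
- exact: vtwist_lipschitz.
Qed.

Lemma twist_act_homeomorphism g : homeomorphism (twist_act g).
Proof.
exists (twist_act g^-1%g); split; try exact: twist_act_continuous.
- exact: (actK twist_act_group).
- exact: (actVK twist_act_group).
Qed.

Lemma measurable_twist_act g : measurable_fun setT (twist_act g).
Proof. by apply: continuous_surfaces_measurable; exact: twist_act_continuous. Qed.

Lemma ge0_integral_twist_act g (F : surf -> \bar R) : measurable_fun setT F ->
  (forall x, 0 <= F x)%E -> (\int[nu]_x F (twist_act g x) = \int[nu]_x F x)%E.
Proof.
move=> mF F0; move: F mF F0.
suff [_ H] : measurable_fun setT (twist_act g) /\ forall F : surf -> \bar R,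
    measurable_fun setT F -> (forall x, 0 <= F x)%E ->
    (\int[nu]_x F (twist_act g x) = \int[nu]_x F x)%E by exact: H.
apply: (@word_act_ind (fun f => measurable_fun setT f /\ forall F : surf -> \bar R,
    measurable_fun setT F -> (forall x, 0 <= F x)%E ->
    (\int[nu]_x F (f x) = \int[nu]_x F x)%E)) => [|f h|c|c].
- by split.
- move=> [mf fE] [mh hE]; split; first exact: measurableT_comp mf mh.
  move=> F mF F0; rewrite -(fE F mF F0).
  exact: (hE _ (measurableT_comp mF mf) (fun x => F0 (f x))).
- by split; [exact: measurable_twist|exact: ge0_integral_twist].
- by split; [exact: measurable_vtwist|exact: ge0_integral_vtwist].
Qed.

Lemma twist_act_measure_preserving g : measure_preserving nu (twist_act g).
Proof.
apply: measure_preserving_integral; first exact: measurable_twist_act.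
exact: ge0_integral_twist_act.
Qed.

End FreeAction.

Theorem theorem1 (R : realType) (O : origami_datum) :
  exists act : free_group 'I_2 -> surface R O -> surface R O,
    [/\ group_action act,
        forall g, homeomorphism (act g) /\ lipschitz_map length_dist (act g),
        forall g, measure_preserving (surface_measure R O) (act g),
        forall S : {fset free_group 'I_2}, symmetric_generating_set S ->
          expanding_in_measure S (surface_measure R O) act &
        forall S : {fset free_group 'I_2}, symmetric_generating_set S ->
          spectral_gap S (surface_measure R O) act].
Proof.
(* The factor 3 ensures [3 <= N] even when both permutations are trivial, as for the one-square
   torus. *)
pose N := (3 * (#[origami_sigma O]%g * #[origami_tau O]%g))%N.
have sN : (origami_sigma O ^+ N)%g = 1%g.
  by rewrite /N mulnCA expgM expg_order expg1n.
have tN : (origami_tau O ^+ N)%g = 1%g.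
  by rewrite /N mulnA mulnC expgM expg_order expg1n.
have N3 : (3 <= N)%N by rewrite leq_pmulr// muln_gt0 !order_gt0.
pose gen (i : 'I_2) : free_group 'I_2 := exist _ [:: (i, true)] isT.
have [kappa k0 Hk] := @gap R O N sN tN N3.
have Hk' (f : surface R O -> R) : f \in Lfun (surface_measure R O) 2%:E ->
    ip (surface_measure R O) f (fun=> 1) = 0 ->
    kappa * ip (surface_measure R O) f f <=
    nrm (surface_measure R O) (fun x => f (@twist_act R O N (gen ord0) x) - f x) ^+ 2 +
    nrm (surface_measure R O) (fun x => f (@twist_act R O N (gen ord_max) x) - f x) ^+ 2.
  by move=> lf f0; rewrite !sqr_nrm; exact: Hk.
have actG := @twist_act_group R O N sN tN.
have mact := @measurable_twist_act R O N sN tN.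
have iact := @ge0_integral_twist_act R O N sN tN.
exists (@twist_act R O N); split.
- exact: actG.
- by move=> g; split; [exact: twist_act_homeomorphism|exact: twist_act_lipschitz].
- exact: twist_act_measure_preserving.
- by move=> S genS; exact: (gap_expanding actG mact iact k0 Hk' genS).
- by move=> S genS; exact: (gap_spectral actG mact iact k0 Hk' genS).
Qed.
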